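(* Assume that there exist a Fréchet differentiable functional $V:\mathcal{L}^2(0,1;\mathbb{R}^n)\to\mathbb{R}_{\ge0}$ and constants $c_1,c_2,c_3,\chi\in\mathbb{R}_{>0}$ such that for each $d\in\mathcal{L}^2(0,1;\mathbb{R}^q)$ and each $\zeta\in\mathcal{D}(\mathcal{A})$, $$c_1\|\zeta\|^2_{\mathcal{L}^2(0,1;\mathbb{R}^n)}\le V(\zeta)\le c_2\|\zeta\|^2_{\mathcal{L}^2(0,1;\mathbb{R}^n)},$$ $$DV(\zeta)(\mathcal{A}\zeta+\mathcal{N}d)\le -c_3V(\zeta)+\chi^2\|d\|^2_{\mathcal{L}^2(0,1;\mathbb{R}^q)} .$$ Let $(X,d)$ be a mild solution pair to $\dot X=\mathcal{A}X+\mathcal{N}d$ with initial condition $X(0)=X_0$. Then, for all $t\in\mathrm{dom}\,X$, $$\|X(t)\|_{\mathcal{L}^2(0,1;\mathbb{R}^n)}\le e^{-\frac{c_3}{2}t}\left(\frac{c_2}{c_1}\right)^{\frac12}\|X_0\|_{\mathcal{L}^2(0,1;\mathbb{R}^n)}+\frac{\chi}{\sqrt{c_1}}\sqrt{\int_0^t\|d(\theta)\|^2_{\mathcal{L}^2(0,1;\mathbb{R}^q)}\,d\theta}.$$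
   Context: Data: $\Lambda\in\mathbb{R}^{n\times n}$ is diagonal positive definite, $H\in\mathbb{R}^{n\times n}$, $B\in\mathbb{R}^{n\times m}$, $N\in\mathbb{R}^{n\times q}$, $K\in\mathbb{R}^{m\times n}$, and $H_{cl}:=H+BK$. $DV(\zeta)$ denotes the Fréchet derivative of $V$ at $\zeta$. Saturation levels $\overline u_1,\dots,\overline u_m>0$ are given; $\sigma:\mathbb{R}^m\to\mathbb{R}^m$ is defined by $\sigma(u)_i=\min(|u_i|,\overline u_i)\,\mathrm{sign}(u_i)$, and $\phi(u):=\sigma(u)-u$. Operators: $\mathcal{A}X:=-\Lambda X_z$ with domain $\mathcal{D}(\mathcal{A}):=\{X\in\mathcal{H}^1(0,1;\mathbb{R}^n):\ X(0)=H_{cl}X(1)+B\phi(KX(1))\}$; $\mathcal{N}:\mathcal{L}^2(0,1;\mathbb{R}^q)\to\mathcal{L}^2(0,1;\mathbb{R}^n)$, $(\mathcal{N}d)(z)=Nd(z)$. $\epsilon$-approximate solution on $[0,T]$, for $\epsilon>0$ and $f:=\mathcal{N}d\in\mathcal{L}^1(0,T;\mathcal{L}^2(0,1;\mathbb{R}^n))$: choose a partition $0=t_0<t_1<\dots<t_M\le T$ with $t_i-t_{i-1}<\epsilon$ for all $i$ and $T-\epsilon<t_M\le T$, and elements $f_1,\dots,f_M\in\mathcal{L}^2(0,1;\mathbb{R}^n)$ with $\sum_{i=1}^M\int_{t_{i-1}}^{t_i}\|f(s)-f_i\|\,ds<\epsilon$. An $\epsilon$-approximate solution with initial condition $X_0$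 is a piecewise constant function $w:[0,t_M]\to\mathcal{L}^2(0,1;\mathbb{R}^n)$ with $w(0)=w_0$, $w=w_i$ on $(t_{i-1},t_i]$, where $w_i\in\mathcal{D}(\mathcal{A})$ and $\frac{w_i-w_{i-1}}{t_i-t_{i-1}}=\mathcal{A}w_i+f_i$ for $i=1,\dots,M$, and $\|w_0-X_0\|\le\epsilon$. Mild solution pair: a pair $(X,d)$ with $\mathrm{dom}\,X=\mathrm{dom}\,d=I$, where $I$ is $[0,T]$ ($T>0$) or $[0,\infty)$, $X\in\mathcal{C}(I;\mathcal{L}^2(0,1;\mathbb{R}^n))$, $d\in\mathcal{L}^1(I;\mathcal{L}^2(0,1;\mathbb{R}^q))$, $X(0)=X_0\in\mathcal{L}^2(0,1;\mathbb{R}^n)$, such that for each $\epsilon>0$ there is an $\epsilon$-approximate solution $w$ of $\dot X=\mathcal{A}X+\mathcal{N}d$ with $\|X(t)-w(t)\|\le\epsilon$ for all $t$ in the domain of $w$ (when $I=[0,\infty)$, this is required of the restriction of $(X,d)$ to $[0,T]$, for every $T>0$). The integral $\int_0^t\|d(\theta)\|^2d\theta$ is taken in $[0,\infty]$, the bound being vacuous when it is infinite. *)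

(* Defs.v *)
From HB Require Import structures.
From mathcomp Require Import all_boot all_order all_algebra.
From mathcomp Require Import all_classical all_reals all_analysis.
From mathcomp Require Import generic_quotient ring_quotient.
From mathcomp Require Import measurable_realfun ring.

Set Implicit Arguments.
Unset Strict Implicit.
Unset Printing Implicit Defensive.
Import Order.TTheory GRing.Theory Num.Theory.
Import numFieldNormedType.Exports.
Local Open Scope classical_set_scope.
Local Open Scope ring_scope.
Local Open Scope quotient_scope.

Section EuclideanNorm.
Context {R : realType} {n : nat}.
Implicit Types u v : 'cV[R]_n.

Definition enorm v : R := Num.sqrt (\sum_i v i 0 ^+ 2).

Lemma sum_sqr_ge0 v : 0 <= \sum_i v i 0 ^+ 2.
Proof. by apply: sumr_ge0 => i _; exact: sqr_ge0. Qed.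

Lemma enorm_ge0 v : 0 <= enorm v. Proof. exact: sqrtr_ge0. Qed.

Lemma enorm_sqr v : enorm v ^+ 2 = \sum_i v i 0 ^+ 2.
Proof. by rewrite sqr_sqrtr// sum_sqr_ge0. Qed.

Lemma enorm0 : enorm 0 = 0.
Proof.
by rewrite /enorm big1 ?sqrtr0// => i _; rewrite mxE expr0n.
Qed.

Lemma enorm0_eq0 v : enorm v = 0 -> v = 0.
Proof.
move=> v0; have : enorm v ^+ 2 = 0 by rewrite v0 expr0n.
rewrite enorm_sqr => /eqP; rewrite psumr_eq0; last by move=> i _; exact: sqr_ge0.
move=> /allP h; apply/matrixP => i j; rewrite (ord1 j) mxE.
by apply/eqP; rewrite -sqrf_eq0; apply: h; rewrite mem_index_enum.
Qed.

Lemma enormZ a v : enorm (a *: v) = `|a| * enorm v.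
Proof.
rewrite /enorm -sqrtr_sqr -sqrtrM ?sqr_ge0// mulr_sumr; congr Num.sqrt.
by apply: eq_bigr => i _; rewrite mxE exprMn.
Qed.

Lemma le_coord_enorm v i : `|v i 0| <= enorm v.
Proof.
rewrite -sqrtr_sqr ler_wsqrtr// (bigD1 i)//= lerDl.
by apply: sumr_ge0 => j _; exact: sqr_ge0.
Qed.

Lemma dot_le_enorm u v : \sum_i u i 0 * v i 0 <= enorm u * enorm v.
Proof.
set a := \sum_i u i 0 ^+ 2; set b := \sum_i v i 0 ^+ 2.
set c := \sum_i _.
suff cab : c ^+ 2 <= a * b.
  rewrite /enorm -sqrtrM ?sum_sqr_ge0//.
  by rewrite (le_trans (ler_norm _))// -sqrtr_sqr ler_wsqrtr.
have b0 : 0 <= b by exact: sum_sqr_ge0.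
have [bz|bnz] := eqVneq b 0.
  have vz : v = 0 by apply: enorm0_eq0; rewrite /enorm -/b bz sqrtr0.
  by rewrite /c big1 ?expr0n ?mulr_ge0 ?sum_sqr_ge0// => i _; rewrite vz mxE mulr0.
have bp : 0 < b by rewrite lt_def bnz.
have : 0 <= \sum_i (b * u i 0 - c * v i 0) ^+ 2.
  by apply: sumr_ge0 => i _; exact: sqr_ge0.
have -> : \sum_i (b * u i 0 - c * v i 0) ^+ 2 = b * (a * b - c ^+ 2).
  transitivity (b ^+ 2 * a - (b * c *+ 2) * c + c ^+ 2 * b); last by ring.
  rewrite (mulr_sumr _ _ _ (b ^+ 2)) (mulr_sumr _ _ _ (b * c *+ 2)).
  rewrite (mulr_sumr _ _ _ (c ^+ 2)) -sumrB -big_split/=.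
  by apply: eq_bigr => i _; ring.
by rewrite pmulr_rge0// subr_ge0.
Qed.

Lemma enormD u v : enorm (u + v) <= enorm u + enorm v.
Proof.
rewrite -(@ler_pXn2r _ 2)// ?nnegrE ?addr_ge0 ?enorm_ge0//.
rewrite sqrrD !enorm_sqr.
have -> : \sum_i (u + v) i 0 ^+ 2 =
    \sum_i u i 0 ^+ 2 + (\sum_i u i 0 * v i 0) *+ 2 + \sum_i v i 0 ^+ 2.
  rewrite -sumrMnl -!big_split/=; apply: eq_bigr => i _.
  by rewrite mxE sqrrD.
by rewrite lerD2r lerD2l lerMn2r dot_le_enorm orbT.
Qed.

End EuclideanNorm.

Lemma enorm_mulmx_le {R : realType} n q (M : 'M[R]_(n, q)) :
  exists C : R, forall v, enorm (M *m v) <= C * enorm v.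
Proof.
exists (\sum_j enorm (col j M)) => v.
have -> : M *m v = \sum_j v j 0 *: col j M.
  apply/matrixP => i k; rewrite (ord1 k) mxE summxE.
  by apply: eq_bigr => j _; rewrite !mxE mulrC.
elim/big_ind2 : _ => [|x1 x2 y1 y2 h1 h2|j _].
- by rewrite enorm0 mul0r.
- by rewrite (le_trans (enormD _ _))// mulrDl lerD.
- by rewrite enormZ mulrC ler_wpM2l ?enorm_ge0// le_coord_enorm.
Qed.

(* Lebesgue measure on ]0, 1[, as a measure on the whole line that ignores the
   complement of ]0, 1[. *)
Definition mu01 (R : realType) : {measure set (measurableTypeR R) -> \bar R} :=
  mrestr (@lebesgue_measure R) (measurable_itv `]0, 1[).

Section PreL2.
Context (R : realType) (n : nat).

(* Square-integrable functions before identification modulo null sets; values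
   outside ]0, 1[ are irrelevant and get quotiented out below. *)
Definition sqint : {pred R -> 'cV[R]_n} :=
  mem [set f : R -> 'cV[R]_n |
    (forall i, measurable_fun setT (fun z => f z i 0)) /\
    finite_norm (@mu01 R) 2%:E (enorm \o f)].

Lemma measurable_enorm (f : R -> 'cV[R]_n) :
  (forall i, measurable_fun setT (fun z => f z i 0)) ->
  measurable_fun setT (enorm \o f).
Proof.
move=> mf; apply: (@measurableT_comp _ _ _ _ _ _ (@Num.sqrt R)).
  by apply: continuous_measurable_fun; exact: sqrt_continuous.
by apply: measurable_sum => i; exact: measurable_funX.
Qed.

Lemma measurable_Lnorm2_integrand (f : R -> R) : measurable_fun setT f ->
  measurable_fun setT (fun x => (`|(EFin \o f) x| `^ 2)%E).
Proof.
move=> mf; apply: (measurableT_comp (measurable_poweR _)) => //.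
by apply: measurableT_comp => //; exact/measurable_EFinP.
Qed.

Lemma le_Lnorm2 (f g : R -> R) : measurable_fun setT f ->
  measurable_fun setT g -> (forall z, `|f z| <= `|g z|) ->
  ('N[@mu01 R]_2%:E[EFin \o f] <= 'N[@mu01 R]_2%:E[EFin \o g])%E.
Proof.
move=> mf mg fg.
rewrite unlock; apply: gt0_ler_poweR.
- by rewrite invr_ge0.
- by rewrite in_itv/= leey andbT integral_ge0// => x _; exact: poweR_ge0.
- by rewrite in_itv/= leey andbT integral_ge0// => x _; exact: poweR_ge0.
apply: ge0_le_integral; first exact: measurableT.
- by move=> x _; exact: poweR_ge0.
- exact: measurable_Lnorm2_integrand.
- exact: measurable_Lnorm2_integrand.
move=> x _; apply: gt0_ler_poweR => //.
- by rewrite in_itv/= leey andbT lee_fin.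
- by rewrite in_itv/= leey andbT lee_fin.
- by rewrite /= lee_fin.
Qed.

Lemma eq_ae_Lnorm2 (f g : R -> R) : measurable_fun setT f ->
  measurable_fun setT g -> {ae @mu01 R, forall z, f z = g z} ->
  ('N[@mu01 R]_2%:E[EFin \o f] = 'N[@mu01 R]_2%:E[EFin \o g])%E.
Proof.
move=> mf mg fg; rewrite unlock; congr (_ `^ _)%E.
apply: ae_eq_integral => //.
- exact: measurable_Lnorm2_integrand.
- exact: measurable_Lnorm2_integrand.
apply: (@filterS _ _ (ae_filter_ringOfSetsType (@mu01 R))) fg => z fg _.
by rewrite /= fg.
Qed.

Lemma sqintP (f : R -> 'cV[R]_n) :
  reflect ((forall i, measurable_fun setT (fun z => f z i 0)) /\
    finite_norm (@mu01 R) 2%:E (enorm \o f)) (f \in sqint).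
Proof. by apply: (iffP idP); rewrite inE. Qed.

Lemma Lfun_enorm f : f \in sqint -> (enorm \o f) \in Lfun (@mu01 R) 2%:E.
Proof.
move=> /sqintP[mf ff]; apply/andP; split; rewrite inE//=.
exact: measurable_enorm.
Qed.

Lemma sqint_submod_closed : submod_closed sqint.
Proof.
split.
  apply/sqintP; split; first by move=> i; rewrite (_ : (fun _ => _) = cst 0);
    [exact: measurable_cst|apply/funext => z; rewrite mxE].
  rewrite (_ : _ \o _ = cst 0); first exact: (finite_norm_cst0 _ (lee1n 2)).
  by apply/funext => z /=; rewrite enorm0.
move=> a f g fS gS.
have [mf _] := sqintP _ fS; have [mg _] := sqintP _ gS.
have mfg i : measurable_fun setT (fun z => (a *: f + g) z i 0).
  rewrite (_ : (fun _ => _) = (fun z => a * f z i 0 + g z i 0)).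
    by apply: measurable_funD => //; exact: measurable_funM.
  by apply/funext => z; rewrite !mxE.
apply/sqintP; split => //.
have /andP[] := (Lfun_submod_closed (@mu01 R) (lee1n 2)).2 `|a| _ _
  (Lfun_enorm fS) (Lfun_enorm gS).
rewrite !inE/= => mh nh.
apply: (le_lt_trans (le_Lnorm2 (measurable_enorm mfg) mh _) nh).
move=> z; rewrite /= (ger0_norm (enorm_ge0 _)).
apply: le_trans (ler_norm _) => /=.
by rewrite (le_trans (enormD _ _))// enormZ.
Qed.

HB.instance Definition _ := GRing.isSubmodClosed.Build R _ sqint
  sqint_submod_closed.

Definition preL2 := {f : R -> 'cV[R]_n | f \in sqint}.
HB.instance Definition _ := [isSub of preL2 for @sval _ _].
HB.instance Definition _ := [Choice of preL2 by <:].
HB.instance Definition _ := [SubChoice_isSubLmodule of preL2 by <:].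

Definition ae_null : {pred preL2} :=
  mem [set f : preL2 | {ae @mu01 R, forall z, val f z = 0}].

Lemma ae_null_zmod_closed : zmod_closed ae_null.
Proof.
split; first by rewrite inE/=; apply: aeW => z.
move=> f g; rewrite !inE/= => f0 g0.
apply: (@filterS2 _ _ (ae_filter_ringOfSetsType (@mu01 R))) f0 g0.
by move=> z f0 g0; rewrite [LHS](_ : _ = sval f z - sval g z)// f0 g0 subr0.
Qed.

HB.instance Definition _ := GRing.isZmodClosed.Build preL2 ae_null
  ae_null_zmod_closed.

Definition L2 : Type := Quotient.quot ae_null.
HB.instance Definition _ := GRing.Zmodule.on L2.
HB.instance Definition _ := EqQuotient.on L2.

Definition toL2 (f : preL2) : L2 := \pi_L2 f.
Definition L2_fun (x : L2) : R -> 'cV[R]_n := val (repr x).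
Local Coercion L2_fun : L2 >-> Funclass.

Lemma toL2_eqP (f g : preL2) :
  toL2 f = toL2 g <-> {ae @mu01 R, forall z, val f z = val g z}.
Proof.
have -> : toL2 f = toL2 g <-> f - g \in ae_null.
  rewrite Quotient.idealrBE; split; first by move=> fg; apply/eqP.
  by move/eqP.
rewrite inE/=; split; apply: (@filterS _ _ (ae_filter_ringOfSetsType (@mu01 R))).
  by move=> z /eqP; rewrite [X in X == _](_ : _ = sval f z - sval g z)// subr_eq0 => /eqP.
by move=> z fg; rewrite [LHS](_ : _ = sval f z - sval g z)// fg subrr.
Qed.

Lemma toL2K x : toL2 (repr x) = x. Proof. exact: reprK. Qed.

Lemma toL2_fun (f : preL2) : {ae @mu01 R, forall z, toL2 f z = val f z}.
Proof. by apply/toL2_eqP; rewrite toL2K. Qed.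

Lemma L2_eqP (x y : L2) : x = y <-> {ae @mu01 R, forall z, x z = y z}.
Proof. by rewrite -[x in x = _]toL2K -[y in _ = y]toL2K toL2_eqP. Qed.

Lemma toL2D (f g : preL2) : toL2 (f + g) = toL2 f + toL2 g.
Proof. by rewrite /toL2 !piE. Qed.

Lemma toL20 : toL2 0 = 0.
Proof. by rewrite /toL2 !piE. Qed.

Lemma L2D (x y : L2) : {ae @mu01 R, forall z, (x + y : L2) z = x z + y z}.
Proof.
have -> : x + y = toL2 (repr x + repr y) by rewrite toL2D !toL2K.
exact: toL2_fun.
Qed.

Lemma L20 : {ae @mu01 R, forall z, (0 : L2) z = 0}.
Proof. by rewrite -toL20; exact: toL2_fun. Qed.

Definition L2_scale (a : R) (x : L2) : L2 := toL2 (a *: repr x).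

Lemma toL2Z a (f : preL2) : toL2 (a *: f) = L2_scale a (toL2 f).
Proof.
apply/toL2_eqP; apply: (@filterS _ _ (ae_filter_ringOfSetsType (@mu01 R))) (toL2_fun f).
by move=> z fz; rewrite [LHS](_ : _ = a *: sval f z)// -fz.
Qed.

Fact L2_scalerA a b x : L2_scale a (L2_scale b x) = L2_scale (a * b) x.
Proof. by rewrite -[x]toL2K -!toL2Z scalerA. Qed.
Fact L2_scale1r : left_id 1 L2_scale.
Proof. by move=> x; rewrite -[x]toL2K -!toL2Z scale1r. Qed.
Fact L2_scalerDr : right_distributive L2_scale +%R.
Proof.
by move=> a x y; rewrite -[x]toL2K -[y]toL2K -!(toL2D, toL2Z) scalerDr.
Qed.
Fact L2_scalerDl x : {morph L2_scale^~ x : a b / a + b}.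
Proof. by move=> a b; rewrite -[x]toL2K -!(toL2D, toL2Z) scalerDl. Qed.

HB.instance Definition _ := GRing.Zmodule_isLmodule.Build R L2
  L2_scalerA L2_scale1r L2_scalerDr L2_scalerDl.

Lemma L2Z a (x : L2) : {ae @mu01 R, forall z, (a *: x : L2) z = a *: x z}.
Proof. exact: toL2_fun. Qed.

(* The norm (\int_0^1 |x(z)|^2 dz)^(1/2). *)
Definition L2_norm (x : L2) : R := fine ('N[@mu01 R]_2%:E[EFin \o (enorm \o x)])%E.

Lemma L2_funP (x : L2) : (x : R -> 'cV[R]_n) \in sqint.
Proof. exact: valP. Qed.

Lemma L2_normE x : (L2_norm x)%:E = ('N[@mu01 R]_2%:E[EFin \o (enorm \o x)])%E.
Proof.
rewrite /L2_norm fineK// ge0_fin_numE ?Lnorm_ge0//.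
by have /sqintP[] := L2_funP x.
Qed.

Lemma L2_measurable (x : L2) i : measurable_fun setT (fun z => x z i 0).
Proof. by have /sqintP[] := L2_funP x. Qed.

Lemma L2_measurable_enorm (x : L2) : measurable_fun setT (enorm \o x).
Proof. by apply: measurable_enorm; exact: L2_measurable. Qed.

Fact L2_normD (x y : L2) : L2_norm (x + y) <= L2_norm x + L2_norm y.
Proof.
rewrite -lee_fin EFinD !L2_normE.
have le12 : (1 <= 2%:E :> \bar R)%E by rewrite lee1n.
pose h z := enorm (x z) + enorm (y z).
have mh : measurable_fun setT h.
  by apply: measurable_funD; exact: L2_measurable_enorm.
have : ('N[@mu01 R]_2%:E[EFin \o h] <= 'N[@mu01 R]_2%:E[EFin \o (enorm \o x)] +
    'N[@mu01 R]_2%:E[EFin \o (enorm \o y)])%E.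
  exact: (@eminkowski _ _ _ (@mu01 R) _ _ _ (L2_measurable_enorm x)
    (L2_measurable_enorm y) le12).
apply: le_trans.
have mxy : measurable_fun setT (fun z => enorm (x z + y z)).
  apply: (@measurable_enorm (fun z => x z + y z)) => i.
  rewrite (_ : (fun _ => _) = (fun z => x z i 0 + y z i 0)).
    by apply: measurable_funD; exact: L2_measurable.
  by apply/funext => z; rewrite mxE.
rewrite (@eq_ae_Lnorm2 _ (fun z => enorm (x z + y z))) => //.
- apply: le_Lnorm2 => // z; rewrite (ger0_norm (enorm_ge0 _)).
  exact: le_trans (enormD _ _) (ler_norm _).
- exact: L2_measurable_enorm.
- apply: (@filterS _ _ (ae_filter_ringOfSetsType (@mu01 R))) (L2D x y) => z /= -> //.
Qed.

Fact L2_normZ a (x : L2) : L2_norm (a *: x) = `|a| * L2_norm x.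
Proof.
apply/EFin_inj; rewrite EFinM !L2_normE.
have xL := Lfun_enorm (L2_funP x).
have := LnormZ (Lfun_Sub (lee1n 2) xL) a.
rewrite Lfun_valP => <-.
rewrite -[in RHS]Lnorm_abse.
apply: (@eq_ae_Lnorm2 _ (fun z => `|a * enorm (x z)|)) => //.
- exact: L2_measurable_enorm.
- apply: measurableT_comp => //; apply: measurable_funM => //.
  exact: L2_measurable_enorm.
- apply: (@filterS _ _ (ae_filter_ringOfSetsType (@mu01 R))) (L2Z a x) => z /= ->.
  by rewrite enormZ normrM (ger0_norm (enorm_ge0 _)).
Qed.

Fact L2_norm_eq0 (x : L2) : L2_norm x = 0 -> x = 0.
Proof.
move=> x0; have : ('N[@mu01 R]_2%:E[EFin \o (enorm \o x)])%E = 0%E by rewrite -L2_normE x0.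
move=> /Lnorm_eq0_eq0 h; apply/L2_eqP.
have {}h : {ae @mu01 R, forall z, enorm (x z) = 0}.
  have mx : measurable_fun setT (EFin \o (enorm \o x)).
    by apply/measurable_EFinP; exact: L2_measurable_enorm.
  have p0 : (0 < 2%:E :> \bar R)%E by rewrite lte_fin.
  move: (h mx p0).
  apply: (@filterS _ _ (ae_filter_ringOfSetsType (@mu01 R))) => z /(_ Logic.I).
  by move=> [].
apply: (@filterS2 _ _ (ae_filter_ringOfSetsType (@mu01 R))) h L20 => z /= xz ->.
exact: enorm0_eq0.
Qed.

HB.instance Definition _ := @Lmodule_isNormed.Build R L2
  L2_norm L2_normD L2_normZ L2_norm_eq0.

End PreL2.
Coercion L2_fun : L2 >-> Funclass.

Section MatrixAction.
Context {R : realType} {n q : nat}.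

Lemma mulmx_sqint (M : 'M[R]_(n, q)) (f : R -> 'cV[R]_q) :
  f \in @sqint R q -> (fun z => M *m f z) \in @sqint R n.
Proof.
move=> /[dup] fS /sqintP[mf _].
have mMf i : measurable_fun setT (fun z => (M *m f z) i 0).
  rewrite (_ : (fun _ => _) = (fun z => \sum_j M i j * f z j 0)).
    by apply: measurable_sum => j; exact: measurable_funM.
  by apply/funext => z; rewrite mxE.
apply/sqintP; split => //.
have [C MC] := enorm_mulmx_le M.
have /andP[] := (Lfun_submod_closed (@mu01 R) (lee1n 2)).2 C _ _
  (Lfun_enorm fS) (Lfun_submod_closed (@mu01 R) (lee1n 2)).1.
rewrite !inE/= => mh nh.
apply: (le_lt_trans (le_Lnorm2 (measurable_enorm mMf) mh _) nh).
move=> z; rewrite /= (ger0_norm (enorm_ge0 _)).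
apply: le_trans (ler_norm _); apply: (le_trans (MC _)).
by rewrite [leRHS](_ : _ = C * enorm (f z) + 0)// addr0.
Qed.

Definition mulmx_pre (M : 'M[R]_(n, q)) (f : preL2 R q) : preL2 R n :=
  exist (fun g => g \in @sqint R n) _ (mulmx_sqint M (valP f)).

Definition mulmxL2 (M : 'M[R]_(n, q)) (x : L2 R q) : L2 R n :=
  toL2 (mulmx_pre M (repr x)).

Lemma mulmxL2E M x : {ae @mu01 R, forall z, mulmxL2 M x z = M *m x z}.
Proof. exact: toL2_fun. Qed.

End MatrixAction.

Section Sobolev.
Context {R : realType} {n : nat}.

(* Test functions: C^1 with compact support in ]0, 1[ (they determine the same
   weak derivatives as smooth ones). *)
Definition C1c01 (phi : R -> R) : Prop :=
  [/\ forall z, derivable phi z 1,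
      continuous (derive1 phi) &
      exists a b, [/\ 0 < a, b < 1 &
        forall z, z \notin `[a, b] -> phi z = 0]].

Definition weak_deriv (x y : L2 R n) : Prop :=
  forall phi, C1c01 phi -> forall i,
    \int[lebesgue_measure]_(z in `]0, 1[) (x z i 0 * derive1 phi z) =
    - \int[lebesgue_measure]_(z in `]0, 1[) (y z i 0 * phi z).

Definition H1 : set (L2 R n) := [set x | exists y, weak_deriv x y].

(* The weak derivative is unique, so the choice made by xget is immaterial on
   H1; outside H1 the value is the junk value 0. *)
Definition dz (x : L2 R n) : L2 R n := xget 0 [set y | weak_deriv x y].

(* For x in H1, the boundary values x(0) and x(1) are the values of its
   continuous representative on [0, 1], which is unique. *)
Definition cont_repr (x : L2 R n) (xc : R -> 'cV[R]_n) : Prop :=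
  (forall i, {within `[0, 1], continuous (fun z => xc z i 0)}) /\
  {ae @mu01 R, forall z, x z = xc z}.

End Sobolev.

Section Plant.
Context {R : realType} {n m : nat}.

Definition sat (ubar u : 'cV[R]_m) : 'cV[R]_m :=
  \col_i (Num.min `|u i 0| (ubar i 0) * Num.sg (u i 0)).

Definition deadzone (ubar u : 'cV[R]_m) : 'cV[R]_m := sat ubar u - u.

Definition opA (Lambda : 'M[R]_n) (x : L2 R n) : L2 R n :=
  - mulmxL2 Lambda (dz x).

Definition domA (H : 'M[R]_n) (B : 'M[R]_(n, m)) (K : 'M[R]_(m, n))
    (ubar : 'cV[R]_m) : set (L2 R n) :=
  [set x | H1 x /\ exists xc, cont_repr x xc /\
    xc 0 = (H + B *m K) *m xc 1 + B *m deadzone ubar (K *m xc 1)].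

End Plant.

Section MildSolutions.
Context {R : realType}.
Local Notation mu := (@lebesgue_measure R).

Section Bochner.
Context {V : normedModType R}.

Definition simple_on (I : set R) (s : R -> V) : Prop :=
  finite_set (s @` I) /\ forall v, measurable (I `&` s @^-1` [set v]).

Definition strongly_measurable (I : set R) (f : R -> V) : Prop :=
  exists s : nat -> R -> V, (forall k, simple_on I (s k)) /\
    {ae mu, forall t, I t -> s k t @[k --> \oo] --> f t}.

Definition bochner_L1 (I : set R) (f : R -> V) : Prop :=
  strongly_measurable I f /\ (\int[mu]_(t in I) `|f t|%:E < +oo)%E.

End Bochner.

Section Evolution.
Context {V : normedModType R}.
Variables (A : V -> V) (DA : set V).

(* f_i and w_i are fs i and ws i; fs 0 is unused, and w only matters on
   [0, tM]. *)
Definition eps_approx_solution (f : R -> V) (x0 : V) (T eps tM : R)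
    (w : R -> V) : Prop :=
  exists (M : nat) (t : nat -> R) (fs ws : nat -> V),
    [/\ [/\ (0 < M)%N, t 0%N = 0, t M = tM,
            forall i, (i < M)%N -> t i < t i.+1 < t i + eps &
            T - eps < tM <= T],
        (\sum_(i < M) \int[mu]_(s in `[t i, t i.+1]) `|f s - fs i.+1|%:E
          < eps%:E)%E,
        forall i, (i < M)%N -> DA (ws i.+1) /\
          (t i.+1 - t i)^-1 *: (ws i.+1 - ws i) = A (ws i.+1) + fs i.+1,
        w 0 = ws 0%N /\ (forall i, (i < M)%N ->
          forall s, t i < s <= t i.+1 -> w s = ws i.+1) &
        `|ws 0%N - x0| <= eps].

Definition mild_on (f : R -> V) (x0 : V) (X : R -> V) (T : R) : Prop :=
  forall eps, 0 < eps -> exists tM w,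
    eps_approx_solution f x0 T eps tM w /\
    forall t, 0 <= t <= tM -> `|X t - w t| <= eps.

(* f = N d; functions of time are total, but only their values on I matter. *)
Definition mild_pair {W : normedModType R} (N : W -> V) (x0 : V) (I : set R)
    (X : R -> V) (d : R -> W) : Prop :=
  [/\ {within I, continuous X}, bochner_L1 I d, X 0 = x0 &
      (exists T, [/\ 0 < T, I = `[0, T]%classic & mild_on (N \o d) x0 X T]) \/
      (I = `[0, +oo[%classic /\ forall T, 0 < T -> mild_on (N \o d) x0 X T)].

End Evolution.
End MildSolutions.

(* Main.v *)
Require Import Defs.
From HB Require Import structures.
From mathcomp Require Import all_boot all_order all_algebra.
From mathcomp Require Import all_classical all_reals all_analysis.
From mathcomp Require Import measurable_realfun ring lra.

(** Why the estimate holds.  Along a solution of the equation that is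
    differentiable as a curve in L^2, the chain rule and the dissipation
    inequality give d/dt V(X) <= - c3 V(X) + chi^2 |d|^2, whence
    V(X(t)) <= exp(- c3 t) V(X_0) + chi^2 int_0^t |d|^2, and the bounds on V
    turn this into the claim.  A mild solution is only a uniform limit of
    implicit Euler polygons, so V cannot be differentiated along it; the proof
    compares it with solutions that are differentiable and passes to the limit.

    - Differentiable solutions are built by characteristics ([evolution]).  The
      i-th component is a stationary profile that absorbs the forcing plus a
      wave in the variable t - z / l_i.  The saturation creates corners
      only where its argument crosses a saturation level with nonzero slope; such
      points are isolated, hence countable in number.  Therefore Lipschitz
      functions that are differentiable off a countable set ([cc]) are stable under everything the boundary condition
      does ([cc_clamp]), they are primitives of their derivative ([cc_prim]), and
      their first-order expansions are uniform off a set of small measure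
      ([cc_unif]), so that the waves are differentiable curves in L^2.  The
      construction is valid for one short time step, with a disturbance that is
      constant in time and smooth in space, and it ends in a state of the same
      kind, so that it can be iterated ([chain]).

    - The operator A is quasi-dissipative for a weighted inner product
      ([opA_dissipative]): the boundary map is Lipschitz, and a weight that grows
      with z makes the energy flowing out at z = 1 dominate the energy flowing in
      at z = 0.  Comparing the implicit Euler steps of a mild solution with a
      differentiable solution is then a discrete Gronwall argument
      ([compare_piece]).  It bounds the distance of the two by the distance of
      the initial states plus the L^1 distance of the forcings.

    - The disturbance is approximated in L^2 in time by step functions on a
      uniform grid with smooth values ([stepappr_L2], [forcing_approx]), and the
      initial state by smooth functions with compact support, which satisfy the
      boundary condition because it maps 0 to 0 ([L2_dense], [C1c01_nice]).

    Together these give, arbitrarily close to X_0 and X(t), states at which V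
    satisfies the integrated inequality up to an arbitrarily small error
    ([approximate_decay]); the error then tends to 0 ([mild_bound]). *)

Import Order.TTheory GRing.Theory Num.Theory.
Import numFieldNormedType.Exports.
Local Open Scope classical_set_scope.
Local Open Scope ring_scope.
Set Implicit Arguments.
Unset Strict Implicit.
Unset Printing Implicit Defensive.

Local Notation ae_filterS := (@filterS _ _ (ae_filter_ringOfSetsType (@lebesgue_measure _))) (only parsing).
Local Notation ae_filterS2 := (@filterS2 _ _ (ae_filter_ringOfSetsType (@lebesgue_measure _))) (only parsing).
Local Notation ae_filterS3 := (@filterS3 _ _ (ae_filter_ringOfSetsType (@lebesgue_measure _))) (only parsing).

(** * Absolutely continuous functions and weak derivatives *)

Section RealAnalysis.
Context {R : realType}.
Local Notation mu := (@lebesgue_measure R).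

(** Both sides are measures in [A] that agree on half-open intervals. *)
Lemma lebesgue_measure_affine (a b : R) (A : set R) : a != 0 -> measurable A ->
  mu ((fun z => a * z + b) @^-1` A) = (`|a|^-1%:E * mu A)%E.
Proof.
move=> a0 mA.
have maff : measurable_fun setT (fun z : measurableTypeR R => (a * z + b : measurableTypeR R)).
  by apply: measurable_funD => //; exact: measurable_funM.
pose phi : {mfun measurableTypeR R >-> measurableTypeR R} := HB.pack (fun z : measurableTypeR R => (a * z + b : measurableTypeR R)) (isMeasurableFun.Build _ _ _ _ _ maff).
pose m := mscale (NngNum (normr_ge0 a)) (pushforward mu phi).
have H A' : measurable A' -> mu A' = m maff A'.
  apply: lebesgue_measure_unique => _ [[x y]] /= _ <-.
  rewrite /m /mscale /= /pushforward /=.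
  have /orP[an|ap] : (a < 0) || (0 < a) by rewrite -neq_lt.
    2:{
    have -> : (fun z => a * z + b) @^-1` `]x, y] = `](x-b)/a, (y-b)/a]%classic.
      by apply/seteqP; split => z; rewrite /= !in_itv/= ltr_pdivrMr// ler_pdivlMr// ltrBlDr lerBrDr mulrC.
    rewrite !lebesgue_measure_itv/= !lte_fin ltr_pM2r ?invr_gt0// ltrD2r.
    case: ifPn => _; rewrite ?mule0// -!EFinB -EFinM gtr0_norm//; congr EFin; field.
    by rewrite gt_eqF. }
  have -> : (fun z => a * z + b) @^-1` `]x, y] = `[(y-b)/a, (x-b)/a[%classic.
    apply/seteqP; split => z; rewrite /= !in_itv/= ltr_ndivlMr// ler_ndivrMr// ltrBlDr lerBrDr mulrC andbC//.
  rewrite !lebesgue_measure_itv/= !lte_fin ltr_nM2r ?invr_lt0// ltrD2r.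
  case: ifPn => _; rewrite ?mule0// -!EFinB -EFinM ltr0_norm//; congr EFin; field.
  by rewrite lt_eqF.
rewrite (H _ mA) /m /mscale/= muleA -EFinM mulVf ?normr_eq0// mul1e.
by [].
Qed.

Lemma Rintegral_EFin (D : set R) (f : R -> R) : measurable D ->
  mu.-integrable D (EFin \o f) ->
  (\int[mu]_(x in D) (f x)%:E = (\int[mu]_(x in D) f x)%:E)%E.
Proof. by move=> mD fi; rewrite /Rintegral fineK//; exact: integrable_fin_num. Qed.

Lemma restrict_itvE (f : R -> R) (a b z : R) :
  (f \_ `[a, b]) z = if a <= z <= b then f z else 0.
Proof.
rewrite patchE; case: ifPn => [|h].
  by rewrite inE/= in_itv/= => ->.
by case: ifPn => // zab; move/negP: h; case; rewrite inE/= in_itv.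
Qed.

Lemma erestrict_itvE (f : R -> \bar R) (a b z : R) :
  ((f \_ `[a, b]) z = if (a <= z <= b)%R then f z else 0)%E.
Proof.
rewrite patchE; case: ifPn => [|h].
  by rewrite inE/= in_itv/= => ->.
by case: ifPn => // zab; move/negP: h; case; rewrite inE/= in_itv.
Qed.

Lemma integrable_mul_cont (a b : R) (y w : R -> R) :
  mu.-integrable `[a, b] (EFin \o y) -> {within `[a, b], continuous w} ->
  mu.-integrable `[a, b] (EFin \o (fun z => y z * w z)).
Proof.
move=> yi cw; rewrite (_ : EFin \o _ = (EFin \o y) \* (EFin \o w))%E//.
apply: integrableMl => //.
  by apply: subspace_continuous_measurable_fun => //; exact: measurable_itv.
have /compact_bounded[M [_ mrt]] := continuous_compact cw (@segment_compact _ a b).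
by exists M; split; rewrite ?num_real // => ? ? ? ?; exact: mrt.
Qed.

(** Fubini on the square, which the diagonal cuts into two triangles; this is
    integration by parts for primitives. *)
Lemma Rintegral_triangle (y s : R -> R) (b : R) : 0 <= b ->
  mu.-integrable `[0, b] (EFin \o y) -> mu.-integrable `[0, b] (EFin \o s) ->
  \int[mu]_(a in `[0, b]) (y a * \int[mu]_(c in `[0, a]) s c) +
  \int[mu]_(c in `[0, b]) (s c * \int[mu]_(a in `[0, c]) y a) =
  \int[mu]_(a in `[0, b]) y a * \int[mu]_(c in `[0, b]) s c.
Proof.
move=> b0 yi si.
pose y0 := y \_ `[0, b]; pose s0 := s \_ `[0, b].
have y0i : mu.-integrable setT (EFin \o y0).
  by rewrite /y0 -restrict_EFin; apply/integrable_restrict => //=; rewrite setTI.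
have s0i : mu.-integrable setT (EFin \o s0).
  by rewrite /s0 -restrict_EFin; apply/integrable_restrict => //=; rewrite setTI.
have my0 : measurable_fun setT y0 by apply/measurable_EFinP; exact: measurable_int y0i.
have ms0 : measurable_fun setT s0 by apply/measurable_EFinP; exact: measurable_int s0i.
pose f (p : measurableTypeR R * measurableTypeR R) : \bar R := (y0 p.1 * s0 p.2 * (p.2 <= p.1)%R%:R)%:E.
have mf : measurable_fun setT f.
  apply/measurable_EFinP; apply: measurable_funM.
    apply: measurable_funM.
      exact: measurableT_comp.
    exact: measurableT_comp.
  apply: (@measurableT_comp _ _ _ _ _ _ (fun b : bool => b%:R : R)) => //.
  exact: measurable_fun_ler.
have fi : (mu \x mu)%E.-integrable setT f.
  apply/integrable12ltyP => //.
  apply: (@le_lt_trans _ _ (\int[mu]_x (\int[mu]_y (`|y0 x|%:E * `|s0 y|%:E)))%E).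
    apply: ge0_le_integral => //.
    - by move=> x _; apply: integral_ge0.
    - apply: (@measurable_fun_fubini_tonelli_F _ _ _ _ R mu (abse \o f)) => //.
        exact: measurableT_comp.
      by move=> x; exact: abse_ge0.
    - apply: (@measurable_fun_fubini_tonelli_F _ _ _ _ R mu (fun p => (`|y0 p.1|%:E * `|s0 p.2|%:E)%E)) => //.
      apply: emeasurable_funM; apply/measurable_EFinP.
        by apply: measurableT_comp => //; exact: (measurableT_comp my0).
      by apply: measurableT_comp => //; exact: (measurableT_comp ms0).
    - move=> x _; apply: ge0_le_integral => //.
      + apply: measurableT_comp => //; apply/measurable_EFinP.
        rewrite /=; apply: measurable_funM; first exact: measurable_funM.
        apply: (@measurableT_comp _ _ _ _ _ _ (fun b : bool => b%:R : R)) => //.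
        exact: measurable_fun_ler.
      + by apply: emeasurable_funM => //; apply/measurable_EFinP; apply: measurableT_comp.
      + move=> z _; rewrite /f /= lee_fin !normrM ler_piMr// ?mulr_ge0//.
        by case: (z <= x); rewrite /= ?normr1// normr0.
  have i1 : (\int[mu]_y `|s0 y|%:E < +oo)%E by case/integrableP : s0i.
  have i2 : (\int[mu]_y `|y0 y|%:E < +oo)%E by case/integrableP : y0i.
  have mas : measurable_fun setT (fun z => `|s0 z|%:E) by apply/measurable_EFinP; exact: measurableT_comp.
  have may : measurable_fun setT (fun z => `|y0 z|%:E) by apply/measurable_EFinP; exact: measurableT_comp.
  under eq_integral => x _ do rewrite ge0_integralZl// muleC.
  rewrite ge0_integralZl ?integral_ge0//.
  by rewrite lte_mul_pinfty// ?integral_ge0// ge0_fin_numE// integral_ge0.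
have := Fubini fi.
have FE a : (\int[mu]_c f (a, c) = (((fun a => y a * \int[mu]_(c in `[0%R, a]) s c) \_ `[0, b]) a)%:E)%E.
  rewrite restrict_itvE; case: ifPn => [|ab]; last first.
    by rewrite integral0_eq// => c _; rewrite /f/= /y0 restrict_itvE (negPf ab) !mul0r.
  move=> /andP[a0 ab].
  have sia : mu.-integrable `[0, a] (EFin \o s).
    by apply: integrableS si => //; apply: subset_itvl; rewrite bnd_simp.
  rewrite -RintegralZl// -Rintegral_EFin//; last by apply: (@integrableZl _ _ _ _ _ _ (y a) _ sia).
  rewrite [RHS]integral_mkcond; apply: eq_integral => c _.
  rewrite /f/= /y0 /s0 !restrict_itvE erestrict_itvE a0 ab /=.
  have [c0|]/= := boolP (0 <= c); last by rewrite mulr0 mul0r.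
  have [ca|]/= := boolP (c <= a); last by rewrite mulr0.
  by rewrite (le_trans ca ab) mulr1.
have GE c : (\int[mu]_a f (a, c) = (((fun c => s c * (\int[mu]_(a in `[0%R, b]) y a - \int[mu]_(a in `[0%R, c]) y a)) \_ `[0, b]) c)%:E)%E.
  rewrite restrict_itvE; case: ifPn => [|cb]; last first.
    by rewrite integral0_eq// => a _; rewrite /f/= /s0 restrict_itvE (negPf cb) mulr0 mul0r.
  move=> /andP[c0 cb].
  have yic : mu.-integrable `[c, b] (EFin \o y).
    by apply: integrableS yi => //; apply: subset_itvr; rewrite bnd_simp.
  rewrite Rintegral_itvB ?bnd_simp// Rintegral_itv_obnd_cbnd; last first.
    by apply: integrableS yi => //; apply: subset_itvr; rewrite bnd_simp.
  rewrite -RintegralZl// -Rintegral_EFin//; last by apply: (@integrableZl _ _ _ _ _ _ (s c) _ yic).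
  rewrite [RHS]integral_mkcond; apply: eq_integral => a _.
  rewrite /f/= /y0 /s0 !restrict_itvE erestrict_itvE c0 cb /=.
  have [ca|]/= := boolP (c <= a); last by rewrite mulr0.
  rewrite (le_trans c0 ca) /=; case: ifPn => _; last by rewrite !mul0r.
  by rewrite mulr1 mulrC.
under eq_integral do rewrite FE.
under [in RHS]eq_integral do rewrite GE.
move=> /(congr1 fine) FG.
have {}FG : \int[mu]_(a in `[0, b]) (y a * \int[mu]_(c in `[0, a]) s c) =
  \int[mu]_(c in `[0, b]) (s c * (\int[mu]_(a in `[0, b]) y a - \int[mu]_(a in `[0, c]) y a)).
  by rewrite [LHS]Rintegral_mkcond [RHS]Rintegral_mkcond.
have Yc := parameterized_integral_continuous b0 yi.
have sYi := integrable_mul_cont si Yc.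
rewrite FG; under eq_Rintegral do rewrite mulrBr.
rewrite RintegralB//; last first.
  rewrite (_ : _ \o _ = (fun z => (\int[mu]_(a in `[0%R, b]) y a)%:E * (s z)%:E)%E); last by apply/funext=> z /=; rewrite mulrC.
  exact: integrableZl.
rewrite subrK RintegralZr// mulrC//.
Qed.

Lemma integrable_add (D : set R) (f g : R -> R) : measurable D ->
  mu.-integrable D (EFin \o f) -> mu.-integrable D (EFin \o g) ->
  mu.-integrable D (EFin \o (fun z => f z + g z)).
Proof.
move=> mD fi gi.
by rewrite (_ : EFin \o _ = (EFin \o f) \+ (EFin \o g))%E//; exact: integrableD.
Qed.

Lemma integrable_scale (D : set R) (f : R -> R) (a : R) : measurable D ->
  mu.-integrable D (EFin \o f) -> mu.-integrable D (EFin \o (fun z => a * f z)).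
Proof.
move=> mD fi.
by rewrite (_ : EFin \o _ = (fun z => a%:E * (EFin \o f) z))%E//; exact: integrableZl.
Qed.

Lemma integrable_lin (D : set R) (f g : R -> R) (a b : R) : measurable D ->
  mu.-integrable D (EFin \o f) -> mu.-integrable D (EFin \o g) ->
  mu.-integrable D (EFin \o (fun z => a * f z + b * g z)).
Proof. by move=> mD fi gi; apply: integrable_add => //; exact: integrable_scale. Qed.

(** Absolute continuity of [v] on [0, 1], with density [y]. *)
Definition prim (v y : R -> R) : Prop :=
  mu.-integrable `[0, 1] (EFin \o y) /\
  forall z : R, 0 <= z <= 1 -> v z = v 0 + \int[mu]_(s in `[0, z]) y s.

Lemma integrable_itvS (f : R -> R) (a b c d : R) :
  a <= c -> d <= b -> mu.-integrable `[a, b] (EFin \o f) -> mu.-integrable `[c, d] (EFin \o f).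
Proof.
move=> ac db; apply: integrableS => //.
by apply: subset_itv; rewrite bnd_simp.
Qed.

Lemma integrable_prefix (y : R -> R) (z : R) : z <= 1 ->
  mu.-integrable `[0, 1] (EFin \o y) -> mu.-integrable `[0, z] (EFin \o y).
Proof. exact: integrable_itvS. Qed.

Lemma prim_continuous (v y : R -> R) : prim v y -> {within `[0, 1], continuous v}.
Proof.
move=> [yi vE]; have cY := parameterized_integral_continuous ler01 yi.
have H : {within `[0, 1], continuous (fun z => v 0 + parameterized_integral mu 0 z y)}.
  by move=> z; apply: cvgD; [exact: cvg_cst|exact: cY].
apply: subspace_eq_continuous H => z; rewrite inE/= in_itv/= => z01.
by rewrite [RHS]vE.
Qed.

Lemma RintegralDZ (D : set R) (f g : R -> R) (a b : R) : measurable D ->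
  mu.-integrable D (EFin \o f) -> mu.-integrable D (EFin \o g) ->
  \int[mu]_(z in D) (a * f z + b * g z) =
  a * \int[mu]_(z in D) f z + b * \int[mu]_(z in D) g z.
Proof.
move=> mD fi gi; rewrite RintegralD//; [|exact: integrable_scale..].
by rewrite !RintegralZl.
Qed.

Lemma prim_lin (v y w s : R -> R) (a b : R) : prim v y -> prim w s ->
  prim (fun z => a * v z + b * w z) (fun z => a * y z + b * s z).
Proof.
move=> [yi vE] [si wE]; split; first exact: integrable_lin.
move=> z z01; have /andP[_ z1] := z01.
rewrite (vE _ z01) (wE _ z01) RintegralDZ//; [by ring|exact: integrable_prefix|exact: integrable_prefix].
Qed.

Lemma prim_mul (v y w s : R -> R) : prim v y -> prim w s ->
  prim (fun z => v z * w z) (fun z => y z * w z + s z * v z).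
Proof.
move=> pv pw; have cv := prim_continuous pv; have cw := prim_continuous pw.
have [yi vE] := pv; have [si wE] := pw.
have ywi := integrable_mul_cont yi cw; have svi := integrable_mul_cont si cv.
split; first exact: integrable_add.
move=> z z01; have /andP[z0 z1] := z01.
have yz := integrable_prefix z1 yi; have sz := integrable_prefix z1 si.
have cY := parameterized_integral_continuous z0 yz.
have cS := parameterized_integral_continuous z0 sz.
rewrite RintegralD//; [|exact: integrable_prefix..].
have -> : \int[mu]_(t in `[0, z]) (y t * w t) =
    w 0 * \int[mu]_(t in `[0, z]) y t + 1 * \int[mu]_(t in `[0, z]) (y t * parameterized_integral mu 0 t s).
  rewrite -RintegralDZ//; last exact: integrable_mul_cont.
  apply: eq_Rintegral => t; rewrite inE/= in_itv/= => /andP[t0 tz].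
  by rewrite wE ?t0 ?(le_trans tz)// /parameterized_integral; ring.
have -> : \int[mu]_(t in `[0, z]) (s t * v t) =
    v 0 * \int[mu]_(t in `[0, z]) s t + 1 * \int[mu]_(t in `[0, z]) (s t * parameterized_integral mu 0 t y).
  rewrite -RintegralDZ//; last exact: integrable_mul_cont.
  apply: eq_Rintegral => t; rewrite inE/= in_itv/= => /andP[t0 tz].
  by rewrite vE ?t0 ?(le_trans tz)// /parameterized_integral; ring.
have := Rintegral_triangle z0 yz sz.
rewrite (vE _ z01) (wE _ z01) /parameterized_integral; move: (Rintegral _ _ _) (Rintegral _ _ _) (Rintegral _ _ _) (Rintegral _ _ _).
move=> A B C D E; have -> : D = B * A - C by rewrite -E addrK.
by ring.
Qed.

Lemma prim_C1 (f : R -> R) : (forall z, derivable f z 1) -> continuous (derive1 f) -> prim f (derive1 f).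
Proof.
move=> df cf; split.
  by apply: continuous_compact_integrable; [exact: segment_compact|exact: continuous_subspaceT].
move=> z /andP[z0 z1].
move: z0; rewrite le_eqVlt => /predU1P[<-|z0].
  by rewrite set_itv1 Rintegral_set1 addr0.
have cc x : {for x, continuous f} by apply/differentiable_continuous/derivable1_diffP.
have dF : derivable_oo_LRcontinuous f 0 z.
  split => //; first by apply: cvg_at_right_filter; exact: cc.
  by apply: cvg_at_left_filter; exact: cc.
have cf' : {within `[0, z], continuous (derive1 f)} by exact: continuous_subspaceT.
have H := continuous_FTC2 z0 cf' dF (fun _ _ => erefl).
by rewrite /Rintegral H -EFinB /= addrC subrK.
Qed.

Definition clamp (a b z : R) : R := Num.max a (Num.min z b).

Lemma clamp_itv (a b z : R) : a <= b -> a <= clamp a b z <= b.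
Proof. by move=> ab; rewrite /clamp le_max lexx ge_max ab ge_min lexx orbT. Qed.

Lemma clampE (a b z : R) : a <= z <= b -> clamp a b z = z.
Proof. by move=> /andP[az zb]; rewrite /clamp (min_idPl zb) (max_idPr az). Qed.

Lemma continuous_clamp (a b : R) : continuous (clamp a b).
Proof.
move=> z; apply: (@continuous_comp _ _ _ (fun z => Num.min z b) (fun z => Num.max a z)).
  by apply: continuous_min => //; exact: cvg_cst.
by apply: continuous_max => //; exact: cvg_cst.
Qed.

Lemma continuous_comp_clamp (f : R -> R) (a b : R) : a <= b ->
  {within `[a, b], continuous f} -> continuous (f \o clamp a b).
Proof.
move=> ab cf z.
have /subspace_continuousP/(_ (clamp a b z)) H := cf.
have {}H : f @ within `[a, b] (nbhs (clamp a b z)) --> f (clamp a b z).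
  by apply: H; rewrite /= in_itv/= clamp_itv.
apply: cvg_trans H => P /= HP.
have H2 : \forall t \near z, `[a, b]%classic (clamp a b t) -> P (f (clamp a b t)).
  exact: (@continuous_clamp a b z _ HP).
change (\forall t \near z, P (f (clamp a b t))).
move: H2; apply: filterS => t; apply.
by rewrite /= in_itv/= clamp_itv.
Qed.

Lemma C1_primitive (psi : R -> R) (a : R) : 0 < a -> continuous psi ->
  (forall z, z <= a -> psi z = 0) ->
  let phi z := \int[mu]_(s in `[0, z]) psi s in
  (forall z, derivable phi z 1 /\ derive1 phi z = psi z) /\
  (forall z, z <= a -> phi z = 0).
Proof.
move=> a0 cpsi psi0 phi.
have phi0 z : z <= a -> phi z = 0.
  move=> za; rewrite /phi (@eq_Rintegral _ _ _ _ _ (cst 0)) ?Rintegral_cst// ?mul0r//.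
  by move=> t; rewrite inE/= in_itv/= => /andP[_ tz]; rewrite psi0// (le_trans tz).
split=> // z.
have [za|az] := ltP z a.
  have phi0z : \forall t \near z, cst 0 t = phi t.
    near=> t; rewrite phi0//; apply: ltW.
    by near: t; exact: lt_nbhsl.
  split; first exact: (near_eq_derivable phi0z).
  by rewrite derive1E -(near_eq_derive _ phi0z) derive_cst psi0// ltW.
apply: (@continuous_FTC1_closed _ _ 0 z (z + 1)) => //.
- by rewrite ltrDl.
- by apply: continuous_compact_integrable; [exact: segment_compact|exact: continuous_subspaceT].
- exact: lt_le_trans az.
- exact: cpsi.
Unshelve. all: by end_near. Qed.

(** The primitive of [g] vanishes identically, and so does its derivative. *)
Lemma ge0_integral_eq0_continuous (g : R -> R) : continuous g ->
  (forall z, 0 <= g z) -> \int[mu]_(z in `[0, 1]) g z = 0 ->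
  forall z, 0 < z < 1 -> g z = 0.
Proof.
move=> cg g0 I0 z /andP[z0 z1].
pose G z := \int[mu]_(s in `[0, z]) g s.
have gi a b : mu.-integrable `[a, b] (EFin \o g).
  by apply: continuous_compact_integrable; [exact: segment_compact|exact: continuous_subspaceT].
have Gz t : 0 < t < 1 -> G t = 0.
  move=> /andP[t0 t1]; apply/eqP; rewrite eq_le Rintegral_ge0// andbT -I0.
  have := @Rintegral_itvB _ g (BLeft 0) (BRight 1) t (gi 0 1).
  rewrite !bnd_simp => /(_ (ltW t0) (ltW t1)) H.
  by rewrite -subr_ge0 H Rintegral_ge0.
have [_ <-] := @continuous_FTC1_closed _ g 0 z 1 z1 (gi _ _) z0 (cg z).
rewrite derive1E (@near_eq_derive _ _ _ _ (cst 0)) ?derive_cst//.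
near=> t; apply: Gz; apply/andP; split.
  by near: t; exact: lt_nbhsr.
by near: t; exact: lt_nbhsl.
Unshelve. all: by end_near. Qed.

Lemma Rintegral_oo_cc (f : R -> R) (a b : R) :
  mu.-integrable `[a, b] (EFin \o f) ->
  \int[mu]_(z in `]a, b[) f z = \int[mu]_(z in `[a, b]) f z.
Proof.
move=> fi; rewrite /Rintegral [in RHS]integral_itv_bndoo//.
apply: measurable_funS (measurable_int mu fi) => //.
exact: subset_itv_oo_cc.
Qed.

Lemma continuous_integrable (f : R -> R) (a b : R) : continuous f ->
  mu.-integrable `[a, b] (EFin \o f).
Proof.
move=> cf; apply: continuous_compact_integrable; first exact: segment_compact.
exact: continuous_subspaceT.
Qed.

(** The du Bois-Reymond lemma.  The difference [D] of [v] and the primitive of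
    [y] is tested against the primitive of [eta * (D - m)], where [eta] is a bump
    on ]a, b[ and [m] is the mean of [D] for [eta]; integration by parts yields
    [\int eta * (D - m)^2 = 0]. *)
Lemma weak_prim_const (v y : R -> R) (a b : R) : 0 < a -> a < b -> b < 1 ->
  {within `[0, 1], continuous v} -> mu.-integrable `[0, 1] (EFin \o y) ->
  (forall phi, C1c01 phi ->
    \int[mu]_(z in `]0, 1[) (v z * derive1 phi z) =
    - \int[mu]_(z in `]0, 1[) (y z * phi z)) ->
  exists m, forall z, a < z < b -> v z - \int[mu]_(s in `[0, z]) y s = m.
Proof.
move=> a0 ab b1 cv yi wvy.
pose E z := \int[mu]_(s in `[0, z]) y s.
have E0 : E 0 = 0 by rewrite /E set_itv1 Rintegral_set1.
have pE : prim E y by split => // z _; rewrite E0 add0r.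
pose D z := (v \o clamp 0 1) z - (E \o clamp 0 1) z.
have cD : continuous D.
  move=> z; apply: cvgB; [exact: (continuous_comp_clamp ler01 cv)|].
  exact: (continuous_comp_clamp ler01 (prim_continuous pE)).
pose eta z := Num.max 0 ((z - a) * (b - z)).
have ceta : continuous eta.
  move=> z; apply: (@continuous_max _ _ (cst 0) (fun z => (z - a) * (b - z))); first exact: cvg_cst.
  by apply: cvgM; apply: cvgB => //; exact: cvg_cst.
have eta_ge0 z : 0 <= eta z by rewrite /eta le_max lexx.
have eta_l z : z <= a -> eta z = 0.
  by move=> za; apply/max_idPl; rewrite mulr_le0_ge0 ?subr_le0 ?subr_ge0// (le_trans za)// ltW.
have eta_r z : b <= z -> eta z = 0.
  by move=> bz; apply/max_idPl; rewrite mulr_ge0_le0 ?subr_le0 ?subr_ge0// (le_trans _ bz)// ltW.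
have eta_gt0 z : a < z < b -> 0 < eta z.
  by move=> /andP[az zb]; rewrite /eta lt_max mulr_gt0 ?subr_gt0// orbT.
pose S := \int[mu]_(z in `[0, 1]) eta z.
have S_neq0 : S != 0.
  apply/eqP => S0; have := ge0_integral_eq0_continuous ceta eta_ge0 S0 (z := (a + b) / 2).
  have [h1 h2] := midf_lt ab.
  by rewrite (lt_trans a0 h1) (lt_trans h2 b1) => /(_ isT) /eqP; rewrite gt_eqF// eta_gt0// h1 h2.
pose m := (\int[mu]_(z in `[0, 1]) (eta z * D z)) / S.
pose psi z := eta z * D z + (- m) * eta z.
have cetaD : continuous (fun z => eta z * D z) by move=> z; apply: cvgM; [exact: ceta|exact: cD].
have cpsi : continuous psi.
  by move=> z; apply: cvgD; [exact: cetaD|apply: cvgM; [exact: cvg_cst|exact: ceta]].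
have psi_l z : z <= a -> psi z = 0 by move=> za; rewrite /psi eta_l// mul0r mulr0 addr0.
have psi_r z : b <= z -> psi z = 0 by move=> za; rewrite /psi eta_r// mul0r mulr0 addr0.
have psi_i0 : \int[mu]_(z in `[0, 1]) psi z = 0.
  under eq_Rintegral do rewrite /psi -[eta _ * D _]mul1r.
  rewrite RintegralDZ//; [|exact: continuous_integrable..].
  by rewrite mul1r -/S mulNr /m divfK// subrr.
have [phiD phi_l] := C1_primitive a0 cpsi psi_l.
set phi := (fun z => _) in phiD phi_l.
have {}phi_l z : z <= a -> phi z = 0 by move=> za; exact: phi_l.
have phi_r z : b <= z -> phi z = 0.
  have H u : b <= u -> phi u = phi b.
    move=> bu; apply/eqP; rewrite -subr_eq0 /phi.
    rewrite (@Rintegral_itvB _ psi (BLeft 0) (BRight u) b (continuous_integrable _ _ cpsi)) ?bnd_simp//; last first.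
      by rewrite (le_trans _ (ltW ab))// ltW.
    rewrite (@eq_Rintegral _ _ _ _ _ (cst 0)) ?Rintegral_cst// ?mul0r//.
    by move=> t; rewrite inE/= in_itv/= => /andP[bt _]; rewrite psi_r// ltW.
  by move=> bz; rewrite H// -(H 1) ?(ltW b1).
have phi' : derive1 phi = psi by apply/funext => z; have [] := phiD z.
have dphi z : derivable phi z 1 by have [] := phiD z.
have phiC : C1c01 phi.
  split; [exact: dphi|rewrite phi'; exact: cpsi|].
  exists a, b; split; [exact: a0|exact: b1|move=> z]; rewrite in_itv/= negb_and -!ltNge => /orP[za|bz].
    by rewrite phi_l// ltW.
  by rewrite phi_r// ltW.
have pphi : prim phi psi.
  rewrite -phi'; apply: prim_C1; [exact: dphi|rewrite phi'; exact: cpsi].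
have phi0 : phi 0 = 0 by rewrite phi_l// ltW.
have phi1 : phi 1 = 0 by rewrite phi_r// ltW.
have I1 : \int[mu]_(z in `[0, 1]) (y z * phi z) + \int[mu]_(z in `[0, 1]) (psi z * E z) = 0.
  have [Ei EE] := prim_mul pE pphi.
  have := EE 1; rewrite lexx ler01 => /(_ isT); rewrite phi0 phi1 !mulr0 add0r RintegralD//.
    exact: integrable_mul_cont yi (prim_continuous pphi).
  exact: integrable_mul_cont pphi.1 (prim_continuous pE).
have I2 := wvy _ phiC; rewrite phi' in I2.
have vpsi_i : mu.-integrable `[0, 1] (EFin \o (fun z => psi z * v z)).
  by apply: integrable_mul_cont => //; exact: continuous_integrable.
have Epsi_i : mu.-integrable `[0, 1] (EFin \o (fun z => psi z * E z)).
  by apply: integrable_mul_cont (prim_continuous pE); exact: continuous_integrable.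
rewrite !Rintegral_oo_cc in I2; last 2 first.
- exact: integrable_mul_cont yi (prim_continuous pphi).
- apply: (@integrable_mul_cont 0 1 v psi); last exact: continuous_subspaceT.
  by apply: continuous_compact_integrable => //; exact: segment_compact.
have I3 : \int[mu]_(z in `[0, 1]) (psi z * D z) = 0.
  transitivity (\int[mu]_(z in `[0, 1]) (1 * (psi z * v z) + (-1) * (psi z * E z))).
    apply: eq_Rintegral => z; rewrite inE/= in_itv/= => z01.
    by rewrite /D /= clampE//; ring.
  rewrite RintegralDZ// mul1r mulN1r.
  under eq_Rintegral do rewrite mulrC.
  by rewrite I2; move/eqP: I1; rewrite addrC addr_eq0 => /eqP ->; rewrite opprK addrC subrr.
exists m => z zab.
have cpsiD : continuous (fun z => psi z * D z) by move=> t; apply: cvgM; [exact: cpsi|exact: cD].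
have I4 : \int[mu]_(z in `[0, 1]) (eta z * (D z - m) ^+ 2) = 0.
  transitivity (\int[mu]_(z in `[0, 1]) (1 * (psi z * D z) + (- m) * psi z)).
    by apply: eq_Rintegral => t _; rewrite /psi; ring.
  rewrite RintegralDZ//; [|exact: continuous_integrable..].
  by rewrite I3 psi_i0 !mulr0 addr0.
have cg : continuous (fun z => eta z * (D z - m) ^+ 2).
  move=> t; apply: cvgM; first exact: ceta.
  by apply: cvgM; (apply: cvgB; [exact: cD|exact: cvg_cst]).
have z01 : 0 < z < 1 by case/andP: zab => az zb; rewrite (lt_trans a0 az) (lt_trans zb b1).
have := ge0_integral_eq0_continuous cg (fun z => mulr_ge0 (eta_ge0 z) (sqr_ge0 _)) I4 z01.
move/eqP; rewrite mulf_eq0 gt_eqF ?eta_gt0//= sqrf_eq0 subr_eq0 => /eqP.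
rewrite /D /= clampE //; by case/andP: z01 => /ltW-> /ltW->.
Qed.

(** [weak_prim_const] on intervals that exhaust ]0, 1[, and continuity at the
    end points. *)
Lemma weak_prim (v y : R -> R) :
  {within `[0, 1], continuous v} -> mu.-integrable `[0, 1] (EFin \o y) ->
  (forall phi, C1c01 phi ->
    \int[mu]_(z in `]0, 1[) (v z * derive1 phi z) =
    - \int[mu]_(z in `]0, 1[) (y z * phi z)) ->
  prim v y.
Proof.
move=> cv yi wvy; split => //.
pose E z := \int[mu]_(s in `[0, z]) y s.
have E0 : E 0 = 0 by rewrite /E set_itv1 Rintegral_set1.
have pE : prim E y by split => // z _; rewrite E0 add0r.
pose D z := v z - E z.
have cD : {within `[0, 1], continuous D}.
  by move=> z; apply: cvgB; [exact: cv|exact: (prim_continuous pE)].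
have Dc z : 0 < z < 1 -> D z = D 2^-1.
  move=> /andP[z0 z1].
  have h1 : 0 < (2^-1 : R) < 1 by rewrite invr_gt0 ltr0n invf_lt1// ltr1n.
  have [h2 h3] := andP h1.
  pose a := (Num.min z 2^-1) / 2; pose b := (Num.max z 2^-1 + 1) / 2.
  have az : Num.min z 2^-1 <= z by rewrite ge_min lexx.
  have a2 : Num.min z 2^-1 <= 2^-1 by rewrite ge_min lexx orbT.
  have bz : z <= Num.max z 2^-1 by rewrite le_max lexx.
  have b2 : 2^-1 <= Num.max z 2^-1 by rewrite le_max lexx orbT.
  have a0 : 0 < Num.min z 2^-1 by rewrite lt_min z0.
  have b1 : Num.max z 2^-1 < 1 by rewrite gt_max z1.
  (* The interval ]a, b[ contains both [z] and the midpoint. *)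
  have [|||m mE] := @weak_prim_const v y a b _ _ _ cv yi wvy.
  - by rewrite /a; lra.
  - by rewrite /a /b; lra.
  - by rewrite /b; lra.
  by rewrite /D [LHS]mE ?[RHS]mE//; rewrite /a /b; apply/andP; split; lra.
have [cD' D0 D1] := (continuous_within_itvP _ (@ltr01 R)).1 cD.
have D0E : D 0 = D 2^-1.
  have H : D x @[x --> 0^'+] --> D 2^-1.
    apply: cvg_near_cst; near=> x; apply: Dc; apply/andP; split.
      by near: x; exact: nbhs_right_gt.
    by near: x; exact: nbhs_right_lt.
  exact: (cvg_unique _ D0 H).
have D1E : D 1 = D 2^-1.
  have H : D x @[x --> 1^'-] --> D 2^-1.
    apply: cvg_near_cst; near=> x; apply: Dc; apply/andP; split.
      by near: x; exact: nbhs_left_gt.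
    by near: x; exact: nbhs_left_lt.
  exact: (cvg_unique _ D1 H).
move=> z /andP[]; rewrite le_eqVlt => /predU1P[<- _|z0].
  by rewrite set_itv1 Rintegral_set1 addr0.
have v0 : v 0 = D 2^-1 by rewrite -D0E /D E0 subr0.
rewrite le_eqVlt => /predU1P[->|z1].
  by rewrite v0 -D1E /D subrK.
by rewrite v0 -(Dc z) ?z0// /D subrK.
Unshelve. all: by end_near. Qed.

(** Lebesgue differentiation of the primitive of [y1 - y2], which is 0. *)
Lemma prim_ae_eq (v y1 y2 : R -> R) : prim v y1 -> prim v y2 ->
  {ae mu, forall z, 0 < z < 1 -> y1 z = y2 z}.
Proof.
move=> p1 p2; have [yi yE] := prim_lin 1 (-1) p1 p2.
pose y z := 1 * y1 z + (-1) * y2 z.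
pose y0 := y \_ `[0, 1].
have y0i : mu.-integrable setT (EFin \o y0).
  by rewrite /y0 -restrict_EFin; apply/integrable_restrict => //=; rewrite setTI.
have y0x (x : R) : mu.-integrable [set` Interval (BLeft 0) (BRight x)] (EFin \o y0).
  exact: integrableS y0i.
have lf : locally_integrable setT y0 by apply: integrable_locally => //; exact: openT.
have := FTC1 y0x lf.
apply: filterS; first exact: (ae_filter_ringOfSetsType mu).
move=> z H /andP[z0 z1]; have [|_] := H; first by rewrite lte_fin.
rewrite derive1E (@near_eq_derive _ _ _ _ (cst 0)) ?derive_cst//.
  rewrite /y0 restrict_itvE !ltW//= /y mul1r mulN1r => /esym/eqP.
  by rewrite subr_eq0 => /eqP.
near=> t.
have t01 : 0 < t < 1.
  apply/andP; split; first by near: t; exact: lt_nbhsr.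
  by near: t; exact: lt_nbhsl.
have [t0 t1] := andP t01.
have := yE t; rewrite !ltW//= => /(_ isT) /eqP.
rewrite !mul1r !mulN1r !subrr add0r eq_sym => /eqP yt.
transitivity (\int[mu]_(s in `[0, t]) (1 * y1 s + (-1) * y2 s)); last exact: yt.
apply: eq_Rintegral => s; rewrite inE/= in_itv/= => /andP[s0 st].
by rewrite /y0 restrict_itvE s0 (le_trans st)// ltW.
Unshelve. all: by end_near. Qed.

(** * Lipschitz functions with countably many corners *)

(** Differentiability, as a first-order expansion; this form is the one whose
    error is estimated uniformly below. *)
Definition is_slope (p : R -> R) (s d : R) : Prop :=
  forall e : R, 0 < e -> \forall h \near (0 : R), `|p (s + h) - p s - h * d| <= e * `|h|.

Lemma is_slope_cst (c s : R) : is_slope (cst c) s 0.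
Proof.
move=> e e0; near=> h.
by rewrite /cst subrr mulr0 subr0 normr0 mulr_ge0// ltW.
Unshelve. all: by end_near. Qed.

Lemma is_slope_add (p q : R -> R) (s d d' : R) : is_slope p s d -> is_slope q s d' ->
  is_slope (fun t => p t + q t) s (d + d').
Proof.
move=> ps qs e e0; have e2 : 0 < e / 2 by rewrite divr_gt0.
near=> h.
rewrite (_ : _ - _ = (p (s + h) - p s - h * d) + (q (s + h) - q s - h * d')); last by ring.
rewrite (le_trans (ler_normD _ _))// (splitr e) mulrDl lerD//.
  by near: h; exact: ps.
by near: h; exact: qs.
Unshelve. all: by end_near. Qed.

Lemma is_slope_scale (p : R -> R) (c s d : R) : is_slope p s d ->
  is_slope (fun t => c * p t) s (c * d).
Proof.
move=> ps e e0; have c0 : 0 < `|c| + 1 by rewrite ltr_wpDl.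
have e2 : 0 < e / (`|c| + 1) by rewrite divr_gt0.
near=> h.
rewrite (_ : _ - _ = c * (p (s + h) - p s - h * d)); last by ring.
have H : `|p (s + h) - p s - h * d| <= e / (`|c| + 1) * `|h| by near: h; exact: ps.
rewrite normrM (le_trans (ler_wpM2l (normr_ge0 _) H))//.
rewrite [leRHS](_ : _ = (`|c| + 1) * (e / (`|c| + 1) * `|h|)).
  by rewrite ler_wpM2r ?lerDl// mulr_ge0// ltW.
by field; rewrite gt_eqF.
Unshelve. all: by end_near. Qed.

Lemma is_slope_affine (p : R -> R) (a b s d : R) : is_slope p (a * s + b) d ->
  is_slope (fun t => p (a * t + b)) s (a * d).
Proof.
move=> ps e e0; have c0 : 0 < `|a| + 1 by rewrite ltr_wpDl.
have e2 : 0 < e / (`|a| + 1) by rewrite divr_gt0.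
have ca : (fun h => a * h) @ (0 : R) --> (0 : R).
  by rewrite -[X in _ --> X](mulr0 a); apply: cvgM; [exact: cvg_cst|exact: cvg_id].
have H : \forall h \near (0 : R), `|p (a * s + b + a * h) - p (a * s + b) - a * h * d| <= e / (`|a| + 1) * `|a * h|.
  exact: (ca _ (ps _ e2)).
near=> h.
have H' : `|p (a * s + b + a * h) - p (a * s + b) - a * h * d| <= e / (`|a| + 1) * `|a * h|.
  by near: h; exact: H.
rewrite (_ : a * (s + h) + b = a * s + b + a * h); last by ring.
rewrite (_ : h * (a * d) = a * h * d); last by ring.
rewrite (le_trans H')// normrM mulrA ler_wpM2r// -mulrA ger_pMr//.
by rewrite ler_pdivrMl// mulr1 lerDl.
Unshelve. all: by end_near. Qed.

Lemma is_slope_near (p q : R -> R) (s d : R) : (\forall t \near s, p t = q t) ->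
  is_slope p s d -> is_slope q s d.
Proof.
move=> pq ps e e0.
have pqs : p s = q s by exact: nbhs_singleton pq.
have ca : (fun h => s + h) @ (0 : R) --> s.
  by rewrite -[X in _ --> X](addr0 s); apply: cvgD; [exact: cvg_cst|exact: cvg_id].
have H : \forall h \near (0 : R), p (s + h) = q (s + h) by exact: (ca _ pq).
near=> h.
have <- : p (s + h) = q (s + h) by near: h; exact: H.
rewrite -pqs.
by near: h; exact: ps.
Unshelve. all: by end_near. Qed.

Lemma is_slope_unique (p : R -> R) (s d d' : R) :
  is_slope p s d -> is_slope p s d' -> d = d'.
Proof.
move=> h1 h2; apply/eqP; rewrite -subr_eq0 -normr_le0; apply/ler_addgt0Pr => e e0.
rewrite add0r; have e2 : 0 < e / 2 by rewrite divr_gt0.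
have {}h1 := h1 _ e2; have {}h2 := h2 _ e2.
near (0 : R)^'+ => h.
have h0 : 0 < h by near: h; exact: nbhs_right_gt.
have H1 : `|p (s + h) - p s - h * d| <= e / 2 * `|h|.
  by near: h; apply: cvg_within; exact: h1.
have H2 : `|p (s + h) - p s - h * d'| <= e / 2 * `|h|.
  by near: h; apply: cvg_within; exact: h2.
rewrite -(ler_pM2l h0) -{1}(gtr0_norm h0) -normrM.
rewrite (_ : h * (d - d') = (p (s + h) - p s - h * d') - (p (s + h) - p s - h * d)); last by ring.
rewrite (le_trans (ler_normB _ _))//.
rewrite (le_trans (lerD H2 H1))// -mulrDl -splitr (gtr0_norm h0) mulrC//.
Unshelve. all: by end_near. Qed.

Lemma is_slope_derive (p : R -> R) (s : R) : derivable p s 1 -> is_slope p s (derive1 p s).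
Proof.
move=> dp e e0.
have : h^-1 *: (p (h *: 1 + s) - p s) @[h --> 0^'] --> derive1 p s.
  by rewrite derive1E; exact: dp.
move=> /cvgrPdist_le/(_ _ e0); rewrite near_withinE => H.
near=> h.
have [->|h0] := eqVneq h 0.
  by rewrite addr0 subrr mul0r subr0 normr0 mulr0.
have : `|derive1 p s - h^-1 *: (p (h *: 1 + s) - p s)| <= e by move: h0; near: h.
rewrite -(ler_pM2r (_ : 0 < `|h|)) ?normr_gt0// -normrM.
rewrite (_ : (_ - _ *: _) * h = - (p (s + h) - p s - h * derive1 p s)) ?normrN//.
rewrite /GRing.scale/= mulr1 (addrC h s).
by field.
Unshelve. all: by end_near. Qed.

(** Near [s], [p t] is at least half as large as [d * (t - s)]. *)
Lemma is_slope_neq0 (p : R -> R) (s d : R) : d != 0 -> p s = 0 -> is_slope p s d ->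
  \forall t \near s, p t = 0 -> t = s.
Proof.
move=> d0 p0 ps; have d2 : 0 < `|d| / 2 by rewrite divr_gt0// normr_gt0.
have ca : (fun t => t - s) @ (s : R) --> (0 : R).
  by rewrite -[X in _ --> X](subrr s); apply: cvgB; [exact: cvg_id|exact: cvg_cst].
have : \forall t \near s, `|p (s + (t - s)) - p s - (t - s) * d| <= `|d| / 2 * `|t - s|.
  exact: (ca _ (ps _ d2)).
apply: filterS => t.
rewrite [s + _]addrC subrK p0 subr0 => H pt; move: H; rewrite pt sub0r normrN normrM.
apply: contraTeq => ts; rewrite -ltNge mulrC ltr_pM2l ?normr_gt0 ?subr_eq0//.
by rewrite ltr_pdivrMr// mulr_natr mulr2n ltrDl normr_gt0.
Qed.

Lemma is_slope_abs0 (p : R -> R) (s : R) : p s = 0 -> is_slope p s 0 ->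
  is_slope (fun t => `|p t|) s 0.
Proof.
move=> p0 ps e e0; near=> h.
have : `|p (s + h) - p s - h * 0| <= e * `|h| by near: h; exact: ps.
by rewrite p0 mulr0 !subr0 normr0 subr0 normr_id.
Unshelve. all: by end_near. Qed.

Lemma countableS (T : Type) (A B : set T) : A `<=` B -> countable B -> countable A.
Proof. by move=> AB; apply: sub_countable; exact: subset_card_le. Qed.

Lemma countableU2 (T : Type) (A B : set T) : countable A -> countable B -> countable (A `|` B).
Proof.
move=> cA cB; apply: (@countableS _ _ (\bigcup_(b in [set: bool]) if b then A else B)).
  by move=> x [Ax|Bx]; [exists true|exists false].
by apply: bigcup_countable => // -[].
Qed.

(** The corners of [p]. *)
Definition no_slope (p : R -> R) : set R := [set s | ~ exists d, is_slope p s d].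

Definition lip (p : R -> R) (L : R) : Prop := forall s t, `|p s - p t| <= L * `|s - t|.

(** Countably many corners: the profiles of which solutions are made.  A
    countable exceptional set, rather than a null set, survives affine changes of
    variable by injectivity and absolute values by [countable_isolated]. *)
Definition cc (p : R -> R) : Prop :=
  (exists2 L, 0 <= L & lip p L) /\ countable (no_slope p).

Definition slope (p : R -> R) (s : R) : R := xget 0 [set d | is_slope p s d].

Lemma slopeE (p : R -> R) (s d : R) : is_slope p s d -> slope p s = d.
Proof. by move=> ps; apply: xget_unique => // d' /= /(is_slope_unique ps) ->. Qed.

Lemma slopeP (p : R -> R) (s : R) : ~ no_slope p s -> is_slope p s (slope p s).
Proof. by move=> /contrapT[d pd]; rewrite (slopeE pd). Qed.

Lemma slope_le (p : R -> R) (L s : R) : 0 <= L -> lip p L -> `|slope p s| <= L.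
Proof.
move=> L0 pL; rewrite /slope; case: xgetP => [d _ /= pd|]; last by rewrite normr0.
apply/ler_addgt0Pr => e e0.
near (0 : R)^'+ => h.
have h0 : 0 < h by near: h; exact: nbhs_right_gt.
have H1 : `|p (s + h) - p s - h * d| <= e * `|h|.
  by near: h; apply: cvg_within; exact: pd.
rewrite -(ler_pM2l h0) -{1}(gtr0_norm h0) -normrM.
rewrite (_ : h * d = (p (s + h) - p s) - (p (s + h) - p s - h * d)); last by ring.
rewrite (le_trans (ler_normB _ _))//.
have := lerD (pL (s + h) s) H1.
rewrite (_ : s + h - s = h); last by ring.
by rewrite (gtr0_norm h0) -mulrDl (mulrC _ h).
Unshelve. all: by end_near. Qed.

Lemma lip_continuous (p : R -> R) (L : R) : 0 <= L -> lip p L -> continuous p.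
Proof.
move=> L0 pL s; apply/cvgrPdist_le => e e0.
have L1 : 0 < L + 1 by rewrite ltr_wpDl.
near=> t.
rewrite (le_trans (pL _ _))//.
have H : `|s - t| <= e / (L + 1) by near: t; apply: cvgr_dist_le => //; rewrite divr_gt0.
rewrite (le_trans (ler_wpM2l L0 H))// mulrCA ger_pMr// ler_pdivrMr// mul1r lerDl//.
Unshelve. all: by end_near. Qed.

Lemma cc_continuous (p : R -> R) : cc p -> continuous p.
Proof. by move=> [[L L0 pL] _]; exact: lip_continuous pL. Qed.

Lemma cc_cst (c : R) : cc (cst c).
Proof.
split; first by exists 0 => // s t; rewrite subrr normr0 mul0r.
apply: (@countableS _ _ set0) => //; move=> s /=; apply; exists 0.
exact: is_slope_cst.
Qed.

Lemma cc_add (p q : R -> R) : cc p -> cc q -> cc (fun t => p t + q t).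
Proof.
move=> [[L L0 pL] pN] [[L' L0' qL] qN]; split.
  exists (L + L'); first exact: addr_ge0.
  move=> s t; rewrite (_ : _ - _ = (p s - p t) + (q s - q t)); last by ring.
  by rewrite (le_trans (ler_normD _ _))// mulrDl lerD.
apply: countableS (countableU2 pN qN) => s /= pqs.
apply: contrapT => /not_orP[/contrapT[d pd] /contrapT[d' qd]].
by apply: pqs; exists (d + d'); exact: is_slope_add.
Qed.

Lemma cc_scale (p : R -> R) (c : R) : cc p -> cc (fun t => c * p t).
Proof.
move=> [[L L0 pL] pN]; split.
  exists (`|c| * L); first exact: mulr_ge0.
  by move=> s t; rewrite -mulrBr normrM -mulrA ler_wpM2l.
apply: countableS pN => s /= ps [d pd]; apply: ps; exists (c * d).
exact: is_slope_scale.
Qed.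

Lemma cc_sum (I : finType) (p : I -> R -> R) : (forall i, cc (p i)) ->
  cc (fun t => \sum_i p i t).
Proof.
move=> pc; elim: (index_enum I) => [|i r IH].
  by under eq_fun do rewrite big_nil; exact: cc_cst.
by under eq_fun do rewrite big_cons; exact: cc_add.
Qed.

Lemma cc_affine (p : R -> R) (a b : R) : a != 0 -> cc p -> cc (fun t => p (a * t + b)).
Proof.
move=> a0 [[L L0 pL] pN]; split.
  exists (L * `|a|); first exact: mulr_ge0.
  move=> s t; rewrite (le_trans (pL _ _))// -mulrA -normrM ler_wpM2l//.
  by rewrite opprD addrACA subrr addr0 mulrBr.
have /countable_injP[f fi] := pN.
apply/countable_injP; exists (f \o (fun t => a * t + b)) => s t.
rewrite !inE => ps pt /= fst.
have : a * s + b = a * t + b.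
  by apply: fi => //; rewrite inE => -[d pd]; [apply: ps|apply: pt]; exists (a * d);
    exact: is_slope_affine.
by move=> /addIr /(mulfI a0).
Qed.

Lemma cc_min0 (p : R -> R) : cc p -> cc (fun t => p (Num.min t 0)).
Proof.
move=> [[L L0 pL] pN]; split.
  exists L => // s t; rewrite (le_trans (pL _ _))// ler_wpM2l//.
  have [s0|s0] := leP s 0; have [t0|t0] := leP t 0 => //.
  - by rewrite subr0 (ler0_norm s0) (@ler0_norm _ (s - t)); lra.
  - by rewrite sub0r normrN (ler0_norm t0) (@ger0_norm _ (s - t)); lra.
  - by rewrite subrr normr0.
apply: countableS (countableU2 pN (countable1 (0 : R))) => s /= ps.
apply: contrapT => /not_orP[/contrapT[d pd] s0].
apply: ps; have /orP[sn|sp] : (s < 0) || (0 < s) by rewrite -neq_lt; apply/eqP.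
  exists d; apply: is_slope_near pd.
  near=> t; have t0 : t < 0 by near: t; exact: lt_nbhsl.
  by rewrite min_l// ltW.
exists 0; apply: is_slope_near (is_slope_cst (p 0) s).
near=> t; have t0 : 0 < t by near: t; exact: lt_nbhsr.
by rewrite min_r// ltW.
Unshelve. all: by end_near. Qed.

Lemma cc_ext (p q : R -> R) : p =1 q -> cc p -> cc q.
Proof. by move=> /funext ->. Qed.

Lemma cc_max0 (p : R -> R) : cc p -> cc (fun t => p (Num.max t 0)).
Proof.
move=> pc; have N1 : (-1 : R) != 0 by rewrite oppr_eq0 oner_eq0.
apply: cc_ext (cc_affine 0 N1 (cc_min0 (cc_affine 0 N1 pc))) => t.
rewrite !addr0 !mulN1r; congr p.
by have [t0|t0] := leP t 0; [rewrite min_r ?oppr_ge0 ?oppr0|rewrite min_l ?oppr_le0 ?opprK// ltW].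
Qed.

(** New corners can only appear at zeros of [p] where the slope is nonzero; these
    are isolated zeros, hence countably many. *)
Lemma cc_abs (p : R -> R) : cc p -> cc (fun t => `|p t|).
Proof.
move=> pc; have cp := cc_continuous pc; have [[L L0 pL] pN] := pc; split.
  by exists L => // s t; rewrite (le_trans _ (pL s t))// ler_dist_dist.
apply: countableS (countableU2 pN (countable_isolated [set s | p s = 0])) => s /= ps.
apply: contrapT => /not_orP[/contrapT[d pd] s0].
apply: ps; have [ps0|ps0] := eqVneq (p s) 0.
  have [d0|d0] := eqVneq d 0; first by exists 0; apply: is_slope_abs0 => //; rewrite -d0.
  exfalso; apply: s0; split; first by rewrite inE.
  exists [set t | p t = 0 -> t = s]; first exact: is_slope_neq0 pd.
  by apply/seteqP; split => [t [ts /ts]//|t ->].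
have /orP[sn|sp] : (p s < 0) || (0 < p s) by rewrite -neq_lt.
  exists (- 1 * d); apply: is_slope_near (is_slope_scale (- 1) pd).
  have : \forall t \near s, p t < 0 by exact: (cvgr_lt _ (cp s) 0 sn).
  apply: filterS => t pt.
  by rewrite ltr0_norm// mulN1r.
exists d; apply: is_slope_near pd.
have : \forall t \near s, 0 < p t by exact: (cvgr_gt _ (cp s) 0 sp).
apply: filterS => t pt.
by rewrite gtr0_norm.
Qed.

(** Minimum and maximum with a constant are expressed by absolute values. *)
Lemma cc_clamp (p : R -> R) (a b : R) : cc p -> cc (fun t => clamp a b (p t)).
Proof.
move=> pc.
have ccmin q c : cc q -> cc (fun t => Num.min (q t) c).
  move=> qc; have qc' := cc_add qc (cc_cst (- c)).
  apply: cc_ext (cc_scale (2^-1) (cc_add (cc_add qc (cc_cst c)) (cc_scale (-1) (cc_abs qc')))) => t.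
  by rewrite minr_absE /cst mulN1r mulrC.
have ccmax q c : cc q -> cc (fun t => Num.max c (q t)).
  move=> qc; have qc' := cc_add (cc_cst c) (cc_scale (-1) qc).
  apply: cc_ext (cc_scale (2^-1) (cc_add (cc_add (cc_cst c) qc) (cc_abs qc'))) => t.
  by rewrite maxr_absE /cst mulN1r mulrC.
by apply: ccmax; exact: ccmin.
Qed.

Lemma is_slope_derivable (p : R -> R) (s d : R) : is_slope p s d ->
  derivable p s 1 /\ derive1 p s = d.
Proof.
move=> pd.
have H : h^-1 *: (p (h *: 1 + s) - p s) @[h --> 0^'] --> d.
  apply/cvgrPdist_le => e e0; rewrite near_withinE; near=> h => h0.
  have h0' : 0 < `|h| by rewrite normr_gt0.
  rewrite -(ler_pM2r h0') -normrM.
  rewrite (_ : (_ - _ *: _) * h = - (p (s + h) - p s - h * d)) ?normrN//.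
    by near: h; exact: pd.
  rewrite /GRing.scale/= mulr1 (addrC h s).
  by field.
split; first by apply/cvg_ex; exists d; exact: H.
by rewrite derive1E; apply: cvg_lim => //; exact: H.
Unshelve. all: by end_near. Qed.

Lemma is_slope_seq (p : R -> R) (s d : R) : is_slope p s d ->
  n.+1%:R * (p (s + n.+1%:R^-1) - p s) @[n --> \oo] --> d.
Proof.
move=> pd; apply/cvgrPdist_le => e e0.
have : \forall n \near \oo, `|p (s + n.+1%:R^-1) - p s - n.+1%:R^-1 * d| <= e * `|n.+1%:R^-1|.
  exact: (@cvg_harmonic R _ (pd _ e0)).
apply: filterS => n /= H.
rewrite -(ler_pM2r (_ : 0 < `|n.+1%:R^-1| :> R)); last by rewrite normr_gt0 invr_eq0 pnatr_eq0.
rewrite -normrM -normrN (le_trans _ H)// le_eqVlt; apply/orP; left; apply/eqP; congr (`|_|).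
have k0 : n.+1%:R != 0 :> R by rewrite pnatr_eq0.
by move: (n.+1%:R : R) k0 => k k0; field.
Qed.

Lemma measurable_cc (p : R -> R) : cc p -> measurable_fun setT p.
Proof. by move=> pc; apply: continuous_measurable_fun; exact: cc_continuous. Qed.

Lemma measurable_shift (p : R -> R) (h : R) : measurable_fun setT p ->
  measurable_fun setT (fun s : R => p (s + h)).
Proof. by move=> mp; apply: (measurableT_comp mp) => //; exact: measurable_funD. Qed.

Lemma measurable_no_slope (p : R -> R) : cc p -> measurable (no_slope p).
Proof. by move=> [_ pN]; apply: countable_measurable. Qed.

(** Off the corners, the slope is a limit of difference quotients. *)
Lemma measurable_slope (p : R -> R) : cc p -> measurable_fun setT (slope p).
Proof.
move=> pc; have mN := measurable_no_slope pc.
apply: (@measurable_fun_cvg _ _ _ _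
  (fun n => (fun s => n.+1%:R * (p (s + n.+1%:R^-1) - p s)) \_ (~` no_slope p))).
  move=> n; apply/(measurable_restrictT _ (measurableC mN)).
  apply: measurable_funTS; apply: measurable_funM => //.
  by apply: measurable_funB; [apply: measurable_shift|]; exact: measurable_cc.
move=> s _.
have [sN|sN] := pselect (no_slope p s).
  have -> : slope p s = 0.
    by rewrite /slope; case: xgetP => // d _ /= pd; exfalso; apply: sN; exists d.
  apply: cvg_near_cst; apply: nearW => n.
  by rewrite patchE memNset//= => /(_ sN).
under eq_fun do rewrite patchE mem_set//=.
by apply: is_slope_seq; exact: slopeP.
Qed.

Lemma continuous_antiderivative (p : R -> R) : continuous p ->
  exists P, forall z : R, -1 < z -> derivable P z 1 /\ derive1 P z = p z.
Proof.
move=> cp; exists (fun z => \int[mu]_(s in `[-1, z]) p s) => z z1.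
apply: (@continuous_FTC1_closed _ _ (-1) z (z + 1)) => //.
- by rewrite ltrDl.
- exact: continuous_integrable.
- exact: cp.
Qed.

(** The difference quotients of [p] are bounded by the Lipschitz constant, so
    dominated convergence applies to their integrals; these are difference
    quotients of an antiderivative of [p] at the two end points. *)
Lemma cc_prim (p : R -> R) : cc p -> prim p (slope p).
Proof.
move=> pc; have cp := cc_continuous pc; have mp := measurable_cc pc.
have [[L L0 pL] pN] := pc; have mN := measurable_no_slope pc.
have [P HP] := continuous_antiderivative cp.
pose g n s := n.+1%:R * (p (s + n.+1%:R^-1) - p s).
have cg n : continuous (g n).
  move=> s; apply: cvgM; first exact: cvg_cst.
  apply: cvgB; last exact: cp.
  by apply: continuous_comp; [apply: cvgD; [exact: cvg_id|exact: cvg_cst]|exact: cp].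
have gL n s : `|g n s| <= L.
  rewrite /g normrM (le_trans (ler_wpM2l (normr_ge0 _) (pL _ _)))//.
  rewrite (_ : s + _ - s = n.+1%:R^-1); last by ring.
  by rewrite mulrCA -normrM mulfV ?normr1 ?mulr1// pnatr_eq0.
have gs : {ae mu, forall s, (EFin \o g n) s @[n --> \oo] --> (EFin \o slope p) s}.
  exists (no_slope p); split => //; first exact: countable_lebesgue_measure0.
  move=> s /= gs; apply: contrapT => /slopeP/is_slope_seq sl; apply: gs.
  by apply: cvg_EFin; [exact: nearW|exact: sl].
have DC z : [/\ mu.-integrable `[0, z] (EFin \o slope p),
    (\int[mu]_(x in `[0%R, z]) `|(EFin \o g n) x - (EFin \o slope p) x|)%E @[n --> \oo] --> 0%E &
    (\int[mu]_(x in `[0%R, z]) (EFin \o g n) x)%E @[n --> \oo] --> (\int[mu]_(x in `[0%R, z]) (EFin \o slope p) x)%E].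
  apply: (@dominated_convergence _ _ _ mu _ (measurable_itv _) (fun n => EFin \o g n) (EFin \o slope p) (EFin \o cst L)).
  - by move=> n; apply/measurable_EFinP; apply: measurable_funTS; exact: continuous_measurable_fun.
  - by apply/measurable_EFinP; apply: measurable_funTS; exact: measurable_slope.
  - move: gs; apply: filterS; first exact: (ae_filter_ringOfSetsType mu).
    by move=> s H _.
  - by apply: continuous_integrable => s; exact: cvg_cst.
  - by apply: aeW => s n _ /=; rewrite lee_fin.
split; first by have [] := DC 1.
move=> z /andP[]; rewrite le_eqVlt => /predU1P[<- _|z0 z1].
  by rewrite set_itv1 Rintegral_set1 addr0.
have [si _ Iz] := DC z.
have DP s : 0 <= s -> is_slope P s (p s).
  move=> s0; have [|dP <-] := HP s; first by rewrite (lt_le_trans _ s0).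
  exact: is_slope_derive.
(* The integrals are computed by the fundamental theorem of calculus for [F]. *)
have gE n : (\int[mu]_(x in `[0%R, z]) (EFin \o g n) x = (n.+1%:R * (P (z + n.+1%:R^-1) - P z) - n.+1%:R * (P (0 + n.+1%:R^-1) - P 0))%:E)%E.
  pose F s := n.+1%:R * (P (s + n.+1%:R^-1) - P s).
  have Fd s : 0 <= s -> is_slope F s (g n s).
    move=> s0.
    have d1 : is_slope (fun s => P (1 * s + n.+1%:R^-1)) s (1 * p (s + n.+1%:R^-1)).
      apply: is_slope_affine; rewrite mul1r; apply: DP.
      by rewrite addr_ge0// invr_ge0.
    have := is_slope_scale n.+1%:R (is_slope_add d1 (is_slope_scale (-1) (DP _ s0))).
    rewrite mul1r mulN1r (_ : (fun t => _) = F)//.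
    by apply/funext => t; rewrite /F mul1r mulN1r.
  have cF s : 0 <= s -> {for s, continuous F}.
    move=> s0; apply/differentiable_continuous/derivable1_diffP.
    by have [] := is_slope_derivable (Fd _ s0).
  have dF : derivable_oo_LRcontinuous F 0 z.
    split.
    - move=> s; rewrite in_itv/= => /andP[s0 _].
      by have [] := is_slope_derivable (Fd _ (ltW s0)).
    - by apply: cvg_at_right_filter; exact: cF.
    - by apply: cvg_at_left_filter; apply: cF; exact: ltW.
  have F' : {in `]0, z[, derive1 F =1 g n}.
    move=> s; rewrite in_itv/= => /andP[s0 _].
    by have [] := is_slope_derivable (Fd _ (ltW s0)).
  have cg' : {within `[0, z], continuous (g n)} by exact: continuous_subspaceT.
  by rewrite EFinB -(continuous_FTC2 z0 cg' dF F').
have : (\int[mu]_(x in `[0%R, z]) (EFin \o g n) x)%E @[n --> \oo] --> (p z - p 0)%:E.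
  under eq_fun do rewrite gE.
  apply: cvg_EFin; first exact: nearW.
  by apply: cvgB; apply: is_slope_seq; apply: DP => //; exact: ltW.
move=> /(cvg_unique (@ereal_hausdorff R) Iz) /(congr1 fine) H.
have -> : \int[mu]_(s in `[0, z]) slope p s = p z - p 0 by exact: H.
by rewrite addrC subrK.
Qed.

Lemma sqr_le_sqr (x y : R) : `|x| <= y -> x ^+ 2 <= y ^+ 2.
Proof.
move=> xy; rewrite -(real_normK (num_real x)) lerXn2r ?nnegrE//.
exact: le_trans xy.
Qed.

Definition rough (p : R -> R) (e h : R) : set R :=
  [set s | e * `|h| < `|p (s + h) - p s - h * slope p s|].

Lemma measurable_rough (p : R -> R) (e h : R) : cc p -> measurable (rough p e h).
Proof.
move=> pc; have ms := measurable_slope pc.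
have -> : rough p e h = setT `&` (fun s => `|p (s + h) - p s - h * slope p s|) @^-1` `]e * `|h|, +oo[.
  by rewrite setTI; apply/seteqP; split => s; rewrite /rough/= in_itv/= andbT.
have : measurable_fun setT (fun s : R => `|p (s + h) - p s - h * slope p s|).
  apply: measurableT_comp => //; apply: measurable_funB; last exact: measurable_funM.
  by apply: measurable_funB; [apply: measurable_shift|]; exact: measurable_cc.
by apply.
Qed.

(** Off the corners the expansion holds for small steps, so the sets of points
    that are rough for some step below [1 / n] decrease to a null set; the measure
    of one of them is less than [e].  Rational steps suffice by continuity and keep
    the sets measurable. *)
Lemma cc_unif (p : R -> R) (M e : R) : 0 < e -> cc p -> exists2 d, 0 < d &
  exists E : set R, [/\ measurable E, (mu E <= e%:E)%E &
    forall s h, `|s| <= M -> ~ E s -> `|h| < d ->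
      `|p (s + h) - p s - h * slope p s| <= e * `|h|].
Proof.
move=> e0 pc; have [_ pN] := pc.
pose E n := `[- M, M] `&` \bigcup_(q : rat) ([set s | `|ratr q : R| < n.+1%:R^-1] `&` rough p e (ratr q)).
have mE n : measurable (E n).
  apply: measurableI => //; apply: bigcupT_measurable_rat => q.
  apply: measurableI; last exact: measurable_rough.
  have [H|H] := pselect (`|ratr q : R| < n.+1%:R^-1).
    by rewrite (_ : mkset _ = setT)//; apply/seteqP; split.
  by rewrite (_ : mkset _ = set0)//; apply/seteqP; split.
have decE : {homo E : n m / (n <= m)%N >-> (m <= n)%O}.
  move=> n m nm; apply/subsetPset; apply: setIS => s [q _ [/= qm rq]].
  exists q => //; split => //=; apply: (lt_le_trans qm).
  by rewrite lef_pV2 ?posrE// ler_nat.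
have capE : \bigcap_n E n `<=` no_slope p.
  move=> s Es; apply: contrapT => /slopeP/(_ _ e0).
  move=> [d /= d0 Hd].
  have [n nd] : exists n, (n.+1%:R^-1 : R) < d.
    have := @cvg_harmonic R; move/cvgrPdist_lt => /(_ _ d0)[n _ /(_ n (leqnn _))].
    by rewrite /harmonic/= sub0r normrN ger0_norm// => H; exists n.
  have [_ [q _ [/= qn rq]]] := Es n Logic.I.
  have := Hd (ratr q); rewrite /ball_/= sub0r normrN => /(_ (lt_trans qn nd)).
  by rewrite leNgt rq.
have capE0 : mu (\bigcap_n E n) = 0%E.
  by apply: countable_lebesgue_measure0; exact: countableS capE pN.
have mE0 : (mu (E 0%N) < +oo)%E.
  apply: (@le_lt_trans _ _ (mu `[- M, M])).
    apply: le_measure; rewrite ?inE; [exact: mE|exact: measurable_itv|exact: subIsetl].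
  by rewrite lebesgue_measure_itv/=; case: ifPn => // _; rewrite -EFinD ltry.
have muE : (mu \o E) n @[n --> \oo] --> 0%E.
  by rewrite -capE0; exact: (nonincreasing_cvg_mu mE0 mE (bigcapT_measurable mE) decE).
have [n muEn] : exists n, (mu (E n) <= e%:E)%E.
  move/fine_cvgP : muE => [[n0 _ fE] /cvgrPdist_le/(_ _ e0)[n1 _ cE]].
  exists (maxn n0 n1).
  have := cE (maxn n0 n1) (leq_maxr _ _); rewrite /= sub0r normrN => H.
  have fn : mu (E (maxn n0 n1)) \is a fin_num by exact: (fE _ (leq_maxl _ _)).
  rewrite -(fineK fn) lee_fin.
  exact: le_trans (ler_norm _) H.
exists n.+1%:R^-1; first by rewrite invr_gt0.
exists (E n); split => // s h sM nEs hn; rewrite leNgt; apply/negP => hs.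
apply: nEs; split; first by rewrite /= in_itv/= -ler_norml.
have cp := cc_continuous pc.
pose G (h : R) : R := `|p (s + h) - p s - h * slope p s| - e * `|h|.
have cG : continuous G.
  move=> t; apply: cvgB.
    apply: cvg_norm; apply: cvgB; last by apply: cvgM; [exact: cvg_id|exact: cvg_cst].
    apply: cvgB; last exact: cvg_cst.
    by apply: continuous_comp; [apply: cvgD; [exact: cvg_cst|exact: cvg_id]|exact: cp].
  by apply: cvgM; [exact: cvg_cst|apply: cvg_norm; exact: cvg_id].
have Gh : 0 < G h by rewrite subr_gt0.
have G1 : \forall t \near h, 0 < G t by exact: (cvgr_gt _ (cG h) 0 Gh).
have G2 : \forall t \near h, `|t| < n.+1%:R^-1.
  have cn : (fun t : R => `|t|) @ h --> `|h| by apply: cvg_norm; exact: cvg_id.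
  exact: (cvgr_lt _ cn _ hn).
have [r /= r0 Hr] := filterI G1 G2.
have hr : h - r < h + r by rewrite ltrD2l (lt_trans _ r0)// oppr_lt0.
have [q] := rat_in_itvoo hr; rewrite in_itv/= => /andP[q1 q2].
have [|Gq qn] := Hr (ratr q).
  by rewrite /ball_/= ltr_norml; apply/andP; split; lra.
exists q => //; split => //=.
by move: Gq; rewrite subr_gt0.
Qed.

(** A travelling wave is differentiable in L^2, uniformly in time: the exceptional
    set of [cc_unif] is only transported and dilated. *)
Lemma cc_unif_L2 (p : R -> R) (l T e : R) : 0 < l -> 0 < e -> cc p ->
  exists2 d, 0 < d & forall t h, `|t| <= T -> `|h| < d ->
    (\int[mu]_(z in `]0%R, 1%R[) ((p (t - z / l + h) - p (t - z / l) - h * slope p (t - z / l)) ^+ 2)%:E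
      <= (e * h ^+ 2)%:E)%E.
Proof.
move=> l0 e0 pc; have [[L L0 pL] _] := pc.
(* Outside the bad set the error is at most [e1 * |h|]; on it, [2 * L * |h|], and its
   preimage in space has measure at most [l * e1]. *)
pose c := 1 + (2 * L) ^+ 2 * l.
have c0 : 0 < c by rewrite ltr_pwDl// mulr_ge0// ?sqr_ge0// ltW.
pose e1 := Num.min 1 (e / c).
have e10 : 0 < e1 by rewrite lt_min ltr01 divr_gt0.
have e11 : e1 <= 1 by rewrite ge_min lexx.
have e1e : e1 * c <= e by rewrite -ler_pdivlMr// ge_min lexx orbT.
have [d d0 [E [mE muE HE]]] := cc_unif (T + l^-1) e10 pc.
exists d => // t h tT hd.
pose aff (z : R) := (- l^-1) * z + t.
have affE z : t - z / l = aff z by rewrite /aff addrC mulrC mulNr.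
have l1 : - l^-1 != 0 by rewrite oppr_eq0 invr_eq0 gt_eqF.
have maff : measurable_fun setT (aff : measurableTypeR R -> measurableTypeR R).
  by apply: measurable_funD => //; exact: measurable_funM.
pose F := aff @^-1` E.
have mF : measurable F by rewrite -[F]setTI; exact: maff.
have muF : (mu F <= (l * e1)%:E)%E.
  rewrite /F (lebesgue_measure_affine t l1 mE) normrN gtr0_norm ?invr_gt0// invrK EFinM.
  by apply: lee_wpmul2l => //; rewrite lee_fin ltW.
have ms := measurable_slope pc; have mp := measurable_cc pc.
have mg : measurable_fun setT (fun s : R => (p (s + h) - p s - h * slope p s) ^+ 2).
  apply: measurable_funX; apply: measurable_funB; last exact: measurable_funM.
  by apply: measurable_funB => //; exact: measurable_shift.
apply: (@le_trans _ _ (\int[mu]_(z in `]0%R, 1%R[) ((e1 * h ^+ 2)%:E + ((2 * L * h) ^+ 2)%:E * (\1_F z)%:E))%E).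
  apply: ge0_le_integral => //.
  - by move=> z _; rewrite lee_fin sqr_ge0.
  - apply/measurable_EFinP; apply: measurable_funTS.
    rewrite (_ : (fun _ => _) = (fun s : R => (p (s + h) - p s - h * slope p s) ^+ 2) \o aff); last first.
      by apply/funext => z; rewrite /= affE.
    exact: (measurableT_comp mg maff).
  - apply: emeasurable_funD => //; apply: emeasurable_funM => //.
    by apply/measurable_EFinP; apply: measurable_funTS.
  move=> z; rewrite /= in_itv/= => /andP[z0 z1].
  rewrite affE -EFinM -EFinD lee_fin.
  have [Fz|Fz] := pselect (F z).
    rewrite indicE mem_set// mulr1; apply: (@le_trans _ _ ((2 * L * `|h|) ^+ 2)).
      apply: sqr_le_sqr; rewrite (le_trans (ler_normB _ _))// normrM.
      have H1 := pL (aff z + h) (aff z); rewrite (_ : aff z + h - aff z = h) in H1; last by ring.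
      have H2 := ler_wpM2l (normr_ge0 h) (slope_le (aff z) L0 pL).
      by rewrite (le_trans (lerD H1 H2))// le_eqVlt; apply/orP; left; apply/eqP; ring.
    by rewrite exprMn real_normK ?num_real// -exprMn lerDr mulr_ge0 ?sqr_ge0// ltW.
  rewrite indicE memNset// mulr0 addr0.
  have H : `|p (aff z + h) - p (aff z) - h * slope p (aff z)| <= e1 * `|h|.
    apply: HE => //; rewrite /aff (le_trans (ler_normD _ _))// addrC lerD//.
    rewrite mulNr normrN normrM gtr0_norm ?invr_gt0// ger_pMr ?invr_gt0//.
    by rewrite ger0_norm ltW.
  rewrite (le_trans (sqr_le_sqr H))// exprMn real_normK ?num_real// ler_wpM2r ?sqr_ge0//.
  by rewrite expr2 ger_pMr.
have p1 (z : R) : `]0, 1[%classic z -> (0 <= (e1 * h ^+ 2)%:E)%E.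
  by move=> _; rewrite lee_fin mulr_ge0 ?sqr_ge0// ltW.
have p2 (z : R) : `]0, 1[%classic z -> (0 <= ((2 * L * h) ^+ 2)%:E * (\1_F z)%:E)%E.
  by move=> _; rewrite -EFinM lee_fin mulr_ge0// sqr_ge0.
have m1 : measurable_fun (`]0, 1[%classic : set (measurableTypeR R)) (fun z : measurableTypeR R => (\1_F z)%:E : \bar R).
  by apply/measurable_EFinP; apply: measurable_funTS.
have m2 : measurable_fun (`]0, 1[%classic : set (measurableTypeR R)) (fun z : measurableTypeR R => ((2 * L * h) ^+ 2)%:E * (\1_F z)%:E)%E.
  exact: emeasurable_funM.
rewrite ge0_integralD//.
rewrite ge0_integralZl ?lee_fin ?sqr_ge0//.
rewrite integral_cst// integral_indic//.
change ((e1 * h ^+ 2)%:E * mu `]0%R, 1%R[%classic + ((2 * L * h) ^+ 2)%:E * mu (F `&` `]0%R, 1%R[%classic) <= (e * h ^+ 2)%:E)%E.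
rewrite lebesgue_measure_itv/= lte_fin ltr01 oppr0 adde0 mule1.
apply: (@le_trans _ _ ((e1 * h ^+ 2)%:E + ((2 * L * h) ^+ 2)%:E * (l * e1)%:E)%E).
  rewrite leeD2l// lee_wpmul2l// ?lee_fin ?sqr_ge0//.
  apply: le_trans muF; apply: le_measure; rewrite ?inE; [exact: measurableI|exact: mF|exact: subIsetl].
rewrite -EFinM -EFinD lee_fin.
rewrite (_ : _ + _ = e1 * c * h ^+ 2); last by rewrite /c; ring.
by rewrite ler_wpM2r// sqr_ge0.
Qed.

(** * Density of C^1 functions with compact support *)

Lemma lip_C1 (f : R -> R) (M : R) : (forall z, derivable f z 1) ->
  (forall z, `|derive1 f z| <= M) -> lip f M.
Proof.
move=> df fM s t.
wlog st : s t / s < t.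
  move=> H; have [st|ts|->] := ltgtP s t; first exact: H.
    by rewrite distrC (distrC s); exact: H.
  by rewrite !subrr normr0 mulr0.
have [||z _ H] := @MVT_segment _ f (derive1 f) s t (ltW st).
- move=> x _; rewrite derive1E; apply: DeriveDef => //.
- apply: derivable_within_continuous => x _; exact: df.
by rewrite distrC H normrM (distrC s) ler_wpM2r.
Qed.

Lemma integral_sqrD_le (D : set (measurableTypeR R)) (a b : R) (A B : R -> R) : measurable D ->
  measurable_fun setT A -> measurable_fun setT B ->
  (\int[mu]_(s in D) (A s ^+ 2)%:E <= a%:E)%E ->
  (\int[mu]_(s in D) (B s ^+ 2)%:E <= b%:E)%E ->
  (\int[mu]_(s in D) ((A s + B s) ^+ 2)%:E <= (2 * a + 2 * b)%:E)%E.
Proof.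
move=> mD mA mB Aa Bb.
have msq (C : R -> R) : measurable_fun setT C -> measurable_fun D (fun s : measurableTypeR R => (C s ^+ 2)%:E).
  by move=> mC; apply/measurable_EFinP; apply: measurable_funTS; exact: measurable_funX.
have mAB : measurable_fun D (fun s : measurableTypeR R => ((A s + B s) ^+ 2)%:E).
  by apply: (msq (fun s => A s + B s)); exact: measurable_funD.
apply: (@le_trans _ _ (\int[mu]_(s in D) (2%:E * (A s ^+ 2)%:E + 2%:E * (B s ^+ 2)%:E))%E).
  apply: ge0_le_integral => //.
  - by move=> s _; rewrite lee_fin sqr_ge0.
  - by apply: emeasurable_funD; apply: emeasurable_funM => //; exact: msq.
  - move=> s _; rewrite -!EFinM -EFinD lee_fin -subr_ge0.
    rewrite (_ : _ - _ = (A s - B s) ^+ 2) ?sqr_ge0//; by ring.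
rewrite ge0_integralD//; last 4 first.
- by move=> s _; rewrite -EFinM lee_fin mulr_ge0// sqr_ge0.
- by apply: emeasurable_funM => //; exact: msq.
- by move=> s _; rewrite -EFinM lee_fin mulr_ge0// sqr_ge0.
- by apply: emeasurable_funM => //; exact: msq.
rewrite !ge0_integralZl//; try exact: msq; try (by move=> s _; rewrite lee_fin sqr_ge0).
by rewrite [leRHS]EFinD (EFinM 2 a) (EFinM 2 b); apply: leeD; apply: lee_wpmul2l.
Qed.

Definition L2close (f g : R -> R) (e : R) : Prop :=
  (\int[mu]_(z in `]0%R, 1%R[) ((f z - g z) ^+ 2)%:E <= e%:E)%E.

Definition appr (f : R -> R) : Prop := measurable_fun setT f /\
  forall e, 0 < e -> exists2 v, C1c01 v & L2close f v e.

Lemma C1c01_continuous (v : R -> R) : C1c01 v -> continuous v.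
Proof. by move=> [dv _ _] z; apply/differentiable_continuous/derivable1_diffP. Qed.

Lemma C1c01_measurable (v : R -> R) : C1c01 v -> measurable_fun setT v.
Proof. by move=> vC; apply: continuous_measurable_fun; exact: C1c01_continuous. Qed.

Lemma L2close_trans (f g h : R -> R) (e e' : R) : measurable_fun setT f ->
  measurable_fun setT g -> measurable_fun setT h ->
  L2close f g e -> L2close g h e' -> L2close f h (2 * e + 2 * e').
Proof.
move=> mf mg mh fg gh; rewrite /L2close.
under eq_integral => z _ do rewrite -(subrK (g z) (f z)) -addrA.
by apply: integral_sqrD_le => //; exact: measurable_funB.
Qed.

Lemma appr_close (f : R -> R) : measurable_fun setT f ->
  (forall e, 0 < e -> exists2 g, appr g & L2close f g e) -> appr f.
Proof.
move=> mf H; split => // e e0; have e4 : 0 < e / 4 by rewrite divr_gt0.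
have [g [mg gA] fg] := H _ e4; have [v vC gv] := gA _ e4.
exists v => //; rewrite (_ : e = 2 * (e / 4) + 2 * (e / 4)); last by field.
by apply: (L2close_trans mf mg) => //; exact: C1c01_measurable.
Qed.

Lemma appr_lim (f F : R -> R) (f_ : nat -> R -> R) : measurable_fun setT f ->
  mu.-integrable `]0, 1[ (EFin \o F) -> (forall n, appr (f_ n)) ->
  (forall n z, 0 < z < 1 -> (f z - f_ n z) ^+ 2 <= F z) ->
  (forall z, 0 < z < 1 -> f_ n z @[n --> \oo] --> f z) -> appr f.
Proof.
move=> mf Fi fA fF fcvg; apply: appr_close => // e e0.
have mff n : measurable_fun setT (fun z : R => (f z - f_ n z) ^+ 2).
  by apply: measurable_funX; apply: measurable_funB => //; have [] := fA n.
have [] := @dominated_convergence _ _ _ mu `]0, 1[ (measurable_itv _)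
  (fun n => EFin \o (fun z => (f z - f_ n z) ^+ 2)) (cst 0%E) (EFin \o F).
- by move=> n; apply/measurable_EFinP; apply: measurable_funTS; exact: mff.
- exact: measurable_cst.
- apply: aeW => z /=; rewrite in_itv/= => z01.
  apply: cvg_EFin; first exact: nearW.
  have := cvgM (cvgB (cvg_cst (f z)) (fcvg _ z01)) (cvgB (cvg_cst (f z)) (fcvg _ z01)).
  by rewrite subrr mulr0; apply.
- exact: Fi.
- by apply: aeW => z n /=; rewrite in_itv/= => z01; rewrite lee_fin ger0_norm ?sqr_ge0// fF.
move=> _ _; rewrite integral0 => /fine_cvgP[[n0 _ fE] /cvgrPdist_le/(_ _ e0)[n1 _ cE]].
set N := maxn n0 n1; exists (f_ N) => //.
have fn := fE N (leq_maxl _ _); have := cE N (leq_maxr _ _); rewrite /= sub0r normrN => H.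
rewrite /L2close; rewrite /= in fn.
by rewrite -(fineK fn) lee_fin (le_trans (ler_norm _) H).
Qed.

Lemma cont_comp (f g : R -> R) : continuous f -> continuous g -> continuous (fun z => g (f z)).
Proof. by move=> cf cg z; apply: continuous_comp; [exact: cf|exact: cg]. Qed.

Lemma appr_C1c01 (v : R -> R) : C1c01 v -> appr v.
Proof.
move=> vC; split; first exact: C1c01_measurable.
move=> e e0; exists v => //; rewrite /L2close.
under eq_integral do rewrite subrr expr0n /=.
by rewrite integral0 lee_fin ltW.
Qed.

Lemma primitive_cst (psi : R -> R) (b z : R) : 0 <= b -> continuous psi ->
  (forall z, b <= z -> psi z = 0) -> b <= z ->
  \int[mu]_(s in `[0, z]) psi s = \int[mu]_(s in `[0, b]) psi s.
Proof.
move=> b0 cpsi psi0 bz; apply/eqP; rewrite -subr_eq0.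
rewrite (@Rintegral_itvB _ psi (BLeft 0) (BRight z) b (continuous_integrable _ _ cpsi)) ?bnd_simp//.
rewrite (@eq_Rintegral _ _ _ _ _ (cst 0)) ?Rintegral_cst// ?mul0r//.
by move=> t; rewrite inE/= in_itv/= => /andP[bt _]; rewrite psi0// ltW.
Qed.

(** The functions [f_ n] are difference quotients of the primitive of [h]; they
    are of class C^1 with compact support and converge to [h] boundedly. *)
Lemma appr_cont_supp (h : R -> R) (a b M : R) : 0 < a -> 0 <= b -> b < 1 -> continuous h ->
  (forall z, z <= a -> h z = 0) -> (forall z, b <= z -> h z = 0) ->
  (forall z, `|h z| <= M) -> appr h.
Proof.
move=> a0 b0 b1 ch h_l h_r hM.
have [PD P_l] := C1_primitive a0 ch h_l.
pose P z := \int[mu]_(s in `[0, z]) h s.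
have dP z : derivable P z 1 by have [] := PD z.
have P' z : derive1 P z = h z by have [] := PD z.
have sP z : is_slope P z (h z) by rewrite -P'; exact: is_slope_derive.
have lP : lip P M by apply: lip_C1 => // z; rewrite P'.
pose c := a / 2; have c0 : 0 < c by rewrite divr_gt0.
have ca : c < a by rewrite /c; lra.
pose d n := c * n.+1%:R^-1 : R.
have d0 n : 0 < d n by rewrite mulr_gt0// invr_gt0.
have dc n : d n <= c by rewrite ger_pMr// invf_le1// ler1n.
pose f_ n z := (d n)^-1 * (P (1 * z + d n) + (-1) * P z).
have sf n z : is_slope (f_ n) z ((d n)^-1 * (1 * h (1 * z + d n) + (-1) * h z)).
  by apply: is_slope_scale; apply: is_slope_add; [exact: is_slope_affine|exact: is_slope_scale].
have fC n : C1c01 (f_ n).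
  split; first by move=> z; have [] := is_slope_derivable (sf n z).
    rewrite (_ : derive1 _ = fun z => (d n)^-1 * (1 * h (1 * z + d n) + (-1) * h z)); last first.
      by apply/funext => z; have [] := is_slope_derivable (sf n z).
    have chd : continuous (fun z : R => h (1 * z + d n)).
      move=> z; apply: continuous_comp; last exact: ch.
      by apply: cvgD; [apply: cvgM; [exact: cvg_cst|exact: cvg_id]|exact: cvg_cst].
    move=> z; apply: cvgM; first exact: cvg_cst.
    apply: cvgD; (apply: cvgM; first exact: cvg_cst); [exact: chd|exact: ch].
  exists (a / 2), b; split => //.
  move=> z; rewrite in_itv/= negb_and -!ltNge /f_ => /orP[za|bz].
    have Pz : P z = 0 by apply: P_l; rewrite (le_trans (ltW za))// ltW.
    have Pz' : P (1 * z + d n) = 0.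
      by apply: P_l; have := dc n; rewrite /c in ca *; lra.
    by rewrite Pz Pz' mulr0 addr0 mulr0.
  have -> : P z = P b by apply: primitive_cst => //; exact: ltW.
  have -> : P (1 * z + d n) = P b.
    by apply: primitive_cst => //; rewrite mul1r ler_wpDr// ltW.
  by rewrite mulN1r subrr mulr0.
have fM n z : `|f_ n z| <= M.
  rewrite /f_ mulN1r mul1r normrM gtr0_norm ?invr_gt0// ler_pdivrMl// mulrC.
  apply: le_trans (lP _ _) _; rewrite (_ : z + d n - z = d n); last by ring.
  by rewrite gtr0_norm.
apply: (@appr_lim h (cst ((2 * M) ^+ 2)) f_).
- exact: continuous_measurable_fun.
- apply: (@integrableS _ _ _ mu `[0, 1]) => //; first exact: subset_itv_oo_cc.
  by apply: continuous_integrable => z; exact: cvg_cst.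
- by move=> n; exact: appr_C1c01.
- move=> n z _; apply: sqr_le_sqr; rewrite (le_trans (ler_normB _ _))//.
  by rewrite mulr2n mulrDl mul1r lerD.
- move=> z _.
  have H : is_slope (fun t => P (c * t + 0)) (z / c) (c * h (c * (z / c) + 0)).
    by apply: is_slope_affine; exact: sP.
  have cz : c * (z / c) = z by rewrite mulrC divfK// gt_eqF.
  rewrite addr0 cz in H; have {H} H := is_slope_seq H.
  have E0 : P (c * (z / c) + 0) = P z by rewrite addr0 cz.
  have H1 : c^-1 * (n.+1%:R * (P (c * (z / c + n.+1%:R^-1) + 0) - P z)) @[n --> \oo] --> c^-1 * (c * h z).
    by apply: cvgM; [exact: cvg_cst|by rewrite -E0; exact: H].
  rewrite mulKf ?gt_eqF// in H1.
  suff -> : f_ ^~ z = fun n => c^-1 * (n.+1%:R * (P (c * (z / c + n.+1%:R^-1) + 0) - P z)) by exact: H1.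
  apply/funext => n.
  have -> : c * (z / c + n.+1%:R^-1) + 0 = z + c * n.+1%:R^-1 by rewrite addr0 mulrDr cz.
  by rewrite /f_ /d mul1r mulN1r invfM invrK mulrA.
Qed.

(** Multiplication by cut-offs that increase to the indicator of ]0, 1[. *)
Lemma appr_cont (g : R -> R) (M : R) : continuous g -> (forall z, `|g z| <= M) -> appr g.
Proof.
move=> cg gM.
pose cut (k : nat) z := clamp 0 1 (Num.min (k.+2%:R * z - 1) (k.+2%:R * (1 - z) - 1)) : R.
have ccut k : continuous (cut k).
  have c1 : continuous (fun z : R => k.+2%:R * z - 1).
    by move=> z; apply: cvgB; [apply: cvgM; [exact: cvg_cst|exact: cvg_id]|exact: cvg_cst].
  have c2 : continuous (fun z : R => k.+2%:R * (1 - z) - 1).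
    move=> z; apply: cvgB; last exact: cvg_cst.
    by apply: cvgM; [exact: cvg_cst|apply: cvgB; [exact: cvg_cst|exact: cvg_id]].
  apply: (@cont_comp (fun z => Num.min (k.+2%:R * z - 1) (k.+2%:R * (1 - z) - 1)) (clamp 0 1)); last exact: continuous_clamp.
  by move=> z; apply: (continuous_min (c1 z) (c2 z)).
have cut01 k z : 0 <= cut k z <= 1 by exact: clamp_itv.
have k0 k : 0 < k.+2%:R :> R by [].
have cut_l k z : z <= k.+2%:R^-1 -> cut k z = 0.
  move=> zk; apply/max_idPl; rewrite ge_min; apply/orP; left.
  rewrite ge_min; apply/orP; left; rewrite subr_le0 mulrC.
  by rewrite -ler_pdivlMr// div1r.
have cut_r k z : 1 - k.+2%:R^-1 <= z -> cut k z = 0.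
  move=> zk; apply/max_idPl; rewrite ge_min; apply/orP; left.
  rewrite ge_min; apply/orP; right; rewrite subr_le0 mulrC.
  by rewrite -ler_pdivlMr// div1r lerBlDr addrC -lerBlDr.
have k1 k : k.+2%:R^-1 <= 1 :> R by rewrite invf_le1// ler1n.
apply: (@appr_lim g (cst (M ^+ 2)) (fun k z => g z * cut k z)).
- exact: continuous_measurable_fun.
- apply: (@integrableS _ _ _ mu `[0, 1]) => //; first exact: subset_itv_oo_cc.
  by apply: continuous_integrable => z; exact: cvg_cst.
- move=> k; apply: (@appr_cont_supp _ k.+2%:R^-1 (1 - k.+2%:R^-1) M).
  + by rewrite invr_gt0.
  + by rewrite subr_ge0.
  + by rewrite ltrBlDr ltrDl invr_gt0.
  + by move=> z; apply: cvgM; [exact: cg|exact: ccut].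
  + by move=> z zk; rewrite cut_l// mulr0.
  + by move=> z zk; rewrite cut_r// mulr0.
  + move=> z; have /andP[c0 c1] := cut01 k z.
    by rewrite normrM (le_trans _ (gM z))// (ger0_norm c0) ler_piMr.
- move=> k z _; have /andP[c0 c1] := cut01 k z.
  apply: sqr_le_sqr; rewrite -[X in X - _]mulr1 -mulrBr normrM (le_trans _ (gM z))//.
  by rewrite ler_piMr// ger0_norm ?subr_ge0// gerBl.
- move=> z /andP[z0 z1]; rewrite -[X in _ --> X]mulr1.
  apply: cvgM; first exact: cvg_cst.
  apply: cvg_near_cst; near=> k.
  have kz : 2 / z <= k.+2%:R.
    by rewrite (le_trans _ (_ : k%:R <= _)) ?ler_nat ?leqW//; near: k; exact: nbhs_infty_ger.
  have kz' : 2 / (1 - z) <= k.+2%:R.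
    by rewrite (le_trans _ (_ : k%:R <= _)) ?ler_nat ?leqW//; near: k; exact: nbhs_infty_ger.
  rewrite ler_pdivrMr// in kz; rewrite ler_pdivrMr ?subr_gt0// in kz'.
  rewrite /cut /clamp (@min_r _ _ _ 1); last by rewrite le_min; apply/andP; split; lra.
  by rewrite max_r.
Unshelve. all: by end_near. Qed.

Lemma appr_bounded (f : R -> R) (M : R) : measurable_fun setT f ->
  (forall z, `|f z| <= M) -> appr f.
Proof.
move=> mf fM; have M0 : 0 <= M by rewrite (le_trans _ (fM 0)).
apply: appr_close => // e e0.
have mu1 : (mu `]0%R, 1%R[%classic < +oo)%E.
  by rewrite lebesgue_measure_itv/= lte_fin ltr01 -EFinD ltry.
have fi : mu.-integrable `]0, 1[ (EFin \o f).
  apply: measurable_bounded_integrable => //.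
  - exact: measurable_funTS.
  - by exists M; split; [exact: num_real|move=> x Mx z _; apply: le_trans (fM z) _; exact: ltW].
have [g_ [cg gi]] := approximation_continuous_integrable (measurable_itv `]0, 1[) mu1 fi.
have c0 : 0 < 2 * M + 1 by lra.
have ec : 0 < e / (2 * M + 1) by rewrite divr_gt0.
move=> /fine_cvgP[[n0 _ fE] /cvgrPdist_le/(_ _ ec)[n1 _ cE]].
set N := maxn n0 n1; exists (clamp (- M) M \o g_ N).
  apply: (@appr_cont _ M).
    by move=> z; apply: continuous_comp; [exact: cg|exact: continuous_clamp].
  move=> z; rewrite ler_norml; apply: clamp_itv; lra.
have fn := fE N (leq_maxl _ _); have := cE N (leq_maxr _ _); rewrite /= sub0r normrN => H.
rewrite /= in fn.
have mg : measurable_fun setT (g_ N) by exact: continuous_measurable_fun.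
have mcg : measurable_fun setT (clamp (- M) M \o g_ N).
  apply: continuous_measurable_fun => z.
  by apply: continuous_comp; [exact: cg|exact: continuous_clamp].
have ma : measurable_fun (`]0, 1[%classic : set (measurableTypeR R)) (fun z : measurableTypeR R => `|(f z - g_ N z)%:E|%E).
  apply: measurableT_comp => //; apply/measurable_EFinP; apply: measurable_funTS.
  exact: measurable_funB.
rewrite /L2close.
apply: (@le_trans _ _ (\int[mu]_(z in `]0%R, 1%R[) ((2 * M + 1)%:E * `|(f z - g_ N z)%:E|))%E).
  apply: ge0_le_integral => //.
  - by move=> z _; rewrite lee_fin sqr_ge0.
  - apply/measurable_EFinP; apply: measurable_funTS; apply: measurable_funX.
    exact: measurable_funB.
  - exact: emeasurable_funM.
  - move=> z _; rewrite -EFinM lee_fin -real_normK ?num_real// expr2.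
    have h1 : `|f z - (clamp (- M) M \o g_ N) z| <= `|f z - g_ N z|.
      have := fM z; rewrite ler_norml /= /clamp => /andP[f1 f2].
      have [h|h] := leP (g_ N z) M.
        have [h'|h'] := leP (- M) (g_ N z) => //.
        by rewrite (@ger0_norm _ (f z - - M)) ?(@ger0_norm _ (f z - g_ N z)); lra.
      rewrite max_r; last by lra.
      by rewrite (@ler0_norm _ (f z - M)) ?(@ler0_norm _ (f z - g_ N z)); lra.
    apply: ler_pM => //.
    have := clamp_itv (g_ N z) (_ : - M <= M); rewrite -ler_norml => H2.
    rewrite (le_trans (ler_normB _ _))//; have := fM z; have := H2 _ => /=; lra.
rewrite ge0_integralZl ?lee_fin//; last exact: ltW.
rewrite -(fineK fn) -EFinM lee_fin mulrC -ler_pdivlMr//.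
exact: le_trans (ler_norm _) H.
Qed.

Lemma appr_L2 (f : R -> R) : measurable_fun setT f ->
  (\int[mu]_(z in `]0%R, 1%R[) ((f z) ^+ 2)%:E < +oo)%E -> appr f.
Proof.
move=> mf fi.
apply: (@appr_lim f (fun z => f z ^+ 2) (fun k => clamp (- k%:R) k%:R \o f)) => //.
- apply/integrableP; split.
    by apply/measurable_EFinP; apply: measurable_funTS; exact: measurable_funX.
  by under eq_integral do rewrite /= ger0_norm ?sqr_ge0//.
- move=> k; apply: (@appr_bounded _ k%:R).
    apply: measurableT_comp => //; apply: continuous_measurable_fun; exact: continuous_clamp.
  move=> z; rewrite ler_norml; apply: clamp_itv.
  by have : 0 <= k%:R :> R by []; lra.
- move=> k z _; have k0 : 0 <= k%:R :> R by [].
  rewrite -[leRHS]real_normK ?num_real//; apply: sqr_le_sqr; rewrite /= /clamp.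
  have [h|h] := leP (f z) k%:R.
    have [h'|h'] := leP (- k%:R) (f z); first by rewrite subrr normr0.
    by rewrite (@ler0_norm _ (f z - - _)) ?(@ler0_norm _ (f z)); lra.
  rewrite max_r; last by lra.
  by rewrite !ger0_norm; lra.
- move=> z _; apply: cvg_near_cst; near=> k; rewrite /= clampE// -ler_norml.
  by near: k; exact: nbhs_infty_ger.
Unshelve. all: by end_near. Qed.

Lemma supp_bounded (f : R -> R) (a b : R) : continuous f ->
  (forall z, z \notin `[a, b] -> f z = 0) -> exists2 M, 0 <= M & forall z, `|f z| <= M.
Proof.
move=> cf f0.
have cf' : {within `[a, b], continuous f} by exact: continuous_subspaceT.
have /compact_bounded[M [Mr HM]] := continuous_compact cf' (@segment_compact _ a b).
exists (Num.max 0 (M + 1)); first by rewrite le_max lexx.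
move=> z; rewrite le_max; apply/orP.
have [zab|/f0 ->] := boolP (z \in `[a, b]); last by left; rewrite normr0.
right; apply: (HM (M + 1)); first by rewrite ltrDl.
by exists z.
Qed.

Lemma C1c01_cc (v : R -> R) : C1c01 v -> cc v.
Proof.
move=> [dv cv [a [b [a0 b1 v0]]]].
have [z|M M0 HM] := @supp_bounded (derive1 v) a b cv.
  move=> zab; rewrite derive1E (@near_eq_derive _ _ _ _ (cst 0)) ?derive_cst//.
  move: zab; rewrite in_itv/= negb_and -!ltNge => /orP[za|bz]; near=> t; apply: v0.
    by rewrite in_itv/= negb_and -ltNge; apply/orP; left; near: t; exact: lt_nbhsl.
  by rewrite in_itv/= negb_and -!ltNge; apply/orP; right; near: t; exact: lt_nbhsr.
split; first by exists M => //; exact: lip_C1.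
apply: (@countableS _ _ set0) => // z /=; apply; exists (derive1 v z).
exact: is_slope_derive.
Unshelve. all: by end_near. Qed.

(** The primitive over [0, z] is a primitive on the whole line because [f] vanishes
    near 0. *)
Lemma C1c01_primitive (f : R -> R) : C1c01 f ->
  exists u, [/\ cc u, u 0 = 0 & forall z, is_slope u z (f z)].
Proof.
move=> fC; have cf := C1c01_continuous fC; have [_ _ [a [b [a0 b1 f0]]]] := fC.
have [M M0 HM] := supp_bounded cf f0.
have f_l z : z <= a / 2 -> f z = 0.
  by move=> za; apply: f0; rewrite in_itv/= negb_and -ltNge; apply/orP; left; lra.
have a2 : 0 < a / 2 by lra.
have [uD u0] := C1_primitive a2 cf f_l.
have us z : is_slope (fun z => \int[mu]_(s in `[0, z]) f s) z (f z).
  by have [du <-] := uD z; exact: is_slope_derive.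
exists (fun z => \int[mu]_(s in `[0, z]) f s); split => //; last by rewrite u0// ltW.
split.
  by exists M => //; apply: lip_C1 => z; have [du du'] := uD z => //; rewrite du'.
by apply: (@countableS _ _ set0) => // z /=; apply; exists (f z).
Qed.

End RealAnalysis.

(** * The space L^2(0, 1; R^n) and its weighted norms *)

Section L2space.
Context {R : realType}.
Local Notation mu := (@lebesgue_measure R).
Local Notation D01 := (`]0, 1[%classic : set (measurableTypeR R)).

(** Almost everywhere statements for the measure behind L^2(0, 1) are turned into
    statements for Lebesgue measure, the form used throughout. *)
Lemma ae_mu01 (P : R -> Prop) :
  {ae @mu01 R, forall z, P z} <-> {ae mu, forall z, 0 < z < 1 -> P z}.
Proof.
have mD : measurable D01 by [].
split=> -[N [mN N0 NP]].
  exists (N `&` D01); split; [exact: measurableI|exact: N0|].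
  move=> z /= /not_implyP[z01 Pz]; split; last by rewrite in_itv.
  exact: NP.
exists (N `|` ~` D01); split.
- by apply: measurableU => //; exact: measurableC.
- rewrite /mu01/= /mrestr setIUl setICl setU0.
  apply/eqP; rewrite -measure_le0; have <- : mu N = 0%E by exact: N0.
  apply: le_measure; rewrite ?inE; [exact: measurableI|exact: mN|exact: subIsetl].
- move=> z /= Pz; have [z01|z01] := pselect (0 < z < 1).
    by left; apply: NP => /=; apply/not_implyP.
  by right; rewrite in_itv.
Qed.

Lemma integral_mu01 (f : R -> \bar R) : measurable_fun setT (f : measurableTypeR R -> \bar R) ->
  (\int[@mu01 R]_z f z = \int[mu]_(z in `]0%R, 1%R[) f z)%E.
Proof.
move=> mf; have mD : measurable D01 by [].
transitivity (\int[@mu01 R]_z (f \_ D01) z)%E.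
  apply: ae_eq_integral => //.
    by apply/(measurable_restrictT _ mD); apply: measurable_funTS.
  have : {ae @mu01 R, forall z, z \in D01}.
    by apply/ae_mu01; apply: aeW => z z01; rewrite inE/= in_itv.
  apply: (@filterS _ _ (ae_filter_ringOfSetsType (@mu01 R))) => z zD _.
  by rewrite patchE zD.
rewrite -integral_mkcond.
apply: eq_measure_integral => A mA AD.
by rewrite /mu01/= /mrestr setIidl.
Qed.

Context {n : nat}.
Implicit Types x y : L2 R n.

Lemma L2_sqr_normE x :
  (\int[mu]_(z in `]0%R, 1%R[) (\sum_i x z i 0 ^+ 2)%:E = (`|x| ^+ 2)%:E)%E.
Proof.
have mx := L2_measurable_enorm x.
have H := L2_normE x.
rewrite unlock in H.
have : (((L2_norm x)%:E) `^ 2 = \int[@mu01 R]_z `|(EFin \o (enorm \o x)) z| `^ 2)%E.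
  rewrite H -poweRrM mulVf ?pnatr_eq0// poweRe1//.
  by apply: integral_ge0 => z _; exact: poweR_ge0.
rewrite integral_mu01; last exact: measurable_Lnorm2_integrand.
move=> E; transitivity (\int[mu]_(z in `]0%R, 1%R[) `|(EFin \o (enorm \o x)) z| `^ 2)%E.
  apply: eq_integral => z _ /=.
  by rewrite ger0_norm ?enorm_ge0// powR_mulrn ?enorm_ge0// enorm_sqr.
rewrite -E /= powR_mulrn//.
by have := normr_ge0 x.
Qed.

Lemma integrable_dom (D : set (measurableTypeR R)) (f F : R -> R) : measurable D -> measurable_fun setT f ->
  mu.-integrable D (EFin \o F) -> (forall z, D z -> `|f z| <= F z) ->
  mu.-integrable D (EFin \o f).
Proof.
move=> mD mf Fi fF; apply: (le_integrable mD _ _ Fi).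
  by apply/measurable_EFinP; exact: measurable_funTS.
move=> z Dz /=; rewrite lee_fin; apply: (le_trans (fF z Dz)); exact: ler_norm.
Qed.

Lemma integrable_L2_sqr x i : mu.-integrable `]0, 1[ (EFin \o (fun z => x z i 0 ^+ 2)).
Proof.
apply/integrableP; split.
  by apply/measurable_EFinP; apply: measurable_funTS; apply: measurable_funX; exact: L2_measurable.
apply: (@le_lt_trans _ _ ((`|x| ^+ 2)%:E)); last exact: ltry.
rewrite -L2_sqr_normE; apply: ge0_le_integral => //.
- by apply/measurable_EFinP; apply: measurable_funTS; apply: measurableT_comp => //; apply: measurable_funX; exact: L2_measurable.
- apply/measurable_EFinP; apply: measurable_funTS; apply: measurable_sum => j.
  by apply: measurable_funX; exact: L2_measurable.
- move=> z _; rewrite lee_fin ger0_norm ?sqr_ge0// (bigD1 i)//= lerDl.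
  by apply: sumr_ge0 => j _; exact: sqr_ge0.
Qed.

Lemma integrable_L2_prod x y i : mu.-integrable `]0, 1[ (EFin \o (fun z => x z i 0 * y z i 0)).
Proof.
apply: (@integrable_dom _ _ (fun z => x z i 0 ^+ 2 + y z i 0 ^+ 2)) => //.
- by apply: measurable_funM; exact: L2_measurable.
- by apply: integrable_add => //; exact: integrable_L2_sqr.
- move=> z _; move: (x z i 0) (y z i 0) => a b; rewrite ler_norml; apply/andP; split; nra.
Qed.

Lemma integrable_L2 x i : mu.-integrable `]0, 1[ (EFin \o (fun z => x z i 0)).
Proof.
apply: (@integrable_dom _ _ (fun z => 1 + x z i 0 ^+ 2)) => //.
- exact: L2_measurable.
- apply: integrable_add => //; last exact: integrable_L2_sqr.
  apply: (@integrableS _ _ _ mu `[0, 1]) => //; first exact: subset_itv_oo_cc.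
  by apply: continuous_integrable => z; exact: cvg_cst.
- move=> z _; move: (x z i 0) => a; rewrite ler_norml; apply/andP; split; nra.
Qed.

Lemma Rintegral_ae_eq (f g : R -> R) : measurable_fun setT f -> measurable_fun setT g ->
  {ae mu, forall z, 0 < z < 1 -> f z = g z} ->
  \int[mu]_(z in `]0, 1[) f z = \int[mu]_(z in `]0, 1[) g z.
Proof.
move=> mf mg fg; rewrite /Rintegral; congr fine; apply: ae_eq_integral => //.
- by apply/measurable_EFinP; exact: measurable_funTS.
- by apply/measurable_EFinP; exact: measurable_funTS.
move: fg; apply: ae_filterS => z H /=.
by rewrite in_itv/= => z01; rewrite H.
Qed.

Lemma aeD x y i : {ae mu, forall z, 0 < z < 1 -> (x + y : L2 R n) z i 0 = x z i 0 + y z i 0}.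
Proof.
have := (ae_mu01 _).1 (L2D x y).
apply: ae_filterS => z H /H ->.
by rewrite mxE.
Qed.

Lemma aeZ a x i : {ae mu, forall z, 0 < z < 1 -> (a *: x : L2 R n) z i 0 = a * x z i 0}.
Proof.
have := (ae_mu01 _).1 (L2Z a x).
apply: ae_filterS => z H /H ->.
by rewrite mxE.
Qed.

(** An affine weight suffices: it grows by the factor [1 + k] from [z = 0] to
    [z = 1], and its derivative is at most [k] times the weight. *)
Definition wip (r : 'I_n -> R) (k : R) x y : R :=
  \sum_i \int[mu]_(z in `]0, 1[) (r i * (1 + k * z) * (x z i 0 * y z i 0)).

Section Wip.
Variables (r : 'I_n -> R) (k : R).
Local Notation B := (wip r k).

Lemma measurable_weight i : measurable_fun setT (fun z : R => r i * (1 + k * z)).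
Proof. by apply: measurable_funM => //; apply: measurable_funD => //; exact: measurable_funM. Qed.

Lemma weight_le i z : 0 < z < 1 -> `|r i * (1 + k * z)| <= `|r i| * (1 + `|k|).
Proof.
move=> /andP[z0 z1]; rewrite normrM ler_wpM2l// (le_trans (ler_normD _ _))// normr1 lerD2l.
by rewrite normrM ler_piMr// gtr0_norm// ltW.
Qed.

Lemma measurable_wip x y i : measurable_fun setT
  (fun z : R => r i * (1 + k * z) * (x z i 0 * y z i 0)).
Proof.
by apply: measurable_funM; [exact: measurable_weight|apply: measurable_funM; exact: L2_measurable].
Qed.

Lemma integrable_wip x y i : mu.-integrable `]0, 1[
  (EFin \o (fun z => r i * (1 + k * z) * (x z i 0 * y z i 0))).
Proof.
apply: (@integrable_dom _ _ (fun z => `|r i| * (1 + `|k|) * (x z i 0 ^+ 2 + y z i 0 ^+ 2))) => //.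
- exact: measurable_wip.
- by apply: integrable_scale => //; apply: integrable_add => //; exact: integrable_L2_sqr.
- move=> z; rewrite /= in_itv/= => z01; rewrite normrM ler_pM//; first exact: weight_le.
  by move: (x z i 0) (y z i 0) => a b; rewrite ler_norml; apply/andP; split; nra.
Qed.

Lemma wipC x y : B x y = B y x.
Proof. by apply: eq_bigr => i _; apply: eq_Rintegral => z _; rewrite (mulrC (x z i 0)). Qed.

Lemma wipDl x1 x2 y : B (x1 + x2) y = B x1 y + B x2 y.
Proof.
rewrite -big_split/=; apply: eq_bigr => i _.
rewrite -RintegralD//; [|exact: integrable_wip..].
apply: Rintegral_ae_eq; [exact: measurable_wip|apply: measurable_funD; exact: measurable_wip|].
have := aeD x1 x2 i; apply: ae_filterS => z H /H ->.
by rewrite mulrDl mulrDr.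
Qed.

Lemma wipZl a x y : B (a *: x) y = a * B x y.
Proof.
rewrite mulr_sumr; apply: eq_bigr => i _.
rewrite -RintegralZl//; last exact: integrable_wip.
apply: Rintegral_ae_eq; [exact: measurable_wip|apply: measurable_funM => //; exact: measurable_wip|].
have := aeZ a x i; apply: ae_filterS => z H /H ->.
by ring.
Qed.

Lemma wipDr x y1 y2 : B x (y1 + y2) = B x y1 + B x y2.
Proof. by rewrite wipC wipDl !(wipC x). Qed.

Lemma wipZr a x y : B x (a *: y) = a * B x y.
Proof. by rewrite wipC wipZl (wipC x). Qed.

Hypotheses (r0 : forall i, 0 < r i) (k0 : 0 <= k).

Lemma wip_ge0 x : 0 <= B x x.
Proof.
apply: sumr_ge0 => i _; apply: Rintegral_ge0 => z; rewrite /= in_itv/= => /andP[z0 z1].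
by rewrite mulr_ge0 ?(mulr_ge0 (ltW (r0 i)))// -?expr2 ?sqr_ge0// addr_ge0// mulr_ge0// ltW.
Qed.

(** The norm for which the transport operator is quasi-dissipative. *)
Definition wnorm x : R := Num.sqrt (B x x).

Lemma wnorm_ge0 x : 0 <= wnorm x. Proof. exact: sqrtr_ge0. Qed.

Lemma wnorm_sqr x : wnorm x ^+ 2 = B x x.
Proof. by rewrite sqr_sqrtr// wip_ge0. Qed.

Lemma wip_CS x y : B x y <= wnorm x * wnorm y.
Proof.
suff H : B x y ^+ 2 <= B x x * B y y.
  rewrite /wnorm -sqrtrM ?wip_ge0// (le_trans (ler_norm _))// -sqrtr_sqr.
  by rewrite ler_wsqrtr.
have Q s : 0 <= B x x - 2 * s * B x y + s ^+ 2 * B y y.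
  have := wip_ge0 (x + (- s) *: y).
  rewrite wipDl !wipDr !wipZl !wipZr (wipC y x); congr (0 <= _); ring.
have [yy|yy] := eqVneq (B y y) 0.
  have [->|xy] := eqVneq (B x y) 0; first by rewrite yy expr0n mulr0.
  have := Q ((B x x + 1) / (2 * B x y)); rewrite yy mulr0 addr0.
  rewrite (_ : _ - _ = -1); last by field.
  by rewrite lerNr oppr0 ler10.
have y0 : 0 < B y y by rewrite lt_def yy wip_ge0.
have := Q (B x y / B y y); rewrite -(pmulr_rge0 _ y0).
rewrite [X in 0 <= X](_ : _ = B x x * B y y - B x y ^+ 2); last by move: (B x x) (B y y) (B x y) yy => a b c b0; field.
by rewrite subr_ge0.
Qed.

Lemma wnormD x y : wnorm (x + y) <= wnorm x + wnorm y.
Proof.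
rewrite -(@ler_pXn2r _ 2)// ?nnegrE ?addr_ge0 ?wnorm_ge0//.
rewrite wnorm_sqr sqrrD !wnorm_sqr wipDl !wipDr (wipC y x).
have := wip_CS x y; rewrite mulr2n; lra.
Qed.

End Wip.

Lemma norm_wip x : `|x| ^+ 2 = wip (fun=> 1) 0 x x.
Proof.
transitivity (fine (\int[mu]_(z in `]0%R, 1%R[) (\sum_i x z i 0 ^+ 2)%:E)%E).
  by rewrite L2_sqr_normE.
rewrite /wip.
pose S (s : seq 'I_n) (z : R) : R := \sum_(i <- s) x z i 0 ^+ 2.
have H s : mu.-integrable `]0, 1[ (EFin \o S s) /\
   \int[mu]_(z in `]0, 1[) S s z =
   \sum_(i <- s) \int[mu]_(z in `]0, 1[) (1 * (1 + 0 * z) * (x z i 0 * x z i 0)).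
  elim: s => [|i s [IH1 IH2]].
    have -> : S [::] = cst 0 by apply/funext => z; rewrite /S big_nil.
    rewrite Rintegral_cst// mul0r big_nil; split => //.
    apply: (@integrableS _ _ _ mu `[0, 1]) => //; first exact: subset_itv_oo_cc.
    by apply: continuous_integrable => z; exact: cvg_cst.
  have -> : S (i :: s) = fun z => x z i 0 ^+ 2 + S s z by apply/funext => z; rewrite /S big_cons.
  split; first by apply: integrable_add => //; exact: integrable_L2_sqr.
  rewrite RintegralD//; last exact: integrable_L2_sqr.
  rewrite IH2 big_cons; congr (_ + _); apply: eq_Rintegral => z _.
  by rewrite mul0r addr0 !mul1r expr2.
by have [_] := H (index_enum 'I_n).
Qed.

Lemma wip_le (r r' : 'I_n -> R) (k k' c : R) x :
  (forall i z, 0 < z < 1 -> r i * (1 + k * z) <= c * (r' i * (1 + k' * z))) ->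
  wip r k x x <= c * wip r' k' x x.
Proof.
move=> H; rewrite mulr_sumr; apply: ler_sum => i _.
rewrite -RintegralZl//; last exact: integrable_wip.
apply: le_Rintegral => //; first exact: integrable_wip.
  by apply: integrable_scale => //; exact: integrable_wip.
move=> z; rewrite /= in_itv/= => z01; rewrite [leRHS]mulrA ler_wpM2r ?H//.
by rewrite -expr2 sqr_ge0.
Qed.

(** * Weak derivatives and boundary values *)

Lemma integrable_oo_cc (f : R -> R) : measurable_fun setT f ->
  mu.-integrable `]0, 1[ (EFin \o f) -> mu.-integrable `[0, 1] (EFin \o f).
Proof.
move=> mf /integrableP[_ fi]; apply/integrableP; split.
  by apply/measurable_EFinP; exact: measurable_funTS.
rewrite integral_itv_bndoo//; apply/measurable_EFinP; apply: measurable_funTS.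
exact: measurableT_comp.
Qed.

Lemma aeN x i : {ae mu, forall z, 0 < z < 1 -> (- x : L2 R n) z i 0 = - x z i 0}.
Proof.
have := aeZ (-1) x i; rewrite scaleN1r; apply: ae_filterS => z H /H ->.
by rewrite mulN1r.
Qed.

Lemma aeB x y i : {ae mu, forall z, 0 < z < 1 -> (x - y : L2 R n) z i 0 = x z i 0 - y z i 0}.
Proof.
apply: ae_filterS2 (aeD x (- y) i) (aeN y i) => z h1 h2 z01.
by rewrite h1// h2.
Qed.

Lemma weak_deriv_dz x : H1 x -> weak_deriv x (dz x).
Proof. by move=> [y xy]; rewrite /dz; case: xgetP => [z _ //|/(_ y)]. Qed.

Lemma weak_deriv_prim x y (xc : R -> 'cV[R]_n) : cont_repr x xc -> weak_deriv x y ->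
  forall i, prim (fun z => xc z i 0) (fun z => y z i 0).
Proof.
move=> [cx /ae_mu01 xxc] xy i; apply: weak_prim => //.
  by apply: integrable_oo_cc; [exact: L2_measurable|exact: integrable_L2].
move=> phi phiC; rewrite -(xy _ phiC i).
rewrite /Rintegral; congr fine; apply: ae_eq_integral => //.
- apply/measurable_EFinP; apply: measurable_funM.
    apply: (measurable_funS (measurable_itv `[0, 1])); first exact: subset_itv_oo_cc.
    by apply: subspace_continuous_measurable_fun => //; exact: cx.
  by apply: measurable_funTS; apply: continuous_measurable_fun; case: phiC.
- apply/measurable_EFinP; apply: measurable_funTS; apply: measurable_funM; first exact: L2_measurable.
  by apply: continuous_measurable_fun; case: phiC.
move: xxc; apply: ae_filterS => z H /=.
by rewrite in_itv/= => z01; rewrite H.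
Qed.

(** Integration by parts; the test function kills the boundary terms. *)
Lemma prim_weak_deriv x y (xc : R -> 'cV[R]_n) : {ae mu, forall z, 0 < z < 1 -> x z = xc z} ->
  (forall i, prim (fun z => xc z i 0) (fun z => y z i 0)) -> weak_deriv x y.
Proof.
move=> xxc xcy phi phiC i; have [dphi cphi [a [b [a0 b1 phi0]]]] := phiC.
have pphi := prim_C1 dphi cphi.
have pxc := xcy i; have [yi _] := pxc; have [_ HE] := prim_mul pxc pphi.
have cxc := prim_continuous pxc.
have := HE 1; rewrite lexx ler01 => /(_ isT).
rewrite !phi0 ?in_itv/= ?negb_and -?ltNge ?a0 ?b1 ?orbT// !mulr0 add0r.
have i1 : mu.-integrable `[0, 1] (EFin \o (fun s => derive1 phi s * xc s i 0)).
  by apply: integrable_mul_cont => //; exact: continuous_integrable.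
have i2 : mu.-integrable `[0, 1] (EFin \o (fun s => y s i 0 * phi s)).
  by apply: integrable_mul_cont => //; exact: prim_continuous pphi.
rewrite RintegralD// => /esym/eqP; rewrite addrC addr_eq0 => /eqP H.
rewrite (Rintegral_oo_cc i2) -H -(Rintegral_oo_cc i1).
rewrite /Rintegral; congr fine; apply: ae_eq_integral => //.
- apply/measurable_EFinP; apply: measurable_funTS; apply: measurable_funM; first exact: L2_measurable.
  exact: continuous_measurable_fun.
- apply: (measurable_funS (measurable_itv `[0, 1])); first exact: subset_itv_oo_cc.
  exact: measurable_int i1.
move: xxc; apply: ae_filterS => z Hz /=.
by rewrite in_itv/= => z01; rewrite Hz// mulrC.
Qed.

Lemma L2_eq_ae x y : (forall i, {ae mu, forall z, 0 < z < 1 -> x z i 0 = y z i 0}) -> x = y.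
Proof.
move=> H; apply/L2_eqP/ae_mu01.
have : {ae mu, forall z (k : nat), forall i : 'I_n, k = i -> 0 < z < 1 -> x z i 0 = y z i 0}.
  apply/ae_foralln => k; have [kn|nk] := ltnP k n; last first.
    by apply: aeW => z i ki; move: nk; rewrite ki leqNgt ltn_ord.
  have := H (Ordinal kn); apply: ae_filterS => z Hz i ki.
  by have <- : Ordinal kn = i by exact: val_inj.
apply: ae_filterS => z Hz z01.
by apply/matrixP => i j; rewrite (ord1 j) (Hz i).
Qed.

(** [dz] is a choice, so it is only known through the uniqueness of weak derivatives. *)
Lemma dz_unique x y (xc : R -> 'cV[R]_n) : cont_repr x xc -> weak_deriv x y -> dz x = y.
Proof.
move=> xxc xy; have xdz : weak_deriv x (dz x) by apply: weak_deriv_dz; exists y.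
apply: L2_eq_ae => i.
exact: prim_ae_eq (weak_deriv_prim xxc xdz i) (weak_deriv_prim xxc xy i).
Qed.

Lemma diag_mulmx (Lambda : 'M[R]_n) (v : 'cV[R]_n) i : is_diag_mx Lambda ->
  (Lambda *m v) i 0 = Lambda i i * v i 0.
Proof.
move=> /is_diag_mxP Ld; rewrite mxE (bigD1 i)//= big1 ?addr0// => j ji.
by rewrite Ld ?mul0r// eq_sym.
Qed.

Lemma opA_ae (Lambda : 'M[R]_n) x i : is_diag_mx Lambda ->
  {ae mu, forall z, 0 < z < 1 -> opA Lambda x z i 0 = - (Lambda i i * dz x z i 0)}.
Proof.
move=> Ld; have /ae_mu01 h1 := mulmxL2E Lambda (dz x).
apply: ae_filterS2 h1 (aeN (mulmxL2 Lambda (dz x)) i) => z h1 h2 z01.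
by rewrite /opA h2// h1// diag_mulmx.
Qed.

Lemma lebesgue_measure_cc (a b : R) : a <= b -> mu `[a, b]%classic = (b - a)%:E.
Proof.
move=> ab; rewrite lebesgue_measure_itv/= lte_fin; move: ab.
by rewrite le_eqVlt => /predU1P[->|->]; rewrite ?ltxx ?subrr// EFinB.
Qed.

Lemma Rintegral_cst_cc (a b c : R) : a <= b -> \int[mu]_(z in `[a, b]) c = c * (b - a).
Proof.
move=> ab; rewrite Rintegral_cst//.
exact: (congr1 (fun m => c * fine m) (lebesgue_measure_cc ab)).
Qed.

(** * Quasi-dissipativity of the transport operator *)

(** The outgoing boundary energy controls the incoming one because the weight
    grows by the factor [1 + k] across the interval; interior growth of the
    weight costs the constant [w]. *)
Lemma opA_dissipative (Lambda : 'M[R]_n) (G : 'cV[R]_n -> 'cV[R]_n) (k : R) (D : set (L2 R n)) :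
  is_diag_mx Lambda -> (forall i, 0 < Lambda i i) -> 0 <= k ->
  (forall a b, enorm (G a - G b) ^+ 2 <= (1 + k) * enorm (a - b) ^+ 2) ->
  (forall x, D x -> H1 x /\ exists xc, cont_repr x xc /\ xc 0 = G (xc 1)) ->
  exists2 w, 0 <= w & forall x y, D x -> D y ->
    wip (fun i => (Lambda i i)^-1) k (x - y) (opA Lambda x - opA Lambda y) <=
    w * wip (fun i => (Lambda i i)^-1) k (x - y) (x - y).
Proof.
move=> Ld L0 k0 GL DP.
set r := fun i => (Lambda i i)^-1.
pose lam := \sum_i Lambda i i.
have lam0 : 0 <= lam by apply: sumr_ge0 => i _; exact: ltW.
exists (k / 2 * lam); first by rewrite mulr_ge0// divr_ge0.
move=> x y /DP[/weak_deriv_dz wx [xc [xxc bx]]] /DP[/weak_deriv_dz wy [yc [yyc by_]]].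
pose e i z := 1 * xc z i 0 + (-1) * yc z i 0.
pose g i z := 1 * dz x z i 0 + (-1) * dz y z i 0.
have pe i : prim (e i) (g i).
  exact: (prim_lin 1 (-1) (weak_deriv_prim xxc wx i) (weak_deriv_prim yyc wy i)).
have pk : prim (fun z => 1 + k * z) (fun=> k).
  split; first by apply: continuous_integrable => z; exact: cvg_cst.
  move=> z /andP[z0 _]; by rewrite mulr0 addr0 Rintegral_cst_cc// subr0.
have mg i : measurable_fun setT (g i).
  by apply: measurable_funD; apply: measurable_funM => //; exact: L2_measurable.
have xy_ae i : {ae mu, forall z, 0 < z < 1 -> (x - y : L2 R n) z i 0 = e i z}.
  apply: ae_filterS3 (aeB x y i) ((ae_mu01 _).1 xxc.2) ((ae_mu01 _).1 yyc.2).
  by move=> z h1 h2 h3 z01; rewrite h1// h2// h3// /e mul1r mulN1r.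
have A_ae i : {ae mu, forall z, 0 < z < 1 -> (opA Lambda x - opA Lambda y : L2 R n) z i 0 = - (Lambda i i * g i z)}.
  apply: ae_filterS3 (aeB (opA Lambda x) (opA Lambda y) i) (opA_ae x i Ld) (opA_ae y i Ld).
  by move=> z h1 h2 h3 z01; rewrite h1// h2// h3// /g; ring.
have ce i := prim_continuous (pe i).
have mw i : measurable_fun setT (fun z : R => r i * (1 + k * z)) by exact: measurable_weight.
have mee i : measurable_fun (`]0, 1[%classic : set (measurableTypeR R)) (e i).
  apply: (measurable_funS (measurable_itv `[0, 1])); first exact: subset_itv_oo_cc.
  by apply: subspace_continuous_measurable_fun => //; exact: ce.
have aeq (f h : R -> R) : measurable_fun (`]0, 1[%classic : set (measurableTypeR R)) f ->
    measurable_fun (`]0, 1[%classic : set (measurableTypeR R)) h ->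
    {ae mu, forall z, 0 < z < 1 -> f z = h z} -> \int[mu]_(z in `]0, 1[) f z = \int[mu]_(z in `]0, 1[) h z.
  move=> mf mh fh; rewrite /Rintegral; congr fine; apply: ae_eq_integral => //.
  - exact/measurable_EFinP.
  - exact/measurable_EFinP.
  move: fh; apply: ae_filterS => z H /=.
  by rewrite in_itv/= => z01; rewrite H.
have ei i : mu.-integrable `[0, 1] (EFin \o (fun z => k * (e i z * e i z))).
  apply: integrable_scale => //; apply: integrable_mul_cont => //.
  by apply: continuous_compact_integrable => //; exact: segment_compact.
have gei i : mu.-integrable `[0, 1] (EFin \o (fun z => (g i z * e i z) * (1 + k * z))).
  apply: integrable_mul_cont; last by exact: prim_continuous pk.
  by apply: integrable_mul_cont => //; have [] := pe i.
pose I i := \int[mu]_(z in `[0, 1]) (k * (e i z * e i z)).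
have I0 i : 0 <= I i by apply: Rintegral_ge0 => z _; rewrite mulr_ge0// -expr2 sqr_ge0.
(* Integration by parts of the weighted energy. *)
have byparts i : \int[mu]_(z in `]0, 1[) (r i * (1 + k * z) * ((x - y : L2 R n) z i 0 * (opA Lambda x - opA Lambda y : L2 R n) z i 0)) =
    2^-1 * (I i - ((1 + k) * e i 1 ^+ 2 - e i 0 ^+ 2)).
  have [_ HE] := prim_mul (prim_mul (pe i) (pe i)) pk.
  have J : \int[mu]_(z in `[0, 1]) ((g i z * e i z + g i z * e i z) * (1 + k * z) + k * (e i z * e i z)) =
      2 * \int[mu]_(z in `[0, 1]) ((g i z * e i z) * (1 + k * z)) + 1 * I i.
    rewrite -RintegralDZ//; apply: eq_Rintegral => z _; ring.
  have := HE 1; rewrite lexx ler01 => /(_ isT); rewrite mulr0 addr0 !mulr1 J.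
  transitivity (- \int[mu]_(z in `[0, 1]) ((g i z * e i z) * (1 + k * z))).
    rewrite -Rintegral_oo_cc// -mulN1r -RintegralZl//; last first.
      by apply: integrableS (gei i) => //; exact: subset_itv_oo_cc.
    apply: aeq.
    - by apply: measurable_funTS; exact: measurable_wip.
    - apply: measurable_funM => //; apply: measurable_funM.
        by apply: measurable_funM; [apply: measurable_funTS; exact: mg|exact: mee].
      by apply: measurable_funD => //; exact: measurable_funM.
    apply: ae_filterS2 (xy_ae i) (A_ae i) => z h1 h2 z01.
    rewrite h1// h2// /r; field; by rewrite gt_eqF.
  lra.
have Ile i : I i <= k * lam * \int[mu]_(z in `]0, 1[) (r i * (1 + k * z) * ((x - y : L2 R n) z i 0 * (x - y : L2 R n) z i 0)).
  rewrite /I -Rintegral_oo_cc// -RintegralZl//; last exact: integrable_wip.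
  have -> : \int[mu]_(z in `]0, 1[) (k * (e i z * e i z)) = \int[mu]_(z in `]0, 1[) (k * ((x - y : L2 R n) z i 0 * (x - y : L2 R n) z i 0)).
    apply: aeq.
    - by apply: measurable_funM => //; exact: measurable_funM.
    - by apply: measurable_funTS; apply: measurable_funM => //; apply: measurable_funM; exact: L2_measurable.
    by have := xy_ae i; apply: ae_filterS => z h1 z01; rewrite h1.
  apply: le_Rintegral => //.
  - by apply: integrable_scale => //; exact: integrable_L2_prod.
  - by apply: integrable_scale => //; exact: integrable_wip.
  move=> z; rewrite /= in_itv/= => /andP[z0 z1].
  rewrite -mulrA ler_wpM2l// mulrA ler_peMl// -?expr2 ?sqr_ge0//.
  have h1 : 1 <= lam * r i.
    by rewrite ler_pdivlMr// mul1r /lam (bigD1 i)//= lerDl; apply: sumr_ge0 => j _; exact: ltW.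
  have h2 : 1 <= 1 + k * z by rewrite lerDl mulr_ge0// ltW.
  by rewrite mulrA -[leLHS]mulr1 ler_pM.
rewrite /wip; under eq_bigr do rewrite byparts.
rewrite -mulr_sumr sumrB.
(* The Lipschitz constant of [G] enters only here. *)
have bdry : 0 <= \sum_i ((1 + k) * e i 1 ^+ 2 - e i 0 ^+ 2).
  rewrite sumrB -mulr_sumr subr_ge0.
  have eE t : \sum_i e i t ^+ 2 = enorm (xc t - yc t) ^+ 2.
    by rewrite enorm_sqr; apply: eq_bigr => i _; rewrite !mxE /e mul1r mulN1r.
  by rewrite !eE bx by_.
rewrite (_ : k / 2 * lam = 2^-1 * (k * lam)); last by ring.
rewrite -mulrA ler_wpM2l ?invr_ge0//.
apply: (@le_trans _ _ (\sum_i I i)); first by rewrite gerBl.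
by rewrite mulr_sumr; apply: ler_sum => i _; exact: Ile.
Qed.

(** * Solutions by characteristics *)

Definition mkL2 (v : R -> 'cV[R]_n) : L2 R n := toL2 (insubd (0 : preL2 R n) v).

Lemma mkL2_ae (v : R -> 'cV[R]_n) : v \in @sqint R n ->
  {ae mu, forall z, 0 < z < 1 -> mkL2 v z = v z}.
Proof.
move=> vS; apply/ae_mu01; have := toL2_fun (insubd (0 : preL2 R n) v).
by rewrite insubdK.
Qed.

Lemma sqint_bounded (v : R -> 'cV[R]_n) (M : R) :
  (forall i, measurable_fun setT (fun z => v z i 0)) ->
  (forall i z, 0 < z < 1 -> `|v z i 0| <= M) -> v \in @sqint R n.
Proof.
move=> mv vM; apply/sqintP; split => //.
rewrite /finite_norm unlock; apply: poweR_lty.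
rewrite integral_mu01; last by apply: measurable_Lnorm2_integrand; exact: measurable_enorm.
apply: (@le_lt_trans _ _ (\int[mu]_(z in `]0%R, 1%R[) (n%:R * M ^+ 2)%:E)%E).
  apply: ge0_le_integral => //.
  - by move=> z _; exact: poweR_ge0.
  - by apply: measurable_funTS; apply: measurable_Lnorm2_integrand; exact: measurable_enorm.
  move=> z; rewrite /= in_itv/= => z01.
  rewrite ger0_norm ?enorm_ge0// powR_mulrn ?enorm_ge0// enorm_sqr lee_fin.
  apply: (@le_trans _ _ (\sum_(i < n) M ^+ 2)).
    by apply: ler_sum => i _; apply: sqr_le_sqr; exact: vM.
  by rewrite sumr_const card_ord mulr_natl.
rewrite integral_cst//.
have H : mu `]0, 1[%classic = 1%E by rewrite lebesgue_measure_itv/= lte_fin ltr01 oppr0 adde0.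
change (((n%:R * M ^+ 2)%:E * mu `]0%R, 1%R[%classic < +oo)%E).
by rewrite H mule1 ltry.
Qed.

Lemma prim_ae (v y y' : R -> R) : measurable_fun setT y' ->
  {ae mu, forall z, 0 < z < 1 -> y z = y' z} -> prim v y -> prim v y'.
Proof.
move=> my' yy' [yi yE].
have yoo : mu.-integrable `]0, 1[ (EFin \o y) by apply: integrableS yi => //; exact: subset_itv_oo_cc.
have y'oo : mu.-integrable `]0, 1[ (EFin \o y').
  apply/integrableP; split; first by apply/measurable_EFinP; exact: measurable_funTS.
  have /integrableP[my] := yoo; apply: le_lt_trans.
  rewrite le_eqVlt; apply/orP; left; apply/eqP; apply: ae_eq_integral => //.
  - by apply: measurableT_comp => //; apply/measurable_EFinP; exact: measurable_funTS.
  - exact: measurableT_comp.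
  move: yy'; apply: ae_filterS => z H /=.
  by rewrite in_itv/= => z01; rewrite H.
have y'i := integrable_oo_cc my' y'oo.
split=> // z z01; rewrite yE//; congr (_ + _); have /andP[z0 z1] := z01.
rewrite -!Rintegral_oo_cc; [|exact: integrable_prefix..].
have sub : `]0, z[ `<=` `]0, 1[ by apply: subset_itv; rewrite bnd_simp.
rewrite /Rintegral; congr fine; apply: ae_eq_integral => //.
- exact: measurable_funS sub (measurable_int mu yoo).
- by apply/measurable_EFinP; exact: measurable_funTS.
move: yy'; apply: ae_filterS => t H /= /sub.
by rewrite /= in_itv/= => t01; rewrite H.
Qed.

Lemma cc_bounded (p : R -> R) (a b : R) : cc p -> exists2 M, 0 <= M & forall z, a <= z <= b -> `|p z| <= M.
Proof.
move=> [[L L0 pL] _]; exists (`|p a| + L * `|b - a|); first by rewrite addr_ge0// mulr_ge0.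
move=> z /andP[az zb]; rewrite -[p z](subrK (p a)) (le_trans (ler_normD _ _))// addrC lerD2l.
rewrite (le_trans (pL _ _))// ler_wpM2l// !ger0_norm ?subr_ge0//; [lra|exact: le_trans zb].
Qed.

Lemma finite_bound (T : Type) (P : 'I_n -> T -> R) (D : T -> Prop) :
  (forall i, exists2 M, 0 <= M & forall t, D t -> P i t <= M) ->
  exists2 M, 0 <= M & forall i t, D t -> P i t <= M.
Proof.
move=> /(_ _)/cid2-/all_sig2[M M0 HM].
exists (\sum_i M i); first by apply: sumr_ge0 => i _; exact: M0.
move=> i t Dt; rewrite (le_trans (HM i t Dt))// (bigD1 i)//= lerDl.
by apply: sumr_ge0 => j _; exact: M0.
Qed.

Definition vec (x : 'I_n -> R -> R) (z : R) : 'cV[R]_n := \col_i x i z.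

Definition st (x : 'I_n -> R -> R) : L2 R n := mkL2 (vec x).

Lemma st_ae_gen (x : 'I_n -> R -> R) : (forall i, measurable_fun setT (x i)) ->
  (forall i, exists2 M, 0 <= M & forall z, 0 < z < 1 -> `|x i z| <= M) ->
  {ae mu, forall z, 0 < z < 1 -> st x z = vec x z}.
Proof.
move=> mx xb; apply: mkL2_ae.
have [M M0 HM] := finite_bound xb.
apply: (@sqint_bounded _ M) => [i|i z z01].
  by rewrite (_ : (fun _ => _) = x i)//; apply/funext => z; rewrite mxE.
by rewrite mxE; exact: HM.
Qed.

Lemma st_ae (x : 'I_n -> R -> R) : (forall i, cc (x i)) ->
  {ae mu, forall z, 0 < z < 1 -> st x z = vec x z}.
Proof.
move=> xc; apply: st_ae_gen => i; first exact: measurable_cc.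
have [M M0 HM] := cc_bounded 0 1 (xc i); exists M => // z /andP[z0 z1].
by apply: HM; rewrite !ltW.
Qed.

Lemma st_aei (x : 'I_n -> R -> R) i : {ae mu, forall z, 0 < z < 1 -> st x z = vec x z} ->
  {ae mu, forall z, 0 < z < 1 -> st x z i 0 = x i z}.
Proof.
apply: ae_filterS => z H z01.
by rewrite H// mxE.
Qed.

(** The factor [n.+1] instead of [n] covers dimension 0. *)
Lemma L2_norm_le (x : L2 R n) (a : 'I_n -> R -> R) (e : R) : 0 <= e ->
  (forall i, measurable_fun setT (a i)) ->
  (forall i, {ae mu, forall z, 0 < z < 1 -> x z i 0 = a i z}) ->
  (forall i, (\int[mu]_(z in `]0%R, 1%R[) (a i z ^+ 2)%:E <= (e / n.+1%:R)%:E)%E) ->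
  `|x| ^+ 2 <= e.
Proof.
move=> e0 ma xa ae_; rewrite norm_wip /wip.
apply: (@le_trans _ _ (\sum_(i < n) (e / n.+1%:R))).
  apply: ler_sum => i _; rewrite -lee_fin; apply: le_trans (ae_ i).
  rewrite (_ : \int[mu]_(z in `]0, 1[) _ = \int[mu]_(z in `]0, 1[) (x z i 0 ^+ 2)); last first.
    by apply: eq_Rintegral => z _; rewrite mul0r addr0 !mul1r expr2.
  rewrite -Rintegral_EFin//; last exact: integrable_L2_sqr.
  rewrite le_eqVlt; apply/orP; left; apply/eqP; apply: ae_eq_integral => //.
  - by apply/measurable_EFinP; apply: measurable_funTS; apply: measurable_funX; exact: L2_measurable.
  - by apply/measurable_EFinP; apply: measurable_funTS; apply: measurable_funX; exact: ma.
  have := xa i; apply: ae_filterS => z H /=.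
  by rewrite in_itv/= => z01; rewrite H.
rewrite sumr_const card_ord -[leLHS]mulr_natl mulrCA ler_piMr//.
by rewrite ler_pdivrMr// mul1r ler_nat.
Qed.

Section Evolution.
Variables (l : 'I_n -> R) (G : 'cV[R]_n -> 'cV[R]_n).
Hypothesis l0 : forall i, 0 < l i.
Hypothesis G_cc : forall p : 'I_n -> R -> R, (forall i, cc (p i)) ->
  forall i, cc (fun t => G (vec p t) i 0).

Definition bc_dom : set (L2 R n) :=
  [set x | H1 x /\ exists xc, cont_repr x xc /\ xc 0 = G (xc 1)].

(** The states at which the construction by characteristics starts and ends. *)
Definition nice (x : 'I_n -> R -> R) : Prop :=
  (forall i, cc (x i)) /\ vec x 0 = G (vec x 1).

Variables (x u f : 'I_n -> R -> R).
Hypothesis x_nice : nice x.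
Hypothesis u_cc : forall i, cc (u i).
Hypothesis u0 : forall i, u i 0 = 0.
Hypothesis u_slope : forall i z, is_slope (u i) z (f i z / l i).

(** The part of the solution transported to the right is a function of
    [t - z / l i]; for negative arguments it carries the initial datum, for
    positive ones the values fed in at [z = 0] by the boundary condition.  The
    stationary profile [u] accounts for the forcing [f]. *)
Definition datum i s := x i (- l i * s + 0) + (-1) * u i (- l i * s + 0).

Definition inflow i s :=
  G (vec (fun j s => u j 1 + (x j (- l j * s + 1) + (-1) * u j (- l j * s + 1))) s) i 0.

Definition wave i s : R := datum i (Num.min s 0) + (inflow i (Num.max s 0) + - datum i 0).

Definition sol t i z : R := u i z + wave i (- (l i)^-1 * z + t).

Let li0 i : - l i != 0. Proof. by rewrite oppr_eq0 gt_eqF. Qed.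
Let lVi0 i : - (l i)^-1 != 0. Proof. by rewrite oppr_eq0 invr_eq0 gt_eqF. Qed.

Lemma cc_wave i : cc (wave i).
Proof.
have [xc _] := x_nice.
have dc : cc (datum i).
  by apply: cc_add; [|apply: cc_scale]; exact: cc_affine.
have ic : cc (inflow i).
  apply: G_cc => j; apply: cc_add; first exact: cc_cst.
  by apply: cc_add; [|apply: cc_scale]; exact: cc_affine.
apply: cc_add; first exact: cc_min0.
by apply: cc_add; [exact: cc_max0|exact: cc_cst].
Qed.

Lemma cc_sol t i : cc (sol t i).
Proof. by apply: cc_add => //; apply: cc_affine => //; exact: cc_wave. Qed.

Lemma wave_pos i s : 0 <= s -> wave i s = inflow i s.
Proof. by move=> s0; rewrite /wave min_r// max_l// addrC subrK. Qed.

Lemma inflow0 i : inflow i 0 = x i 0.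
Proof.
have [_ xG] := x_nice; rewrite /inflow.
have -> : vec (fun j s => u j 1 + (x j (- l j * s + 1) + -1 * u j (- l j * s + 1))) 0 = vec x 1.
  by apply/matrixP => j k; rewrite !mxE mulr0 add0r mulN1r addrC subrK.
by rewrite -xG mxE.
Qed.

(** The constant subtracted in [wave] makes the two branches meet at 0, by the
    boundary condition at time 0. *)
Lemma wave_neg i s : s <= 0 -> wave i s = datum i s.
Proof.
move=> s0; rewrite /wave min_l// max_r// inflow0 {2}/datum mulr0 addr0 u0 mulr0 addr0.
by rewrite subrr addr0.
Qed.

Lemma sol0 i z : 0 <= z -> sol 0 i z = x i z.
Proof.
move=> z0; rewrite /sol wave_neg; last by rewrite addr0 mulNr oppr_le0 mulr_ge0// invr_ge0 ltW.
rewrite /datum !addr0 mulrA mulrNN mulfV ?gt_eqF// mul1r mulN1r.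
by rewrite addrC subrK.
Qed.

(** The value at [z = 0] only depends on the values at [z = 1] up to the present
    time, and for [t * l i <= 1] the latter still come from the initial datum;
    this is why a time step is limited. *)
Lemma sol_bc t : 0 <= t -> (forall i, t * l i <= 1) -> vec (sol t) 0 = G (vec (sol t) 1).
Proof.
move=> t0 tl; apply/matrixP => i j; rewrite (ord1 j) mxE /sol u0 add0r mulr0 add0r wave_pos//.
rewrite /inflow; congr (G _ i 0); apply/matrixP => k ?; rewrite !mxE /sol; congr (_ + _).
rewrite wave_neg; last first.
  by rewrite mulr1 addrC subr_le0 -div1r ler_pdivlMr.
rewrite /datum addr0 (_ : - l k * (- (l k)^-1 * 1 + t) = - l k * t + 1)//.
by field; rewrite gt_eqF.
Qed.

Lemma sol_nice t : 0 <= t -> (forall i, t * l i <= 1) -> nice (sol t).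
Proof. by move=> t0 tl; split; [exact: cc_sol|exact: sol_bc]. Qed.

Let W t := st (fun i z => slope (wave i) (- (l i)^-1 * z + t)).

Let mW t i : measurable_fun setT (fun z : R => slope (wave i) (- (l i)^-1 * z + t)).
Proof.
apply: (@measurableT_comp _ _ _ _ _ _ (slope (wave i)) _ (fun z : R => - (l i)^-1 * z + t)).
  by apply: measurable_slope; exact: cc_wave.
by apply: measurable_funD => //; exact: measurable_funM.
Qed.

Let W_ae t i : {ae mu, forall z, 0 < z < 1 -> W t z i 0 = slope (wave i) (- (l i)^-1 * z + t)}.
Proof.
apply: (@st_aei (fun i z => slope (wave i) (- (l i)^-1 * z + t))); apply: st_ae_gen => j; first exact: mW.
have [[L L0 pL] _] := cc_wave j; exists L => // z _; exact: slope_le.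
Qed.

Let dsol t i z := f i z / l i + - (l i)^-1 * slope (wave i) (- (l i)^-1 * z + t).

Let fE i z : f i z = l i * slope (u i) z.
Proof. by rewrite (slopeE (u_slope i z)) mulrCA mulfV ?gt_eqF ?mulr1. Qed.

Let mf i : measurable_fun setT (f i).
Proof.
by rewrite (_ : f i = fun z => l i * slope (u i) z); [apply: measurable_funM => //; exact: measurable_slope|exact/funext].
Qed.

Let mdsol t i : measurable_fun setT (dsol t i).
Proof. by apply: measurable_funD; apply: measurable_funM => //; exact: mW. Qed.

Lemma sol_prim t i : prim (sol t i) (dsol t i).
Proof.
apply: prim_ae (cc_prim (cc_sol t i)) => //.
have pN : countable (no_slope (fun z => wave i (- (l i)^-1 * z + t))).
  by have [] := cc_affine t (lVi0 i) (cc_wave i).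
have pN' : countable ((fun z => - (l i)^-1 * z + t) @^-1` no_slope (wave i)).
  have [_ /countable_injP[g gi]] := cc_wave i.
  apply/countable_injP; exists (g \o (fun z => - (l i)^-1 * z + t)) => a b; rewrite !inE => ga gb /= gab.
  by have /addIr/(mulfI (lVi0 i)) : - (l i)^-1 * a + t = - (l i)^-1 * b + t by apply: gi => //; rewrite inE.
exists ((fun z => - (l i)^-1 * z + t) @^-1` no_slope (wave i)); split.
- exact: countable_measurable.
- exact: countable_lebesgue_measure0.
- move=> z /= /not_implyP[_]; move=> H; apply: contrapT => Nz; apply: H; apply/slopeE.
  by apply: is_slope_add; [exact: u_slope|apply: is_slope_affine; exact: slopeP].
Qed.

(** The last clause is differentiability in L^2, uniform for bounded times; it
    serves both the chain rule for V and the comparison with implicit Euler steps. *)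
Lemma evolution (Lambda : 'M[R]_n) (F : L2 R n) : is_diag_mx Lambda -> (forall i, Lambda i i = l i) ->
  (forall i, {ae mu, forall z, 0 < z < 1 -> F z i 0 = f i z}) ->
  exists Y Y' : R -> L2 R n, [/\ Y 0 = st x,
    forall t, 0 <= t -> (forall i, t * l i <= 1) -> exists2 x', nice x' & Y t = st x',
    forall t, 0 <= t -> (forall i, t * l i <= 1) -> bc_dom (Y t) /\ opA Lambda (Y t) + F = Y' t &
    forall T e, 0 < e -> exists2 d, 0 < d & forall t h, `|t| <= T -> `|h| < d ->
      `|Y (t + h) - Y t - h *: Y' t| <= e * `|h|].
Proof.
move=> Ld LE F_ae; exists (fun t => st (sol t)), W.
have sol_ae t := st_ae (cc_sol t).
split.
- apply: L2_eq_ae => i.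
  apply: ae_filterS2 (st_aei i (sol_ae 0)) (st_aei i (st_ae x_nice.1)) => z h1 h2 z01.
  by rewrite h1// h2// sol0// ltW//; case/andP: z01.
- by move=> t t0 tl; exists (sol t) => //; exact: sol_nice.
- move=> t t0 tl.
  have Z_ae i : {ae mu, forall z, 0 < z < 1 -> st (dsol t) z i 0 = dsol t i z}.
    apply: st_aei; apply: st_ae_gen => j; first exact: mdsol.
    have [[L L0 pL] _] := cc_wave j; have [[L' L'0 pL'] _] := u_cc j.
    exists (L' + `|- (l j)^-1| * L); first by rewrite addr_ge0// mulr_ge0.
    move=> z _; rewrite /dsol -(slopeE (u_slope j z)) (le_trans (ler_normD _ _))// lerD//.
      exact: slope_le.
    by rewrite normrM ler_wpM2l// slope_le.
  have cr : cont_repr (st (sol t)) (vec (sol t)).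
    split; last by apply/ae_mu01; exact: sol_ae.
    move=> i; rewrite (_ : (fun z => _) = sol t i); last by apply/funext => z; rewrite mxE.
    by apply: continuous_subspaceT; apply: cc_continuous; exact: cc_sol.
  have wd : weak_deriv (st (sol t)) (st (dsol t)).
    apply: prim_weak_deriv (sol_ae t) _ => i.
    apply: prim_ae (L2_measurable _ i) _ _; last first.
      rewrite (_ : (fun z => _) = sol t i); last by apply/funext => z; rewrite mxE.
      exact: sol_prim.
    have := Z_ae i; apply: ae_filterS => z h z01.
    by rewrite h.
  split.
    split; first by exists (st (dsol t)).
    by exists (vec (sol t)); split=> //; exact: sol_bc.
  have dzE := dz_unique cr wd.
  apply: L2_eq_ae => i.
  have h12 : {ae mu, forall z, 0 < z < 1 -> opA Lambda (st (sol t)) z i 0 + F z i 0 = W t z i 0}.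
    have h13 : {ae mu, forall z, 0 < z < 1 -> opA Lambda (st (sol t)) z i 0 = - (l i * dsol t i z)}.
      apply: ae_filterS2 (Z_ae i) (opA_ae (st (sol t)) i Ld) => z h1 h2 z01.
      by rewrite h2// dzE h1// LE.
    apply: ae_filterS3 h13 (F_ae i) (W_ae t i) => z h1 h2 h3 z01.
    rewrite h1// h2// h3// /dsol; move: (slope _ _) => s; field.
    by rewrite gt_eqF.
  apply: ae_filterS2 h12 (aeD (opA Lambda (st (sol t))) F i) => z h1 h2 z01.
  by rewrite h2// h1.
- move=> T e e0.
  have [d d0 Hd] : exists2 d, 0 < d & forall i t h, `|t| <= T -> `|h| < d ->
    (\int[mu]_(z in `]0%R, 1%R[) ((wave i (t - z / l i + h) - wave i (t - z / l i) - h * slope (wave i) (t - z / l i)) ^+ 2)%:E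
      <= (e ^+ 2 / n.+1%:R * h ^+ 2)%:E)%E.
    have en : 0 < e ^+ 2 / n.+1%:R by rewrite divr_gt0// exprn_gt0.
    have /(_ _)/cid2-/all_sig2[d d0 Hd] := fun i => cc_unif_L2 T (l0 i) en (cc_wave i).
    have [|M M0 HM] := @finite_bound unit (fun i _ => (d i)^-1) (fun=> True).
      by move=> i; exists (d i)^-1 => //; rewrite invr_ge0 ltW.
    have M1 : 0 < M + 1 by lra.
    exists (M + 1)^-1; first by rewrite invr_gt0.
    move=> i t h tT hM; apply: Hd => //; apply: (lt_trans hM).
    rewrite invf_plt ?posrE//; have := HM i tt Logic.I; lra.
  exists d => // t h tT hd.
  rewrite -(@ler_pXn2r _ 2)// ?nnegrE ?mulr_ge0 ?(ltW e0)//.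
  rewrite exprMn real_normK ?num_real//.
  pose a i z := sol (t + h) i z - sol t i z - h * slope (wave i) (- (l i)^-1 * z + t).
  apply: (@L2_norm_le _ a).
  + by rewrite mulr_ge0// sqr_ge0.
  + move=> i; apply: measurable_funB; last by apply: measurable_funM => //; exact: mW.
    by apply: measurable_funB; apply: measurable_cc; exact: cc_sol.
  + move=> i.
    have h1 : {ae mu, forall z, 0 < z < 1 -> (st (sol (t + h)) - st (sol t) : L2 R n) z i 0 = sol (t + h) i z - sol t i z}.
      apply: ae_filterS3 (aeB (st (sol (t + h))) (st (sol t)) i) (st_aei i (sol_ae (t + h))) (st_aei i (sol_ae t)).
      by move=> z a1 a2 a3 z01; rewrite a1// a2// a3.
    have h2 : {ae mu, forall z, 0 < z < 1 -> (h *: W t : L2 R n) z i 0 = h * slope (wave i) (- (l i)^-1 * z + t)}.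
      apply: ae_filterS2 (aeZ h (W t) i) (W_ae t i).
      by move=> z a1 a2 z01; rewrite a1// a2.
    apply: ae_filterS3 (aeB (st (sol (t + h)) - st (sol t)) (h *: W t) i) h1 h2.
    by move=> z a1 a2 a3 z01; rewrite a1// a2// a3.
  + move=> i; rewrite mulrAC; apply: le_trans (Hd i t h tT hd).
    rewrite le_eqVlt; apply/orP; left; apply/eqP; apply: eq_integral => z _.
    congr ((_ ^+ 2)%:E); rewrite /a /sol.
    rewrite (_ : - (l i)^-1 * z + (t + h) = t - z / l i + h); last by ring.
    rewrite (_ : - (l i)^-1 * z + t = t - z / l i); last by ring.
    by ring.
Qed.

End Evolution.
(** * Density and equivalence of norms *)

Lemma L2_dense (x : L2 R n) (e : R) : 0 < e ->
  exists2 v : 'I_n -> R -> R, (forall i, C1c01 (v i)) & `|x - st v| <= e.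
Proof.
move=> e0; have en : 0 < e ^+ 2 / n.+1%:R by rewrite divr_gt0// exprn_gt0.
have H i : exists2 v, C1c01 v & L2close (fun z => x z i 0) v (e ^+ 2 / n.+1%:R).
  have [_] : appr (fun z => x z i 0).
    apply: appr_L2; first exact: L2_measurable.
    have /integrableP[_] := integrable_L2_sqr x i; apply: le_lt_trans.
    by rewrite le_eqVlt; apply/orP; left; apply/eqP; apply: eq_integral => z _ /=; rewrite ger0_norm ?sqr_ge0.
  exact.
have /(_ _)/cid2-/all_sig2[v vC vx] := H.
exists v => //.
rewrite -(@ler_pXn2r _ 2)// ?nnegrE ?(ltW e0)//.
apply: (@L2_norm_le _ (fun i z => x z i 0 - v i z)).
- exact: sqr_ge0.
- by move=> i; apply: measurable_funB; [exact: L2_measurable|exact: C1c01_measurable].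
- move=> i; apply: ae_filterS2 (aeB x (st v) i) (st_aei i (st_ae (fun i => C1c01_cc (vC i)))).
  by move=> z h1 h2 z01; rewrite h1// h2.
- exact: vx.
Qed.

Section WnormEquiv.
Variables (r : 'I_n -> R) (k : R).
Hypotheses (r0 : forall i, 0 < r i) (k0 : 0 <= k).

(** The weight lies between positive constants; see also [le_wnorm]. *)
Lemma wnorm_le : exists2 c, 0 < c & forall x, wnorm r k x <= c * `|x|.
Proof.
pose c := (\sum_i r i) * (1 + k) + 1.
have s0 : 0 <= \sum_i r i by apply: sumr_ge0 => i _; exact: ltW.
have c0 : 0 < c by rewrite ltr_wpDl// mulr_ge0// addr_ge0.
exists (Num.sqrt c); first by rewrite sqrtr_gt0.
move=> x; rewrite -(@ler_pXn2r _ 2)// ?nnegrE ?wnorm_ge0 ?mulr_ge0//.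
have -> : (Num.sqrt c * `|x|) ^+ 2 = c * wip (fun=> 1) 0 x x.
  by rewrite exprMn sqr_sqrtr ?ltW// norm_wip.
rewrite wnorm_sqr//; apply: (@wip_le r (fun=> 1) k 0 c x) => i z /andP[z0 z1].
rewrite mul0r addr0 !mulr1 /c (le_trans _ (_ : (\sum_i r i) * (1 + k) <= _)) ?lerDl//.
apply: ler_pM; [exact: ltW|by rewrite addr_ge0// mulr_ge0// ltW| |].
  by rewrite (bigD1 i)//= lerDl; apply: sumr_ge0 => j _; exact: ltW.
by rewrite lerD2l ler_piMr// ltW.
Qed.

Lemma le_wnorm : exists2 c, 0 < c & forall x, `|x| <= c * wnorm r k x.
Proof.
pose c := \sum_i (r i)^-1 + 1.
have s0 : 0 <= \sum_i (r i)^-1 by apply: sumr_ge0 => i _; rewrite invr_ge0 ltW.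
have c0 : 0 < c by rewrite ltr_wpDl.
exists (Num.sqrt c); first by rewrite sqrtr_gt0.
move=> x; rewrite -(@ler_pXn2r _ 2)// ?nnegrE ?wnorm_ge0 ?mulr_ge0 ?wnorm_ge0//.
have -> : (Num.sqrt c * wnorm r k x) ^+ 2 = c * wip r k x x.
  by rewrite exprMn sqr_sqrtr ?ltW// wnorm_sqr.
rewrite norm_wip; apply: (@wip_le (fun=> 1) r 0 k c x) => i z /andP[z0 z1].
rewrite mul0r addr0 mulr1 mulrA.
have h1 : 1 <= c * r i.
  rewrite -ler_pdivrMr// div1r /c (bigD1 i)//= -addrA lerDl addr_ge0//.
  by apply: sumr_ge0 => j _; rewrite invr_ge0 ltW.
have h2 : 1 <= 1 + k * z by rewrite lerDl mulr_ge0// ltW.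
by rewrite -[leLHS]mulr1 ler_pM.
Qed.

End WnormEquiv.

End L2space.

Section MulmxL2.
Context {R : realType} {n q : nat}.
Local Notation mu := (@lebesgue_measure R).

Lemma mulmxL2B (M : 'M[R]_(n, q)) (x y : L2 R q) : mulmxL2 M x - mulmxL2 M y = mulmxL2 M (x - y).
Proof.
apply: L2_eq_ae => i.
have /ae_mu01 h1 := mulmxL2E M x; have /ae_mu01 h2 := mulmxL2E M y.
have /ae_mu01 h3 := mulmxL2E M (x - y).
have h4 : {ae mu, forall z, 0 < z < 1 -> (x - y : L2 R q) z = x z - y z}.
  have /ae_mu01 a1 := L2D x (- y).
  have a2 : {ae mu, forall z, 0 < z < 1 -> (- y : L2 R q) z = - y z}.
    have /ae_mu01 := L2Z (-1) y; rewrite scaleN1r.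
    by apply: ae_filterS => z H /H ->; rewrite scaleN1r.
  by apply: ae_filterS2 a1 a2 => z b1 b2 z01; rewrite b1// b2.
have h34 : {ae mu, forall z, 0 < z < 1 -> mulmxL2 M (x - y) z = M *m (x z - y z)}.
  by apply: ae_filterS2 h3 h4 => z b1 b2 z01; rewrite b1// b2.
have h12 : {ae mu, forall z, 0 < z < 1 -> (mulmxL2 M x - mulmxL2 M y : L2 R n) z i 0 = (M *m x z - M *m y z) i 0}.
  apply: ae_filterS3 (aeB (mulmxL2 M x) (mulmxL2 M y) i) h1 h2.
  by move=> z b1 b2 b3 z01; rewrite b1// b2// b3// !mxE.
apply: ae_filterS2 h12 h34 => z b1 b2 z01.
by rewrite b1// b2// mulmxBr.
Qed.

Lemma mulmxL2_le (M : 'M[R]_(n, q)) : exists2 C, 0 < C & forall x : L2 R q, `|mulmxL2 M x| <= C * `|x|.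
Proof.
have [C HC] := enorm_mulmx_le M.
have C0 : 0 < `|C| + 1 by rewrite ltr_wpDl.
exists (`|C| + 1) => // x.
rewrite -(@ler_pXn2r _ 2)// ?nnegrE ?mulr_ge0 ?(ltW C0)//.
have ms : measurable_fun (`]0, 1[%classic : set (measurableTypeR R)) (fun z : measurableTypeR R => (\sum_i x z i 0 ^+ 2)%:E).
  apply/measurable_EFinP; apply: measurable_funTS; apply: measurable_sum => i.
  by apply: measurable_funX; exact: L2_measurable.
have E1 : (((`|C| + 1) * `|x|) ^+ 2)%:E =
    (\int[mu]_(z in `]0%R, 1%R[) (((`|C| + 1) ^+ 2)%:E * (\sum_i x z i 0 ^+ 2)%:E))%E.
  rewrite ge0_integralZl ?lee_fin ?sqr_ge0//; last first.
    by move=> z _; rewrite lee_fin sumr_ge0// => i _; exact: sqr_ge0.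
  by rewrite exprMn EFinM L2_sqr_normE.
rewrite -lee_fin -L2_sqr_normE E1.
rewrite (_ : (\int[mu]_(z in `]0%R, 1%R[) (\sum_i mulmxL2 M x z i 0 ^+ 2)%:E)%E = (\int[mu]_(z in `]0%R, 1%R[) (enorm (M *m x z) ^+ 2)%:E)%E); last first.
  apply: ae_eq_integral => //.
  - apply/measurable_EFinP; apply: measurable_funTS; apply: measurable_sum => i.
    by apply: measurable_funX; exact: L2_measurable.
  - apply/measurable_EFinP; apply: measurable_funTS; apply: measurable_funX.
    apply: (@measurable_enorm R n (fun z => M *m x z)) => i.
    have /sqintP[] := mulmx_sqint M (L2_funP x); exact.
  have /ae_mu01 := mulmxL2E M x.
  apply: ae_filterS => z H /=.
  by rewrite in_itv/= => z01; rewrite H// enorm_sqr.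
apply: ge0_le_integral => //.
- by move=> z _; rewrite lee_fin sqr_ge0.
- apply/measurable_EFinP; apply: measurable_funTS; apply: measurable_funX.
  apply: (@measurable_enorm R n (fun z => M *m x z)) => i.
  have /sqintP[] := mulmx_sqint M (L2_funP x); exact.
- exact: emeasurable_funM.
- move=> z _; rewrite -EFinM lee_fin -enorm_sqr -exprMn lerXn2r ?nnegrE ?mulr_ge0 ?enorm_ge0 ?(ltW C0)//.
  rewrite (le_trans (HC _))// ler_wpM2r ?enorm_ge0// (le_trans (ler_norm _))// lerDl//.
Qed.

End MulmxL2.

(** * Comparison of a mild solution with a differentiable one *)

Section Comparison.
Context {R : realType} {n : nat}.
Local Notation mu := (@lebesgue_measure R).
Local Notation V := (L2 R n).
Variables (A : V -> V) (DA : set V) (r : 'I_n -> R) (k w : R).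
Hypotheses (r0 : forall i, 0 < r i) (k0 : 0 <= k) (w0 : 0 <= w).
Hypothesis dissip : forall x y, DA x -> DA y ->
  wip r k (x - y) (A x - A y) <= w * wip r k (x - y) (x - y).
Local Notation N := (wnorm r k).

(** Take the weighted inner product of the error equation with the error and apply
    the Cauchy-Schwarz inequality. *)
Lemma implicit_step (x y x0 y0 g : V) (h : R) : DA x -> DA y -> 0 < h ->
  x - y = (x0 - y0) + h *: (A x - A y) + g ->
  (1 - w * h) * N (x - y) <= N (x0 - y0) + N g.
Proof.
move=> Dx Dy h0 E; set e := x - y.
have Ne := wnorm_ge0 r k e.
have := dissip Dx Dy; rewrite -/e => H1.
have H2 : wip r k e e = wip r k e (x0 - y0) + h * wip r k e (A x - A y) + wip r k e g.
  by rewrite -wipZr -!wipDr -E.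
have H3 := wip_CS r0 k0 e (x0 - y0); have H4 := wip_CS r0 k0 e g.
have H5 : (1 - w * h) * N e ^+ 2 <= N e * (N (x0 - y0) + N g).
  rewrite wnorm_sqr//; have := ler_wpM2l (ltW h0) H1.
  by rewrite mulrDr mulrBl mul1r; lra.
have [Ne0|Ne0] := eqVneq (N e) 0; first by rewrite Ne0 mulr0 addr_ge0// wnorm_ge0.
have Np : 0 < N e by rewrite lt_def Ne0.
by move: H5; rewrite expr2 mulrCA ler_pM2l.
Qed.

Lemma expR_step (x : R) : 0 <= x <= 2^-1 -> 1 <= (1 - x) * expR (2 * x).
Proof.
move=> /andP[x0 x1].
have H : 1 + 2 * x <= expR (2 * x) by exact: expR_ge1Dx.
apply: (@le_trans _ _ ((1 - x) * (1 + 2 * x))); first by nra.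
by apply: ler_wpM2l => //; lra.
Qed.

Lemma gronwall_step (t h e0 e1 al s rho : R) : 0 <= h -> w * h <= 2^-1 -> 0 <= s ->
  0 <= al + s -> 0 <= t -> 0 <= rho ->
  (1 - w * h) * e1 <= e0 + rho -> e0 <= expR (2 * w * t) * (al + s) ->
  e1 <= expR (2 * w * (t + h)) * (al + (s + rho)).
Proof.
move=> h0 wh s0 als t0 rho0 H1 H2.
have wh0 : 0 <= w * h by exact: mulr_ge0.
have := @expR_step (w * h); rewrite wh0 wh => /(_ isT) H3.
have E1 : 1 <= expR (2 * w * t) by rewrite -expR0 ler_expR !mulr_ge0.
have -> : expR (2 * w * (t + h)) = expR (2 * w * t) * expR (2 * (w * h)).
  by rewrite -expRD; congr expR; ring.
have p0 : 0 < 1 - w * h by lra.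
rewrite -(ler_pM2l p0) (le_trans H1)//.
set a := expR (2 * w * t) in H2 E1 *; set b := expR _ in H3 *.
rewrite (_ : (1 - w * h) * (a * b * (al + (s + rho))) = ((1 - w * h) * b) * (a * (al + (s + rho)))); last by ring.
have : a * (al + s) + rho <= a * (al + (s + rho)) by rewrite (addrA al) [leRHS]mulrDr lerD2l ler_peMl.
move=> H4; apply: le_trans (_ : a * (al + (s + rho)) <= _).
  by rewrite (le_trans _ H4)// lerD2r.
rewrite ler_peMl// mulr_ge0//; [exact: le_trans ler01 E1|by rewrite addrA addr_ge0].
Qed.

(** Neither function need be measurable: the integral of a nonnegative function is
    a supremum over the simple functions below it.  This matters for norms of
    strongly measurable functions, which are measurable only up to a null set. *)
Lemma ge0_le_integral_nonmeasurable (D : set (measurableTypeR R)) (f g : R -> \bar R) :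
  (forall s, D s -> (0 <= f s)%E) -> (forall s, D s -> (f s <= g s)%E) ->
  (\int[mu]_(s in D) f s <= \int[mu]_(s in D) g s)%E.
Proof.
move=> f0 fg; have g0 s : D s -> (0 <= g s)%E by move=> Ds; exact: le_trans (f0 s Ds) (fg s Ds).
rewrite !ge0_integralE//; apply: le_ereal_sup => _ /= [h hf <-].
exists h => // s; apply: (le_trans (hf s)).
rewrite !patchE; case: ifPn => // sD; apply: fg.
by rewrite inE in sD.
Qed.

Lemma Rintegral_cc_split (th : R -> R) (a b c : R) : a <= b -> b <= c ->
  mu.-integrable `[a, c] (EFin \o th) ->
  \int[mu]_(s in `[a, c]) th s = \int[mu]_(s in `[a, b]) th s + \int[mu]_(s in `[b, c]) th s.
Proof.
move=> ab bc thi.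
have := @Rintegral_itvB _ th (BLeft a) (BRight c) b thi; rewrite !bnd_simp => /(_ ab bc).
rewrite Rintegral_itv_obnd_cbnd; last by apply: integrableS thi => //; apply: subset_itv; rewrite bnd_simp.
by move=> <-; rewrite addrC subrK.
Qed.

Lemma within_cont_eps (X : R -> V) (T s0 eta : R) : {within `[0, T], continuous X} ->
  0 <= s0 <= T -> 0 < eta ->
  exists2 d : R, 0 < d & forall s, 0 <= s <= T -> `|s - s0| < d -> `|X s - X s0| <= eta.
Proof.
move=> cX s0T eta0.
have /= := cX s0 => /cvgr_dist_le/(_ _ eta0).
rewrite /nbhs/= -nbhs_subspace_in; last by rewrite /= in_itv.
rewrite /within/= => -[d /= d0 H]; exists d => // s sT sd.
by rewrite distrC; apply: H; rewrite /= ?in_itv// distrC.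
Qed.

Lemma deriv_cont_eps (Y Y' : R -> V) (t0 d0 eta : R) : 0 < d0 -> 0 < eta ->
  (forall h, `|h| < d0 -> `|Y (t0 + h) - Y t0 - h *: Y' t0| <= `|h|) ->
  exists2 d : R, 0 < d & forall h, `|h| < d -> `|Y (t0 + h) - Y t0| <= eta.
Proof.
move=> d00 eta0 H; pose m := 1 + `|Y' t0|; have m0 : 0 < m by rewrite ltr_pwDl.
exists (Num.min d0 (eta / m)); first by rewrite lt_min d00 divr_gt0.
move=> h; rewrite lt_min => /andP[/H h1 h2].
rewrite -(subrK (h *: Y' t0) (_ - _)) (le_trans (ler_normD _ _))// normrZ.
rewrite ltr_pdivlMr// in h2; apply: (le_trans _ (ltW h2)).
by rewrite /m mulrDr mulr1 lerD2r.
Qed.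

Lemma last_index (t : nat -> R) (M : nat) (b eps : R) : t 0%N <= b -> 0 < eps ->
  b - eps < t M -> (forall i, (i < M)%N -> t i < t i.+1 < t i + eps) ->
  exists2 j, (j <= M)%N & b - eps < t j <= b.
Proof.
move=> t0b eps0 tM tS.
suff H i : (i <= M)%N -> (exists2 j, (j <= M)%N & b - eps < t j <= b) \/ t i <= b.
  by have [//|tMb] := H M (leqnn M); exists M => //; rewrite tM.
elim: i => [|i IH] iM; first by right.
have [H|tib] := IH (ltnW iM); first by left.
have [|tb] := leP (t i.+1) b; first by right.
left; exists i; first exact: ltnW.
by have /andP[_ h] := tS i iM; rewrite tib andbT; lra.
Qed.

Section Piece.
Variables (f : R -> V) (X0 : V) (X Y Y' : R -> V) (T a b c : R) (F : V) (th : R -> R).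
Hypotheses (Xmild : mild_on A DA f X0 X T) (X_cont : {within `[0, T], continuous X}).
Hypotheses (a0 : 0 <= a) (ab : a < b) (bT : b <= T).
Hypothesis YA : forall s, 0 <= s <= b - a -> DA (Y s) /\ A (Y s) + F = Y' s.
Hypothesis Y_deriv : forall e, 0 < e -> exists2 d : R, 0 < d &
  forall t h, `|t| <= b - a -> `|h| < d -> `|Y (t + h) - Y t - h *: Y' t| <= e * `|h|.
Hypotheses (c0 : 0 < c) (Nc : forall x, N x <= c * `|x|).
Hypothesis mf : forall v, exists g : R -> R, [/\ measurable_fun setT g,
  forall s, 0 <= g s <= `|f s - v| & {ae mu, forall s, 0 <= s <= T -> `|f s - v| <= g s}].
Hypotheses (th_int : mu.-integrable `[a, b] (EFin \o th))
  (th_ge0 : forall s, 0 <= th s)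
  (f_th : {ae mu, forall s, a <= s <= b -> `|f s - F| <= th s}).

(** Both [v] and [F] are compared with [f] on the interval. *)
Lemma forcing_dist (s t : R) (v : V) : a <= s -> s <= t -> t <= b ->
  (\int[mu]_(x in `[s, t]) `|f x - v|%:E < +oo)%E ->
  (t - s) * `|v - F| <= fine (\int[mu]_(x in `[s, t]) `|f x - v|%:E)%E +
    \int[mu]_(x in `[s, t]) th x.
Proof.
move=> as_ st tb fin; have [g [mg g_le g_ge]] := mf v.
have sub : `[s, t] `<=` `[a, b] by apply: subset_itv; rewrite bnd_simp.
have thi : mu.-integrable `[s, t] (EFin \o th) by exact: integrableS th_int.
have I0 : (0 <= \int[mu]_(x in `[s, t]) `|f x - v|%:E)%E by apply: integral_ge0 => x _; rewrite lee_fin.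
have finE : (\int[mu]_(x in `[s, t]) `|f x - v|%:E)%E \is a fin_num by rewrite ge0_fin_numE.
rewrite -lee_fin EFinD fineK// -Rintegral_EFin//.
have -> : ((t - s) * `|v - F|)%:E = (\int[mu]_(x in `[s, t]) (`|v - F|)%:E)%E.
  rewrite integral_cst// mulrC EFinM; congr (_ * _)%E.
  by apply/esym; exact: lebesgue_measure_cc.
have mgE : measurable_fun `[s, t] (EFin \o g) by apply: measurable_funTS; apply/measurable_EFinP.
apply: (@le_trans _ _ (\int[mu]_(x in `[s, t]) ((EFin \o g) x + (EFin \o th) x))%E); last first.
  rewrite ge0_integralD//=; last 3 first.
  - by move=> x _; rewrite lee_fin; case/andP: (g_le x).
  - by move=> x _; rewrite lee_fin.
  - exact: measurable_int thi.
  apply: leeD => //; apply: ge0_le_integral_nonmeasurable => x _; rewrite lee_fin; by case/andP: (g_le x).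
apply: ae_ge0_le_integral => //.
- by move=> x _ /=; rewrite adde_ge0// lee_fin//; case/andP: (g_le x).
- by apply: emeasurable_funD => //; exact: measurable_int thi.
apply: ae_filterS2 g_ge f_th => x h1 h2 /=.
rewrite in_itv/= => /andP[sx xt]; rewrite lee_fin.
have xa : a <= x by lra. have xb : x <= b by lra.
have : 0 <= x <= T by rewrite (le_trans a0 xa)/= (le_trans xb bT).
move/h1 => h1'; have := h2; rewrite xa xb => /(_ isT) h2'.
by rewrite (le_trans (ler_distD (f x) v F))// lerD// distrC.
Qed.

(** With [p], [q] the values of [h *: A] on the two curves, [g] and [z] the two
    forcing terms, this splits one implicit Euler step into the part governed by
    dissipativity and a residue. *)
Lemma step_decomp (x0 y0 y p q g z : V) :
  (x0 - y0) + (p - q) + ((g - z) + (y0 - y + (q + z))) = x0 + (p + g) - y.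
Proof.
rewrite (addrA _ q) (addrACA g) addNr addr0 (addrACA (x0 - y0)) (addrACA p) addNr addr0.
by rewrite (addrC p) (addrACA (x0 - y0)) subrKA (addrC g) addrAC.
Qed.

Lemma wnorm_distD (y x z : V) : N (x - z) <= N (x - y) + N (y - z).
Proof. by rewrite (le_trans _ (wnormD r0 k0 _ _))// addrA subrK. Qed.

(** One epsilon-approximate solution with a fine mesh, compared with the
    differentiable curve at the grid points of [a, b] by induction.  The slack
    [eta] absorbs the mesh size, the tolerance, and the remainder of the expansion
    of [Y]. *)
Lemma compare_eta (eta : R) : 0 < eta ->
  N (X b - Y (b - a)) <= expR (2 * w * (b - a)) * (N (X a - Y 0) + 3 * c * eta
     + c * (eta + \int[mu]_(x in `[a, b]) th x + eta * (b - a))) + 3 * c * eta.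
Proof.
move=> eta0; have ba0 : 0 < b - a by rewrite subr_gt0.
have aT : 0 <= a <= T by rewrite a0 (le_trans (ltW ab)).
have bT' : 0 <= b <= T by rewrite bT (le_trans a0 (ltW ab)).
have [dA dA0 HA] : exists2 d : R, 0 < d & forall s, 0 <= s <= T -> `|s - a| < d -> `|X s - X a| <= eta.
  exact: within_cont_eps.
have [dB dB0 HB] : exists2 d : R, 0 < d & forall s, 0 <= s <= T -> `|s - b| < d -> `|X s - X b| <= eta.
  exact: within_cont_eps.
have [d1 d10 H1] := Y_deriv ltr01.
have [dY dY0 HY] : exists2 d : R, 0 < d & forall h, `|h| < d -> `|Y (0 + h) - Y 0| <= eta.
  apply: (@deriv_cont_eps Y Y' 0 d1) => // h hd.
  by have := H1 0 h; rewrite normr0 (ltW ba0) mul1r; exact.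
have [dZ dZ0 HZ] : exists2 d : R, 0 < d & forall h, `|h| < d -> `|Y (b - a + h) - Y (b - a)| <= eta.
  apply: (@deriv_cont_eps Y Y' (b - a) d1) => // h hd.
  by have := H1 (b - a) h; rewrite gtr0_norm// lexx mul1r; exact.
have [dR dR0 HR] := Y_deriv eta0.
have w1 : 0 < 2 * (w + 1) by have := w0; lra.
have [eps /and5P[eps0 e1 e2 e3 /and5P[e4 e5 e6 e7 e8]]] : exists eps,
    [&& 0 < eps, eps <= eta, eps <= b - a, eps <= (2 * (w + 1))^-1 &
    [&& eps <= dA, eps <= dB, eps <= dY, eps <= dZ & eps <= dR]].
  exists (Num.min (Num.min (Num.min eta (b - a)) (2 * (w + 1))^-1) (Num.min (Num.min dA dB) (Num.min (Num.min dY dZ) dR))).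
  by rewrite !lt_min !ge_min !lexx !orbT eta0 ba0 dA0 dB0 dY0 dZ0 dR0 invr_gt0 w1.
have [tM [W [[M [t [fs [ws [[M0 t0 tME tS /andP[tM1 tM2]] int_lt stepE [W0 WE] ws0]]]]] XW]]] := Xmild eps0.
have t_mono i : (i <= M)%N -> 0 <= t i.
  elim: i => [|i IH] iM; first by rewrite t0.
  by case/andP: (tS i iM) => h _; exact: le_trans (IH (ltnW iM)) (ltW h).
have t_add i j : (i + j <= M)%N -> t i <= t (i + j)%N.
  elim: j => [|j IH]; rewrite ?addn0// addnS => ijM.
  by case/andP: (tS _ ijM) => /ltW h _; exact: le_trans (IH (ltnW ijM)) h.
have t_le i : (i <= M)%N -> t i <= tM.
  by move=> iM; rewrite -tME -[X in _ <= t X](subnKC iM); apply: t_add; rewrite subnKC.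
have XwsE i : (i <= M)%N -> `|X (t i) - ws i| <= eps.
  move=> iM; have := XW (t i); rewrite t_mono// t_le// => /(_ isT).
  case: i iM => [|i] iM; first by rewrite t0 W0.
  by rewrite (WE i iM)// lexx andbT; case/andP: (tS i iM).
have Nle x y : `|x| <= y -> N x <= c * y by move=> h; rewrite (le_trans (Nc _))// ler_pM2l.
pose al := N (X a - Y 0) + 3 * c * eta.
have al0 : 0 <= al by rewrite addr_ge0// ?wnorm_ge0// !mulr_ge0// ltW.
(* At the first grid point after [a] nothing is known about the previous step, so
   the three continuity moduli are used instead. *)
have base i : (i <= M)%N -> a <= t i < a + eps -> N (ws i - Y (t i - a)) <= al.
  move=> iM /andP[ati tia]; have ti := t_le i iM.
  have d1' : `|t i - a| < eps by rewrite ger0_norm ?subr_ge0//; lra.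
  have h1 : N (ws i - X (t i)) <= c * eta.
    by apply: Nle; rewrite distrC (le_trans (XwsE i iM)).
  have h2 : N (X (t i) - X a) <= c * eta.
    by apply/Nle/HA; [rewrite t_mono//= (le_trans ti)|exact: lt_le_trans e4].
  have h3 : N (Y 0 - Y (t i - a)) <= c * eta.
    apply: Nle; rewrite distrC -[X in Y X - _]add0r; apply: HY; exact: lt_le_trans e6.
  have := wnorm_distD (X (t i)) (ws i) (Y (t i - a)).
  have := wnorm_distD (X a) (X (t i)) (Y (t i - a)).
  have := wnorm_distD (Y 0) (X a) (Y (t i - a)).
  by rewrite /al; lra.
pose dl i := fine (\int[mu]_(s in `[t i, t i.+1]) `|f s - fs i.+1|%:E)%E.
have int0 i : (0 <= \int[mu]_(s in `[t i, t i.+1]) `|f s - fs i.+1|%:E)%E.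
  by apply: integral_ge0 => x _; rewrite lee_fin.
have dl0 i : 0 <= dl i by rewrite fine_ge0.
have int_fin i : (i < M)%N -> (\int[mu]_(s in `[t i, t i.+1]) `|f s - fs i.+1|%:E < +oo)%E.
  move=> iM; apply: (le_lt_trans _ (lt_trans int_lt (ltry eps))).
  rewrite (bigD1 (Ordinal iM))//=; apply: leeDl.
  by apply: sume_ge0 => j _; exact: int0.
have dlE i : (i < M)%N -> (dl i)%:E = (\int[mu]_(s in `[t i, t i.+1]) `|f s - fs i.+1|%:E)%E.
  by move=> iM; rewrite fineK// ge0_fin_numE// int_fin.
have dl_sum : \sum_(i < M) dl i < eps.
  rewrite -lte_fin -sumEFin (le_lt_trans _ int_lt)//.
  by apply: lee_sum => i _; rewrite dlE.
have dl_le i : (i <= M)%N -> \sum_(j < i) dl j <= eps.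
  move=> iM; apply: le_trans (ltW dl_sum).
  rewrite (big_ord_widen M (fun j => dl j))//.
  by rewrite [leRHS](bigID (fun j : 'I_M => (j < i)%N))/= lerDl sumr_ge0.
pose S i := c * (\sum_(j < i) dl j + \int[mu]_(x in `[a, t i]) th x + eta * (t i - a)).
have th_int' x : a <= x <= b -> mu.-integrable `[a, x] (EFin \o th).
  by case/andP => _ xb; apply: integrableS th_int => //; apply: subset_itv; rewrite bnd_simp.
have RI0 x y : 0 <= \int[mu]_(z in `[x, y]) th z by exact: Rintegral_ge0.
have S0 i : a <= t i -> 0 <= S i.
  move=> h; rewrite /S mulr_ge0//; first exact: ltW.
  by rewrite !addr_ge0 ?sumr_ge0// mulr_ge0 ?subr_ge0// ltW.
have main i : (i <= M)%N -> a <= t i <= b -> N (ws i - Y (t i - a)) <= expR (2 * w * (t i - a)) * (al + S i).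
  have small j : (j <= M)%N -> a <= t j < a + eps -> N (ws j - Y (t j - a)) <= expR (2 * w * (t j - a)) * (al + S j).
    move=> jM /[dup] /(base j jM) h /andP[aj _]; apply: (le_trans h).
    have aS : al <= al + S j by rewrite lerDl S0.
    apply: (le_trans aS); rewrite ler_peMl ?(le_trans al0)//.
    by rewrite -expR0 ler_expR !mulr_ge0// subr_ge0.
  elim: i => [|i IH] iM /andP[at1 tb].
    by apply: small => //; rewrite at1 t0/=; have := a0; lra.
  have /andP[tlt tlt'] := tS i iM.
  have [ati|tia] := leP a (t i); last by apply: small => //; rewrite at1/=; lra.
  have tib : t i <= b by exact: le_trans (ltW tlt) tb.
  have {}IH := IH (ltnW iM); rewrite ati tib in IH; have {}IH := IH isT.
  set h := t i.+1 - t i; have h0 : 0 < h by rewrite subr_gt0.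
  have [Dw sE] := stepE i iM.
  have [|DY YE] := YA (s := t i.+1 - a); first by rewrite subr_ge0 at1 lerD2r.
  have t1E : t i.+1 - a = t i - a + h by rewrite /h; ring.
  set Rm := Y (t i - a) - Y (t i.+1 - a) + h *: Y' (t i.+1 - a).
  have Rm_le : `|Rm| <= eta * h.
    have := HR (t i.+1 - a) (- h); rewrite normrN (gtr0_norm h0) (@ger0_norm _ (t i.+1 - a)) ?subr_ge0//.
    have -> : t i.+1 - a - h = t i - a by rewrite t1E addrK.
    rewrite scaleNr opprK; apply; first by rewrite lerD2r.
    by rewrite /h; apply: lt_le_trans e8; lra.
  have E : ws i.+1 - Y (t i.+1 - a) = (ws i - Y (t i - a)) + h *: (A (ws i.+1) - A (Y (t i.+1 - a)))
     + (h *: (fs i.+1 - F) + Rm).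
    rewrite /Rm -YE !scalerBr scalerDr step_decomp -scalerDr -sE scalerA divff ?gt_eqF//.
    by rewrite scale1r addrCA subrr addr0.
  have := implicit_step Dw DY h0 E.
  have FD := forcing_dist ati (ltW tlt) tb (int_fin i iM).
  have Ng : N (h *: (fs i.+1 - F) + Rm) <= c * (dl i + \int[mu]_(x in `[t i, t i.+1]) th x + eta * h).
    apply: Nle; rewrite (le_trans (ler_normD _ _))// lerD// normrZ gtr0_norm//.
  have SE : al + S i.+1 = al + (S i + c * (dl i + \int[mu]_(x in `[t i, t i.+1]) th x + eta * h)).
    congr (_ + _); rewrite /S -mulrDr; congr (_ * _).
    rewrite big_ord_recr/= (@Rintegral_cc_split _ a (t i) (t i.+1))//; last 2 first.
    - exact: ltW.
    - by apply: th_int'; rewrite at1.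
    by rewrite /h; lra.
  move=> st; rewrite SE t1E.
  have wh : w * h <= 2^-1.
    have h1 : h <= (2 * (w + 1))^-1 by apply: le_trans e3; rewrite /h; lra.
    apply: (le_trans (ler_wpM2l w0 h1)).
    by rewrite invfM mulrCA ler_piMr// ler_pdivrMr ?mul1r ?lerDl//; have := w0; lra.
  have rho0 : 0 <= c * (dl i + \int[mu]_(x in `[t i, t i.+1]) th x + eta * h).
    by apply: mulr_ge0; [exact: ltW|rewrite !addr_ge0// mulr_ge0// ltW].
  apply: (gronwall_step (ltW h0) wh (S0 i ati) _ _ rho0 _ IH).
  - by rewrite addr_ge0// S0.
  - by rewrite subr_ge0.
  - by rewrite -t1E (le_trans st)// lerD2l.
(* The grid need not contain [b]: stop at the last grid point before it. *)
have [j jM /andP[jb bj]] : exists2 j, (j <= M)%N & b - eps < t j <= b.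
  apply: (last_index _ eps0 _ tS); first by rewrite t0; case/andP: bT'.
  by rewrite tME; lra.
have aj : a <= t j by lra.
have := main j jM; rewrite aj bj => /(_ isT) Hj.
have h1 : N (X b - ws j) <= 2 * c * eta.
  have : N (X b - X (t j)) <= c * eta.
    apply: Nle; rewrite distrC; apply: HB; first by rewrite t_mono//= (le_trans bj).
    by rewrite distrC ger0_norm ?subr_ge0//; lra.
  have : N (X (t j) - ws j) <= c * eta by apply: Nle; rewrite (le_trans (XwsE j jM)).
  by have := wnorm_distD (X (t j)) (X b) (ws j); lra.
have h2 : N (Y (t j - a) - Y (b - a)) <= c * eta.
  have := HZ (t j - b); rewrite distrC ger0_norm ?subr_ge0// => h.
  apply: Nle; rewrite (_ : t j - a = b - a + (t j - b)); last by ring.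
  by apply: h; lra.
have h3 : expR (2 * w * (t j - a)) * (al + S j) <= expR (2 * w * (b - a)) * (al + c * (eta + \int[mu]_(x in `[a, b]) th x + eta * (b - a))).
  apply: ler_pM; [exact: expR_ge0|by rewrite addr_ge0// S0| |].
    by rewrite ler_expR ler_wpM2l ?lerD2r// mulr_ge0.
  rewrite lerD2l ler_pM2l//; apply: lerD; last by rewrite ler_pM2l// lerD2r.
  apply: lerD; first by rewrite (le_trans (dl_le j jM)).
  rewrite [leRHS](@Rintegral_cc_split _ a (t j) b)//.
  by rewrite lerDl.
have := wnorm_distD (ws j) (X b) (Y (b - a)).
have := wnorm_distD (Y (t j - a)) (ws j) (Y (b - a)).
by move: h3 Hj; rewrite -/al; lra.
Qed.

Lemma compare_piece : N (X b - Y (b - a)) <=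
  expR (2 * w * (b - a)) * (N (X a - Y 0) + c * \int[mu]_(x in `[a, b]) th x).
Proof.
apply/ler_addgt0Pr => e e0.
set E := expR _; have E0 : 0 < E by exact: expR_gt0.
pose C := E * (3 * c + c * (1 + (b - a))) + 3 * c.
have ba0 : 0 < b - a by rewrite subr_gt0.
have C0 : 0 < C.
  by rewrite addr_gt0 ?mulr_gt0 ?addr_gt0 ?mulr_gt0// addr_gt0.
have := compare_eta (divr_gt0 e0 C0); rewrite -/E => /le_trans; apply.
have CE : e / C * C = e by rewrite mulfVK// gt_eqF.
rewrite -[X in _ <= _ + X]CE; set eta := e / C; rewrite /C le_eqVlt; apply/orP; left; apply/eqP; ring.
Qed.

End Piece.
End Comparison.
(** * Decay of V along a differentiable curve *)

Section Lyapunov.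
Context {R : realType} {U : normedModType R}.

Lemma is_derive_of_estimate (Y : R -> U) (y' : U) (s : R) :
  (forall e, 0 < e -> exists2 d : R, 0 < d &
    forall h, `|h| < d -> `|Y (s + h) - Y s - h *: y'| <= e * `|h|) ->
  is_derive s 1 Y y'.
Proof.
move=> HY.
have cY : (fun h => h^-1 *: (Y (h *: 1 + s) - Y s)) @ 0^' --> y'.
  apply/cvgrPdist_le => e e0; have [d d0 Hd] := HY e e0.
  near=> h.
  have h0 : h != 0 by near: h; exact: nbhs_dnbhs_neq.
  have hd : `|h| < d.
    near: h; apply: dnbhs0_lt; exact: d0.
  rewrite [h *: 1](_ : _ = h); last exact: mulr1.
  rewrite distrC (addrC h) -[y'](scalerK h0) -scalerBr normrZ normfV.
  by rewrite ler_pdivrMl ?normr_gt0// mulrC Hd.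
apply: DeriveDef; first by apply/cvg_ex; exists y'.
exact/cvg_lim.
Unshelve. all: by end_near. Qed.

(** The function [expR (c * s) * (V (Y s) - D / c)] is nonincreasing, and
    [1 - expR (- c * h) <= c * h]. *)
Lemma lyapunov_step (V : U -> R) (Y Y' : R -> U) (h c D : R) :
  (forall x, differentiable V x) -> 0 < h -> 0 < c -> 0 <= D ->
  (forall e, 0 < e -> exists2 d : R, 0 < d &
    forall t k, `|t| <= h -> `|k| < d -> `|Y (t + k) - Y t - k *: Y' t| <= e * `|k|) ->
  (forall s, 0 <= s <= h -> 'd V (Y s) (Y' s) <= - c * V (Y s) + D) ->
  V (Y h) <= expR (- c * h) * V (Y 0) + h * D.
Proof.
move=> dV h0 c0 D0 HY HV.
have Yd s : 0 <= s <= h -> is_derive s 1 Y (Y' s).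
  move=> /andP[s0 sh]; apply: is_derive_of_estimate => e e0; have [d d0 Hd] := HY e e0.
  by exists d => // k kd; apply: Hd => //; rewrite ger0_norm.
have VYd s : 0 <= s <= h -> is_derive s 1 (V \o Y) ('d V (Y s) (Y' s)).
  move=> /Yd Ys.
  have dY : differentiable Y s by apply/derivable1_diffP.
  have dVY : differentiable (V \o Y) s by exact: differentiable_comp.
  apply: DeriveDef; first exact/derivable1_diffP.
  rewrite deriveE// diff_comp//=; congr ('d V (Y s) _).
  by rewrite -deriveE//; apply: derive_val.
pose p s := expR (c * s) * (V (Y s) - D / c).
have pd s : 0 <= s <= h -> is_derive s 1 p (expR (c * s) * (c * V (Y s) - D + 'd V (Y s) (Y' s))).
  move=> /VYd VYs.
  have cs : is_derive s 1 (fun x => c * x) c.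
    have := @is_deriveZ _ _ _ (@id R) c s 1 1 _; rewrite [c *: 1]mulr1; exact.
  have e1 : is_derive s 1 (expR \o (fun x => c * x)) (expR (c * s) * c).
    exact: is_derive1_comp.
  have e2 : is_derive s 1 ((V \o Y) - cst (D / c)) ('d V (Y s) (Y' s)).
    by rewrite -[X in is_derive _ _ _ X]subr0; exact: is_deriveB.
  have := is_deriveM e1 e2.
  rewrite (_ : (_ \o _) * (_ - _) = p) => [h1|]; last by apply/funext.
  apply: is_derive_eq; rewrite /=; change (expR (c * s) * 'd V (Y s) (Y' s) + (V (Y s) - D / c) * (expR (c * s) * c) = expR (c * s) * (c * V (Y s) - D + 'd V (Y s) (Y' s))).
  have cD : D / c * c = D by rewrite mulfVK// gt_eqF.
  rewrite -[in RHS]cD; ring.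
have ph : p h <= p 0.
  apply: (@ler0_derive1_le_cc _ p 0 h) => [x|x||||]; rewrite ?in_itv/= ?lexx ?(ltW h0)//.
  - by move=> /andP[/ltW x0 /ltW xh]; have := pd x; rewrite x0 xh => /(_ isT) [].
  - move=> /andP[/ltW x0 /ltW xh]; have := pd x; have := HV x; rewrite x0 xh => /(_ isT) h1 /(_ isT) h2.
    rewrite derive1E derive_val mulr_ge0_le0 ?expR_ge0//; lra.
  - apply: derivable_within_continuous => x; rewrite in_itv/= => xh.
    by case: (pd x xh).
have Ep : expR (- c * h) * p h = V (Y h) - D / c.
  by rewrite /p mulrA -expRD mulNr addNr expR0 mul1r.
have : expR (- c * h) * p h <= expR (- c * h) * p 0 by rewrite ler_wpM2l// expR_ge0.
rewrite Ep /p mulr0 expR0 mul1r => H1.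
have H2 : 1 - expR (- c * h) <= c * h.
  by have := expR_ge1Dx (- c * h); lra.
have H3 : (1 - expR (- c * h)) * (D / c) <= c * h * (D / c) by rewrite ler_wpM2r// divr_ge0// ltW.
have H4 : c * h * (D / c) = h * D by rewrite mulrCA mulrAC divff ?gt_eqF// mul1r mulrC.
by move: H1 H3; rewrite H4; lra.
Qed.

End Lyapunov.
(** * The saturated boundary condition *)

Lemma is_slope_sum (R : realType) (I : finType) (p : I -> R -> R) (d : I -> R) (s : R) :
  (forall i, is_slope (p i) s (d i)) -> is_slope (fun t => \sum_i p i t) s (\sum_i d i).
Proof.
move=> pd; elim: (index_enum I) => [|i r IH].
  under eq_fun do rewrite big_nil.
  by rewrite big_nil; exact: is_slope_cst.
under eq_fun do rewrite big_cons.
by rewrite big_cons; exact: (is_slope_add (pd i) IH).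
Qed.

Lemma clamp_lip (R : realType) (a b x y : R) : a <= b -> `|clamp a b x - clamp a b y| <= `|x - y|.
Proof.
move=> ab; wlog xy : x y / x <= y.
  move=> h; have [xy|/ltW yx] := leP x y; first exact: h.
  by rewrite distrC (distrC x) h.
rewrite [leRHS]distrC (ger0_norm (_ : 0 <= y - x)) ?subr_ge0// /clamp ler_norml.
by case: (leP x b); case: (leP y b); case: (leP a x); case: (leP a y); case: (leP a b) => *; apply/andP; split; lra.
Qed.

Section PlantFacts.
Context {R : realType} {n m q : nat}.
Variables (Lambda H : 'M[R]_n) (B : 'M[R]_(n, m)) (N : 'M[R]_(n, q))
  (K : 'M[R]_(m, n)) (ubar : 'cV[R]_m).
Hypothesis Lambda_diag : is_diag_mx Lambda.
Hypothesis Lambda_posdef : forall v : 'cV[R]_n, v != 0 -> 0 < (v^T *m Lambda *m v) 0 0.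
Hypothesis ubar_gt0 : forall i, 0 < ubar i 0.
Local Notation mu := (@lebesgue_measure R).

Lemma Lambda_gt0 i : 0 < Lambda i i.
Proof.
pose v : 'cV[R]_n := delta_mx i 0.
have <- : (v^T *m Lambda *m v) 0 0 = Lambda i i.
  by rewrite /v -colE trmx_delta -rowE !mxE.
apply: Lambda_posdef; apply/eqP => /matrixP/(_ i 0); rewrite !mxE !eqxx => /eqP.
by rewrite oner_eq0.
Qed.

(** The boundary condition as a map from X(1) to X(0). *)
Definition bc_map (y : 'cV[R]_n) : 'cV[R]_n := (H + B *m K) *m y + B *m deadzone ubar (K *m y).

Lemma bc_mapE y : bc_map y = H *m y + B *m sat ubar (K *m y).
Proof.
by rewrite /bc_map /deadzone mulmxBr mulmxDl -mulmxA -addrA (addrC (B *m (K *m y))) subrK.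
Qed.

(** Saturation as a monotone truncation, the form to which [clamp_lip] and
    [cc_clamp] apply. *)
Lemma sat_clamp (u : 'cV[R]_m) i : sat ubar u i 0 = clamp (- ubar i 0) (ubar i 0) (u i 0).
Proof.
have ub := ubar_gt0 i; rewrite mxE; move: (u i 0) (ubar i 0) ub => x b b0.
rewrite /clamp; have [x0|x0|->] := ltgtP x 0.
- have -> : Num.min x b = x by rewrite min_l// ltW// (lt_trans x0).
  by rewrite ltr0_norm// ltr0_sg// mulrN1 oppr_min opprK maxC.
- by rewrite gtr0_norm// gtr0_sg// mulr1 max_r// le_min; apply/andP; split; lra.
- by rewrite sgr0 mulr0 min_l ?ltW// max_r// oppr_le0 ltW.
Qed.

Lemma sat_lip (u v : 'cV[R]_m) : enorm (sat ubar u - sat ubar v) <= enorm (u - v).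
Proof.
have E (a b : 'cV[R]_m) i : (a - b) i 0 = a i 0 - b i 0 by rewrite !mxE.
rewrite /enorm ler_wsqrtr//; apply: ler_sum => i _; rewrite !E.
rewrite -[leRHS]real_normK ?num_real//; apply: sqr_le_sqr; rewrite !sat_clamp clamp_lip//.
by rewrite ge0_cp// ltW.
Qed.

Lemma bc_map_lip : exists2 k : R, 0 <= k &
  forall a b, enorm (bc_map a - bc_map b) ^+ 2 <= (1 + k) * enorm (a - b) ^+ 2.
Proof.
have [C1 HC1] := enorm_mulmx_le H; have [C2 HC2] := enorm_mulmx_le B; have [C3 HC3] := enorm_mulmx_le K.
pose L := `|C1| + `|C2| * `|C3|.
exists (L ^+ 2); first exact: sqr_ge0.
move=> a b; have e0 := enorm_ge0 (a - b).
have h : enorm (bc_map a - bc_map b) <= L * enorm (a - b).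
  rewrite !bc_mapE opprD addrACA -!mulmxBr (le_trans (enormD _ _))// mulrDl lerD//.
    by rewrite (le_trans (HC1 _))// ler_wpM2r// ler_norm.
  rewrite (le_trans (HC2 _))// (le_trans (ler_wpM2r (enorm_ge0 _) (ler_norm C2)))//.
  rewrite -mulrA ler_wpM2l// (le_trans (sat_lip _ _))// -mulmxBr (le_trans (HC3 _))//.
  by rewrite ler_wpM2r// ler_norm.
apply: (le_trans (_ : _ <= (L * enorm (a - b)) ^+ 2)).
  by rewrite lerXn2r// nnegrE ?enorm_ge0// (le_trans (enorm_ge0 _) h).
by rewrite exprMn ler_wpM2r ?sqr_ge0// lerDr.
Qed.

Lemma bc_map_cc (p : 'I_n -> R -> R) : (forall i, cc (p i)) ->
  forall i, cc (fun t => bc_map (vec p t) i 0).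
Proof.
move=> p_cc i.
pose kp j t := \sum_h K j h * p h t.
have kp_cc j : cc (kp j) by apply: cc_sum => h; exact: cc_scale.
apply: (@cc_ext _ (fun t => \sum_h H i h * p h t + \sum_j B i j * clamp (- ubar j 0) (ubar j 0) (kp j t))).
  move=> t; rewrite bc_mapE !mxE; congr (_ + _); apply: eq_bigr => j _; first by rewrite mxE.
  rewrite sat_clamp mxE; congr (_ * clamp _ _ _); apply: eq_bigr => h _; by rewrite mxE.
apply: cc_add; apply: cc_sum => j; apply: cc_scale => //; exact: cc_clamp.
Qed.

Lemma bc_map0 : bc_map 0 = 0.
Proof.
rewrite bc_mapE !mulmx0 add0r (_ : sat ubar 0 = 0) ?mulmx0//.
by apply/matrixP => i j; rewrite !mxE sgr0 mulr0.
Qed.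

(** Both boundary values are 0, and 0 is fixed by the boundary map. *)
Lemma C1c01_nice (v : 'I_n -> R -> R) : (forall i, C1c01 (v i)) -> nice bc_map v.
Proof.
move=> v_c; split; first by move=> i; exact: C1c01_cc.
have v0 z : z \notin `]0, 1[ -> vec v z = 0.
  move=> z01; apply/matrixP => i j; rewrite !mxE.
  have [_ _ [a [b [a0 b1 vz]]]] := v_c i; apply: vz; apply: contra z01.
  by rewrite !in_itv/= => /andP[za zb]; rewrite (lt_le_trans a0)//= (le_lt_trans zb).
by rewrite !v0 ?bc_map0// in_itv/= ltxx ?andbF.
Qed.

(** A time during which no wave crosses the whole interval. *)
Definition step_bound : R := (\sum_i Lambda i i + 1)^-1.

Lemma step_bound_gt0 : 0 < step_bound.
Proof. by rewrite invr_gt0 ltr_wpDl// sumr_ge0// => i _; exact/ltW/Lambda_gt0. Qed.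

Lemma step_boundP t i : 0 <= t <= step_bound -> t * Lambda i i <= 1.
Proof.
move=> /andP[t0 tt]; have Li := ltW (Lambda_gt0 i).
apply: (le_trans (ler_wpM2r Li tt)); have := step_bound_gt0.
rewrite /step_bound invr_gt0 => S0; rewrite mulrC ler_pdivrMr// mul1r.
rewrite (bigD1 i)//= -addrA lerDl addr_ge0// sumr_ge0// => j _; exact/ltW/Lambda_gt0.
Qed.

(** The stationary profile is a primitive of [N d], divided by the speeds. *)
Lemma nice_evolution (x : 'I_n -> R -> R) (d : 'I_q -> R -> R) : nice bc_map x ->
  (forall j, C1c01 (d j)) -> exists Y Y' : R -> L2 R n,
  [/\ Y 0 = st x,
      forall t, 0 <= t <= step_bound -> exists2 x', nice bc_map x' & Y t = st x',
      forall t, 0 <= t <= step_bound -> domA H B K ubar (Y t) /\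
        opA Lambda (Y t) + mulmxL2 N (st d) = Y' t &
      forall T e, 0 < e -> exists2 r : R, 0 < r & forall t h, `|t| <= T -> `|h| < r ->
        `|Y (t + h) - Y t - h *: Y' t| <= e * `|h| ].
Proof.
move=> x_nice d_c.
have /choice[D D_p] j : exists u : R -> R, [/\ cc u, u 0 = 0 & forall z, is_slope u z (d j z)].
  exact: C1c01_primitive.
pose u i z := (Lambda i i)^-1 * \sum_j N i j * D j z.
pose f i z := \sum_j N i j * d j z.
have u_cc i : cc (u i).
  by apply: cc_scale; apply: cc_sum => j; apply: cc_scale; case: (D_p j).
have u0 i : u i 0 = 0.
  by rewrite /u big1 ?mulr0// => j _; case: (D_p j) => _ -> _; rewrite mulr0.
have u_slope i z : is_slope (u i) z (f i z / Lambda i i).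
  rewrite mulrC; apply/is_slope_scale/is_slope_sum => j.
  by apply: is_slope_scale; case: (D_p j).
have F_ae i : {ae mu, forall z, 0 < z < 1 -> mulmxL2 N (st d) z i 0 = f i z}.
  apply: ae_filterS2 (iffLR (ae_mu01 _) (mulmxL2E N (st d))) (st_ae (fun j => C1c01_cc (d_c j))) => z h1 h2 z01.
  rewrite h1// h2// mxE; apply: eq_bigr => j _; by rewrite mxE.
have [Y [Y' [Y0 Yn YA Yd]]] := evolution Lambda_gt0 bc_map_cc x_nice u_cc u0 u_slope Lambda_diag (fun=> erefl) F_ae.
exists Y, Y'; split => // t tt; case/andP: (tt) => t0 _.
- by apply: Yn => // i; exact: step_boundP.
- by apply: YA => // i; exact: step_boundP.
Qed.

(** * Iteration of time steps *)

Section Chain.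
Local Notation A := (opA Lambda).
Local Notation DA := (domA H B K ubar).
Local Notation r := (fun i => (Lambda i i)^-1).
Variables (V : L2 R n -> R) (c3 chi : R).
Hypothesis V_differentiable : forall z, differentiable V z.
Hypothesis c3_gt0 : 0 < c3.
Hypothesis V_dissipation : forall (d : L2 R q) z, DA z ->
  'd V z (A z + mulmxL2 N d) <= - c3 * V z + chi ^+ 2 * `|d| ^+ 2.
Variables (k w c : R).
Hypotheses (k0 : 0 <= k) (w0 : 0 <= w) (c0 : 0 < c).
Hypothesis dissip : forall x y, DA x -> DA y ->
  wip r k (x - y) (A x - A y) <= w * wip r k (x - y) (x - y).
Hypothesis Nc : forall x, wnorm r k x <= c * `|x|.
Variables (f : R -> L2 R n) (X0 : L2 R n) (X : R -> L2 R n) (T : R).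
Hypotheses (Xmild : mild_on A DA f X0 X T) (X_cont : {within `[0, T], continuous X}).
Hypothesis mf : forall v, exists g : R -> R, [/\ measurable_fun setT g,
  forall s, 0 <= g s <= `|f s - v| & {ae mu, forall s, 0 <= s <= T -> `|f s - v| <= g s}].

(** Each piece starts from the state where the previous one ended.  The disturbance
    is the element [st (dk i)] on the i-th piece, and [th] bounds the distance of
    the forcings. *)
Lemma chain (h : R) (P : nat) (x : 'I_n -> R -> R) (dk : nat -> 'I_q -> R -> R) (th : R -> R) :
  0 < h <= step_bound -> P%:R * h <= T -> nice bc_map x -> (forall i j, C1c01 (dk i j)) ->
  mu.-integrable `[0, P%:R * h] (EFin \o th) -> (forall s, 0 <= th s) ->
  (forall i, (i < P)%N -> {ae mu, forall s, i%:R * h <= s <= i.+1%:R * h ->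
     `|f s - mulmxL2 N (st (dk i))| <= th s}) ->
  exists x', [/\ nice bc_map x',
    wnorm r k (X (P%:R * h) - st x') <= expR (2 * w * (P%:R * h)) *
       (wnorm r k (X 0 - st x) + c * \int[mu]_(s in `[0, P%:R * h]) th s) &
    V (st x') <= expR (- c3 * (P%:R * h)) * V (st x) +
       chi ^+ 2 * (h * \sum_(i < P) `|st (dk i)| ^+ 2)].
Proof.
move=> /andP[h0 hs] PT x_nice dk_c thi th0 f_th.
have r0 i : 0 < (Lambda i i)^-1 by rewrite invr_gt0 Lambda_gt0.
have RI0 (a b : R) : 0 <= \int[mu]_(z in `[a, b]) th z by exact: Rintegral_ge0.
elim: P PT thi f_th => [|P IH] PT thi f_th.
  exists x; rewrite !mul0r !mulr0 expR0 !mul1r big_ord0 !mulr0 addr0; split => //.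
  by rewrite lerDl mulr_ge0// ltW.
have PS : P.+1%:R * h = P%:R * h + h by rewrite -natr1 mulrDl mul1r.
have P0 : 0 <= P%:R * h by rewrite mulr_ge0// ltW.
have PP : P%:R * h <= P.+1%:R * h by rewrite PS lerDl ltW.
have [||i iP|x' [x'_nice Nx' Vx']] := IH; first exact: le_trans PT.
- by apply: integrableS thi => //; apply: subset_itv; rewrite bnd_simp.
- by apply: f_th; rewrite ltnS ltnW.
have [Y [Y' [Y0 Yn YA Yd]]] := nice_evolution x'_nice (dk_c P).
have [|x'' x''_nice Yh] := Yn h; first by rewrite ltW.
exists x''; split => //.
- have hE : P.+1%:R * h - P%:R * h = h by rewrite PS addrC addKr.
  have Plt : P%:R * h < P.+1%:R * h by rewrite PS ltrDl.
  have YA' s : 0 <= s <= P.+1%:R * h - P%:R * h -> DA (Y s) /\ A (Y s) + mulmxL2 N (st (dk P)) = Y' s.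
    by rewrite hE => /andP[s0 sh]; apply: YA; rewrite s0 (le_trans sh).
  have thi' : mu.-integrable `[P%:R * h, P.+1%:R * h] (EFin \o th).
    by apply: integrableS thi => //; apply: subset_itv; rewrite bnd_simp.
  have := compare_piece r0 k0 w0 dissip Xmild X_cont P0 Plt PT YA' (Yd _) c0 Nc mf thi' th0 (f_th P (ltnSn P)).
  rewrite hE Yh Y0 => /le_trans; apply.
  have -> : 2 * w * (P.+1%:R * h) = 2 * w * h + 2 * w * (P%:R * h) by rewrite PS; ring.
  rewrite expRD -[leRHS]mulrA; apply: ler_wpM2l; first exact: expR_ge0.
  rewrite (Rintegral_cc_split P0 PP thi).
  have E1 : 1 <= expR (2 * w * (P%:R * h)) by rewrite -expR0 ler_expR !mulr_ge0// ltW.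
  have I1 := RI0 (P%:R * h) (P.+1%:R * h).
  have := ler_wpM2r (mulr_ge0 (ltW c0) I1) E1; rewrite mul1r => H2.
  apply: (le_trans (lerD Nx' H2)).
  by rewrite -mulrDr -[X in _ * X]addrA -[X in _ * (_ + X)]mulrDr.
have DV0 : 0 <= chi ^+ 2 * `|st (dk P)| ^+ 2 by rewrite mulr_ge0 ?sqr_ge0.
have HV s : 0 <= s <= h -> 'd V (Y s) (Y' s) <= - c3 * V (Y s) + chi ^+ 2 * `|st (dk P)| ^+ 2.
  move=> /andP[s0 sh]; have [|DY <-] := YA s; first by rewrite s0 (le_trans sh).
  exact: V_dissipation.
have := lyapunov_step V_differentiable h0 c3_gt0 DV0 (Yd h) HV.
rewrite Yh Y0 => /le_trans; apply.
have -> : - c3 * (P.+1%:R * h) = - c3 * h + - c3 * (P%:R * h) by rewrite PS; ring.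
rewrite expRD big_ord_recr/= -[X in _ <= X + _]mulrA !mulrDr addrA lerD//; last by rewrite mulrCA.
have E1 : expR (- c3 * h) <= 1 by rewrite -expR0 ler_expR mulNr oppr_le0 mulr_ge0// ltW.
apply: (le_trans (ler_wpM2l (expR_ge0 _) Vx')).
rewrite mulrDr lerD2l ler_piMl// mulr_ge0 ?sqr_ge0// mulr_ge0 ?sumr_ge0//; last exact: ltW.
Qed.
End Chain.
End PlantFacts.

(** * Step approximation of a disturbance in time *)

Section TimeApprox.
Context {R : realType} {W : normedModType R}.
Local Notation mu := (@lebesgue_measure R).

Lemma simple_onS (I J : set R) (s : R -> W) : measurable I -> I `<=` J -> simple_on J s -> simple_on I s.
Proof.
move=> mI IJ [fs ms]; split; first by apply: sub_finite_set fs; exact: image_subset.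
move=> v; rewrite (_ : _ `&` _ = I `&` (J `&` s @^-1` [set v])); first exact: measurableI.
by rewrite setIA (setIidl IJ).
Qed.

Lemma strongly_measurableS (I J : set R) (d : R -> W) : measurable I -> I `<=` J ->
  strongly_measurable J d -> strongly_measurable I d.
Proof.
move=> mI IJ [s [ss sd]]; exists s; split; first by move=> k; exact: simple_onS (ss k).
by apply: ae_filterS sd => x h /IJ.
Qed.

Lemma simple_on_cst (I : set R) (v : W) : measurable I -> simple_on I (cst v).
Proof.
move=> mI; split.
  by apply: sub_finite_set (finite_set1 v); move=> _ [x _ <-].
move=> u; have [->|/eqP vu] := eqVneq v u.
  by rewrite (_ : _ @^-1` _ = setT) ?setIT//; apply/seteqP; split.
by rewrite (_ : _ @^-1` _ = set0) ?setI0//; apply/seteqP; split.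
Qed.

(** The values form a finite set, so nothing is required of [phi]. *)
Lemma measurable_simple2 (I : set R) (s s' : R -> W) (phi : W -> W -> R) : measurable I ->
  simple_on I s -> simple_on I s' -> measurable_fun (I : set (measurableTypeR R)) (fun x => phi (s x) (s' x)).
Proof.
move=> mI [fs ms] [fs' ms'] _ B mB.
rewrite (_ : _ `&` _ = \bigcup_(v in s @` I) \bigcup_(v' in s' @` I)
   ([set _ | B (phi v v')] `&` ((I `&` s @^-1` [set v]) `&` (I `&` s' @^-1` [set v'])))).
  apply: fin_bigcup_measurable => // v _; apply: fin_bigcup_measurable => // v' _.
  apply: measurableI; last by apply: measurableI; [exact: ms|exact: ms'].
  have [Bv|Bv] := pselect (B (phi v v')).
    by rewrite (_ : [set _ | _] = setT)//; apply/seteqP; split.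
  by rewrite (_ : [set _ | _] = set0)//; apply/seteqP; split.
apply/seteqP; split => x /=.
  by move=> [Ix Bx]; exists (s x); [exists x|exists (s' x); [exists x|]].
by move=> [v _ [v' _ [Bv [[Ix sx] [_ sx']]]]]; split => //; rewrite sx sx'.
Qed.

(** Norms of strongly measurable functions are Borel only off a null set; [g] is a
    Borel substitute that never exceeds the original. *)
Lemma bochner_measurable (I : set R) (d u : R -> W) (phi : W -> W -> R) : measurable I ->
  strongly_measurable I d -> simple_on I u -> (forall v, continuous (phi^~ v)) ->
  (forall x v, 0 <= phi x v) ->
  exists g : R -> R, [/\ measurable_fun setT g, forall s, 0 <= g s <= phi (d s) (u s) &
    {ae mu, forall s, I s -> g s = phi (d s) (u s)}].
Proof.
move=> mI [s [ss [Z [mZ Z0 sZ]]]] us cphi phi0.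
pose D := (I `\` Z : set (measurableTypeR R)).
have mD : measurable D by exact: measurableD.
have mf : measurable_fun D (fun x => phi (d x) (u x)).
  apply: (@measurable_fun_cvg _ _ _ D (fun k x => phi (s k x) (u x))) => //.
    move=> k; apply: measurable_funS (measurable_simple2 phi mI (ss k) us) => //.
    by move=> x [].
  move=> x [Ix nZ].
  have sx : s k x @[k --> \oo] --> d x.
    by apply: contrapT => h; apply: nZ; apply: sZ => /= h'; apply: h; exact: h'.
  exact: (cvg_comp (fun k => s k x) (fun y => phi y (u x)) sx (cphi (u x) (d x))).
exists (restrict D (fun x => phi (d x) (u x))); split.
- exact: (iffLR (measurable_restrictT _ mD) mf).
- by move=> x; rewrite patchE; case: ifP => _; rewrite lexx phi0.
- exists Z; split => // x /= h; apply: contrapT => nZ; apply: h => Ix.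
  by rewrite patchE mem_set.
Qed.

(** Approximation by step functions on all fine enough uniform grids.  The error is
    measured through a pointwise bound [th], because this is the form in which
    [compare_piece] uses it. *)
Definition stepappr (t : R) (f : R -> W) : Prop := forall e : R, 0 < e -> exists P0 : nat,
  forall P : nat, (P0 <= P)%N -> (0 < P)%N -> exists (a : nat -> W) (th : R -> R),
  [/\ measurable_fun setT th, forall s, 0 <= th s,
      (\int[mu]_(s in `[0%R, t]) (th s ^+ 2)%:E <= e%:E)%E &
      forall i, (i < P)%N -> {ae mu, forall s, i%:R * (t / P%:R) <= s <= i.+1%:R * (t / P%:R) ->
        `|f s - a i| <= th s}].

Lemma grid_piece_itv (t : R) (P i : nat) (s : R) : 0 < t -> (i < P)%N ->
  i%:R * (t / P%:R) <= s <= i.+1%:R * (t / P%:R) -> 0 <= s <= t.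
Proof.
move=> t0 iP /andP[h1 h2]; have P0 : 0 < P%:R :> R by rewrite ltr0n (leq_ltn_trans _ iP).
have tP : 0 <= t / P%:R by rewrite divr_ge0// ltW.
apply/andP; split; first by rewrite (le_trans _ h1)// mulr_ge0.
rewrite (le_trans h2)// mulrCA ger_pMr// ler_pdivrMr// mul1r ler_nat//.
Qed.

Lemma stepappr_close (t : R) (f : R -> W) : 0 < t ->
  (forall e, 0 < e -> exists (g : R -> W) (E : R -> R), [/\ stepappr t g, measurable_fun setT E,
     forall s, 0 <= E s, (\int[mu]_(s in `[0%R, t]) (E s ^+ 2)%:E <= e%:E)%E &
     {ae mu, forall s, 0 <= s <= t -> `|f s - g s| <= E s}]) -> stepappr t f.
Proof.
move=> t0 H e e0; have e4 : 0 < e / 4 by rewrite divr_gt0.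
have [g [E [gA mE E0 Ee fg]]] := H _ e4.
have [P0 HP] := gA _ e4; exists P0 => P P0P P_gt0; have [a [th [mth th0 the ga]]] := HP P P0P P_gt0.
exists a, (fun s => E s + th s); split.
- exact: measurable_funD.
- by move=> s; rewrite addr_ge0.
- by rewrite (_ : e = 2 * (e / 4) + 2 * (e / 4)); [exact: integral_sqrD_le|field].
- move=> i iP; apply: ae_filterS2 fg (ga i iP) => s h1 h2 si.
  by rewrite (le_trans (ler_distD (g s) _ _))// lerD// ?h2// h1// (grid_piece_itv t0 iP).
Qed.

Lemma stepappr_add (t : R) (f g : R -> W) : stepappr t f -> stepappr t g ->
  stepappr t (fun s => f s + g s).
Proof.
move=> fA gA e e0; have e4 : 0 < e / 4 by rewrite divr_gt0.
have [P0 HP] := fA _ e4; have [P1 HP1] := gA _ e4.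
exists (maxn P0 P1) => P; rewrite geq_max => /andP[P0P P1P] P_gt0.
have [a [th [mth th0 the fa]]] := HP P P0P P_gt0.
have [b [th' [mth' th'0 th'e gb]]] := HP1 P P1P P_gt0.
exists (fun i => a i + b i), (fun s => th s + th' s); split.
- exact: measurable_funD.
- by move=> s; rewrite addr_ge0.
- by rewrite (_ : e = 2 * (e / 4) + 2 * (e / 4)); [exact: integral_sqrD_le|field].
- move=> i iP; apply: ae_filterS2 (fa i iP) (gb i iP) => s h1 h2 si.
  by rewrite opprD addrACA (le_trans (ler_normD _ _))// lerD// ?h1// h2.
Qed.

Lemma int_sqr_cst (t c : R) : 0 < t -> (\int[mu]_(s in `[0%R, t]) (c ^+ 2)%:E = (c ^+ 2 * t)%:E)%E.
Proof.
move=> t0; rewrite integral_cst// (EFinM (c ^+ 2) t); congr (_ * _)%E.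
by rewrite -[X in _ = X%:E]subr0; apply: lebesgue_measure_cc; exact: ltW.
Qed.

(** The image of Lebesgue measure under a dilation is a multiple of it. *)
Lemma int_scaling (t : R) (F : R -> R) : 0 < t -> measurable_fun setT F -> (forall s, 0 <= F s) ->
  (\int[mu]_(s in `[0%R, t]) (F s)%:E = t%:E * \int[mu]_(s in `]0%R, 1%R[) (F (t * s)%R)%:E)%E.
Proof.
move=> t0 mF F0; have t0' : t != 0 by rewrite gt_eqF.
have mphi : measurable_fun setT (fun z : measurableTypeR R => (t * z + 0 : measurableTypeR R)).
  by apply: measurable_funD => //; exact: measurable_funM.
have mFE : measurable_fun (`[0%R, t]%classic : set (measurableTypeR R)) (EFin \o F).
  by apply: measurable_funTS; apply/measurable_EFinP.
have F0' : {in (`[0%R, t]%classic : set (measurableTypeR R)), forall s, (0 <= (EFin \o F) s)%E}.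
  by move=> s _; rewrite lee_fin.
have [pm pmE P] : exists2 pm : {measure set (measurableTypeR R) -> \bar R},
    (forall A, pm A = mu ((fun z => t * z + 0) @^-1` A)) &
    (\int[pm]_(s in `[0%R, t]) (F s)%:E = \int[mu]_(s in (fun z => t * z + 0)%R @^-1` `[0%R, t]) ((EFin \o F) \o (fun z => t * z + 0)%R) s)%E.
  by unshelve refine (ex_intro2 _ _ _ _ (ge0_integral_pushforward mphi mu (measurable_itv _) mFE F0')).
have S := ge0_integral_mscale pm (measurable_itv `[0, t]) (NngNum (normr_ge0 t)) mFE.
have -> : (\int[mu]_(s in `[0%R, t]) (F s)%:E = \int[mscale (NngNum (normr_ge0 t)) pm]_(s in `[0%R, t]) (F s)%:E)%E.
  apply: eq_measure_integral => A mA _.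
  change (mu A = (`|t|%:E * pm A)%E); rewrite pmE (lebesgue_measure_affine 0 t0' mA) muleA -EFinM.
  by rewrite divff ?normr_eq0// mul1e.
rewrite S; last by move=> s _; rewrite lee_fin.
rewrite P /= gtr0_norm//; congr (_ * _)%E.
have -> : (fun z : R => t * z + 0) @^-1` `[0, t] = `[0, 1]%classic.
  by apply/seteqP; split => z; rewrite /= !in_itv/= addr0 pmulr_rge0// -ler_pdivlMl// mulVf.
under eq_integral do rewrite addr0.
rewrite (@integral_itv_bndoo _ 0 1)//; apply: measurable_funTS; apply/measurable_EFinP.
by apply: (measurableT_comp mF); exact: measurable_funM.
Qed.

(** After rescaling time to [0, 1], the scalar [p] is close in L^2 to a Lipschitz
    function, which is sampled on the grid. *)
Lemma stepappr_scale (t : R) (p : R -> R) (M : R) (v : W) : 0 < t -> measurable_fun setT p ->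
  (forall s, `|p s| <= M) -> stepappr t (fun s => p s *: v).
Proof.
move=> t0 mp pM e e0; have v1 : 0 < `|v| + 1 by rewrite ltr_wpDl.
pose b := e / (2 * t * (`|v| + 1) ^+ 2).
have b0 : 0 < b by rewrite divr_gt0 ?mulr_gt0 ?exprn_gt0.
have be : 2 * t * b * (`|v| + 1) ^+ 2 = e by rewrite /b; field; rewrite !gt_eqF.
have mpt : measurable_fun setT (fun s : R => p (t * s)).
  by apply: (measurableT_comp mp); exact: measurable_funM.
have b4 : 0 < b / 2 by rewrite divr_gt0.
have [_ /(_ _ b4)[psi psiC Hpsi]] := @appr_bounded _ (fun s => p (t * s)) M mpt (fun s => pM _).
have [[L L0 psiL] _] := C1c01_cc psiC.
have mpsi := C1c01_measurable psiC.
pose del s := p s - psi (s / t).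
have mdel : measurable_fun setT del.
  apply: measurable_funB => //; apply: (measurableT_comp mpsi).
  exact: measurable_funM.
pose dl := Num.min 1 (b / 2); have dl0 : 0 < dl by rewrite lt_min ltr01.
have dl1 : dl <= 1 by rewrite ge_min lexx.
have dlb : dl <= b / 2 by rewrite ge_min lexx orbT.
exists (Num.truncn (L / dl)).+1 => P P0P P_gt0.
have PR : 0 < P%:R :> R by rewrite ltr0n.
have LP0 : 0 <= L / P%:R by rewrite divr_ge0.
have LP : L / P%:R <= dl.
  rewrite ler_pdivrMr// mulrC -ler_pdivrMr// (le_trans (ltW (truncnS_gt _)))//.
  by rewrite ler_nat.
have LPb : (L / P%:R) ^+ 2 <= b / 2.
  rewrite (le_trans _ dlb)// expr2 (le_trans (ler_wpM2l LP0 LP))//.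
  by rewrite (le_trans (ler_wpM2r (ltW dl0) LP))// ler_piMr// ltW.
exists (fun i => psi (i%:R / P%:R) *: v), (fun s => `|v| * (`|del s| + L / P%:R)); split.
- apply: measurable_funM => //; apply: measurable_funD => //.
  exact: measurableT_comp.
- by move=> s; rewrite mulr_ge0// addr_ge0// divr_ge0.
- have mF : measurable_fun setT (fun s : R => del s ^+ 2) by exact: measurable_funX.
  have I1 : (\int[mu]_(s in `[0%R, t]) (`|del s| ^+ 2)%:E <= (t * (b / 2))%:E)%E.
    under eq_integral do rewrite real_normK ?num_real//.
    rewrite (int_scaling t0 mF) => [|s]; last exact: sqr_ge0.
    rewrite EFinM lee_wpmul2l ?lee_fin ?(ltW t0)//.
    under eq_integral do rewrite /del mulrAC divff ?gt_eqF// mul1r.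
    exact: Hpsi.
  have I2 : (\int[mu]_(s in `[0%R, t]) ((L / P%:R) ^+ 2)%:E <= (b / 2 * t)%:E)%E.
    by rewrite int_sqr_cst// lee_fin ler_wpM2r// ltW.
  have mabs : measurable_fun setT (fun s : R => `|del s|) by exact: measurableT_comp.
  have := integral_sqrD_le (measurable_itv `[0, t]) mabs (measurable_cst _) I1 I2.
  have -> : (2 * (t * (b / 2)) + 2 * (b / 2 * t)) = 2 * t * b by field.
  move=> I3; under eq_integral do rewrite exprMn EFinM.
  rewrite ge0_integralZl//; last 2 first.
  + apply/measurable_EFinP; apply: measurable_funTS; apply: measurable_funX.
    exact: measurable_funD.
  + by move=> s _; rewrite lee_fin sqr_ge0.
  apply: (le_trans (lee_wpmul2l _ I3)); first by rewrite lee_fin sqr_ge0.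
  rewrite -EFinM lee_fin -be mulrC; apply: ler_wpM2l.
    by apply: mulr_ge0; [apply: mulr_ge0 => //|]; exact: ltW.
  by apply: lerXn2r; rewrite ?nnegrE ?lerDl// ltW.
- move=> i iP; apply: aeW => s /andP[h1 h2]; rewrite -scalerBl normrZ mulrC ler_wpM2l//.
  rewrite (le_trans (ler_distD (psi (s / t)) _ _))// lerD2l (le_trans (psiL _ _))//.
  have it : i%:R / P%:R = i%:R * (t / P%:R) / t by field; rewrite !gt_eqF.
  have it1 : i.+1%:R * (t / P%:R) = i%:R * (t / P%:R) + t / P%:R by rewrite -natr1; ring.
  have t0' := ltW t0.
  rewrite ler_wpM2l// it -mulrBl ger0_norm ?divr_ge0 ?subr_ge0//.
  by rewrite ler_pdivrMr// mulrC; move: h2; rewrite it1; lra.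
Qed.

Lemma stepappr_ext (t : R) (f g : R -> W) : 0 < t -> (forall s, 0 <= s <= t -> f s = g s) ->
  stepappr t g -> stepappr t f.
Proof.
move=> t0 fg gA; apply: (stepappr_close t0) => e e0; exists g, (cst 0); split => //.
- under eq_integral do rewrite expr0n /=.
  by rewrite integral0 lee_fin ltW.
- by apply: aeW => s s0t; rewrite fg// subrr normr0.
Qed.

Lemma stepappr_sum (t : R) (r : seq W) (p : W -> R -> R) : 0 < t ->
  (forall v, measurable_fun setT (p v)) -> (forall v s, `|p v s| <= 1) ->
  stepappr t (fun s => \sum_(v <- r) p v s *: v).
Proof.
move=> t0 mp p1; elim: r => [|v r IH].
  apply: (@stepappr_ext _ _ (fun s => cst 0 s *: (0 : W))) => //.
    by move=> s _; rewrite big_nil scaler0.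
  by apply: (@stepappr_scale _ _ 1) => // s; rewrite normr0.
apply: (@stepappr_ext _ _ (fun s => p v s *: v + \sum_(v <- r) p v s *: v)) => //.
  by move=> s _; rewrite big_cons.
by apply: stepappr_add => //; exact: stepappr_scale.
Qed.

Lemma stepappr_simple (t : R) (u : R -> W) : 0 < t -> simple_on `[0, t] u -> stepappr t u.
Proof.
move=> t0 [/finite_seqP[r ur] mu_].
pose A v := (`[0, t] `&` u @^-1` [set v] : set (measurableTypeR R)).
have mA v : measurable (A v) by exact: mu_.
apply: (@stepappr_ext _ _ (fun s => \sum_(v <- undup r) (\1_(A v) s) *: v)) => //; last first.
  apply: (@stepappr_sum t (undup r) (fun v => \1_(A v))) t0 _ _ => v.
    by apply: measurable_indic; exact: mA.
  by move=> s; rewrite indicE; case: (s \in A v) => /=; rewrite ?normr0 ?normr1.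
move=> s s0t.
have Is : `[0, t]%classic s by rewrite /= in_itv.
have usr : u s \in undup r.
  by rewrite mem_undup; have : [set` r] (u s) by rewrite -ur; exists s.
rewrite (bigD1_seq (u s)) ?undup_uniq//= indicE mem_set ?scale1r ?big1 ?addr0//.
move=> v vu; rewrite indicE memNset ?scale0r// => -[_ /= uv].
by rewrite uv eqxx in vu.
Qed.

(** Simple functions [s_ k] converge to [d] almost everywhere without any bound on
    their norms.  Replacing [s_ k] by 0 where its norm exceeds twice that of [d]
    keeps the convergence, since there the norm of [d] is at most the distance to
    [s_ k], and makes [3 * g] a dominating function, where [g] is the norm of [d]. *)
Lemma stepappr_L2 (t : R) (d : R -> W) : 0 < t -> strongly_measurable `[0, t] d ->
  (\int[mu]_(s in `[0%R, t]) (`|d s| ^+ 2)%:E < +oo)%E -> stepappr t d.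
Proof.
move=> t0 dS dfin; have mI : measurable (`[0, t]%classic : set (measurableTypeR R)) by [].
have cnorm (v : W) : continuous (fun x => `|x - v|).
  by move=> x; apply: cvg_norm; apply: cvgB; [exact: cvg_id|exact: cvg_cst].
have pos (x v : W) : 0 <= `|x - v| by [].
have [g [mg g_le g_ae]] := bochner_measurable (phi := fun x v => `|x - v|) mI dS (simple_on_cst 0 mI) cnorm pos.
have [s_ [ss sd]] := dS.
have /choice[e_ He] k : exists g : R -> R, [/\ measurable_fun setT g, forall s, 0 <= g s <= `|d s - s_ k s| &
    {ae mu, forall s, `[0, t]%classic s -> g s = `|d s - s_ k s|}].
  exact: (bochner_measurable (phi := fun x v => `|x - v|) mI dS (ss k) cnorm pos).
pose Bk k := (`[0, t]%classic `&` [set s | `|s_ k s| - 2 * g s <= 0] : set (measurableTypeR R)).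
have mBk k : measurable (Bk k).
  have m1 : measurable_fun (`[0, t]%classic : set (measurableTypeR R)) (fun s : measurableTypeR R => `|s_ k s| - 2 * g s).
    apply: measurable_funB; last by apply: measurable_funTS; exact: measurable_funM.
    exact: (measurable_simple2 (fun x _ => `|x|) mI (ss k) (ss k)).
  rewrite (_ : Bk k = `[0, t]%classic `&` (fun s => `|s_ k s| - 2 * g s) @^-1` `]-oo, 0]).
    exact: m1 mI _ (measurable_itv _).
  by apply/seteqP; split => s /=; rewrite ?in_itv.
pose E_ k s := \1_(Bk k) s * e_ k s + (1 - \1_(Bk k) s) * g s.
have g_ge0 s : 0 <= g s by case/andP: (g_le s).
have EB k s : Bk k s -> E_ k s = e_ k s.
  by move=> h; rewrite /E_ indicE mem_set// subrr mul0r addr0 mul1r.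
have EnB k s : ~ Bk k s -> E_ k s = g s.
  by move=> h; rewrite /E_ indicE memNset// subr0 mul0r add0r mul1r.
have mE k : measurable_fun setT (E_ k).
  have [me _ _] := He k.
  by apply: measurable_funD; apply: measurable_funM => //; apply: measurable_funB.
have E0 k s : 0 <= E_ k s.
  have [_ /(_ s)/andP[h _] _] := He k.
  by have [hB|hB] := pselect (Bk k s); [rewrite EB|rewrite EnB; first exact: g_ge0].
have E_le k : {ae mu, forall s, `[0, t]%classic s -> E_ k s <= `|d s - s_ k s| /\ E_ k s <= 3 * g s}.
  have [_ e_le _] := He k.
  apply: ae_filterS g_ae => s gs Is.
  have {}gs := gs Is; rewrite /= subr0 in gs; have /andP[_ h] := e_le s.
  have [hB|hB] := pselect (Bk k s).
    rewrite EB//; split => //; apply: (le_trans h); apply: (le_trans (ler_normB _ _)).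
    by case: hB => _ /=; rewrite -gs; lra.
  rewrite EnB//; split; last by have := g_ge0 s; lra.
  have : ~ (`|s_ k s| - 2 * g s <= 0) by move=> h'; apply: hB.
  move/negP; rewrite -ltNge => h'; have := lerB_dist (s_ k s) (d s).
  by rewrite distrC -gs; lra.
apply: (stepappr_close t0) => e e0.
have sq_le (a b : R) : 0 <= a -> a <= b -> a ^+ 2 <= b ^+ 2.
  by move=> a0 ab; rewrite lerXn2r// nnegrE (le_trans a0).
have gfin : mu.-integrable `[0, t] (EFin \o (fun s => 9 * g s ^+ 2)).
  apply/integrableP; split.
    by apply/measurable_EFinP; apply: measurable_funTS; apply: measurable_funM => //; exact: measurable_funX.
  under eq_integral do rewrite /= ger0_norm ?mulr_ge0 ?sqr_ge0// EFinM.
  rewrite ge0_integralZl//; last 2 first.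
  - by apply/measurable_EFinP; apply: measurable_funTS; exact: measurable_funX.
  - by move=> s _; rewrite lee_fin sqr_ge0.
  rewrite lte_mul_pinfty ?lee_fin//; apply: le_lt_trans dfin.
  apply: ge0_le_integral_nonmeasurable => s _; rewrite lee_fin ?sqr_ge0//.
  by apply: sq_le => //; case/andP: (g_le s); rewrite subr0.
have [] := @dominated_convergence _ _ _ mu `[0, t] mI
  (fun k => EFin \o (fun s => E_ k s ^+ 2)) (cst 0%E) (EFin \o (fun s => 9 * g s ^+ 2)).
- by move=> k; apply/measurable_EFinP; apply: measurable_funTS; exact: measurable_funX.
- exact: measurable_cst.
- apply: ae_filterS2 (ae_foralln E_le) sd => s h1 h2 Is.
  apply: cvg_EFin; first exact: nearW.
  have c0 : E_ k s @[k --> \oo] --> 0.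
    apply: (@squeeze_cvgr _ _ _ _ (cst 0) (fun k => `|d s - s_ k s|)).
    - by apply: nearW => k; rewrite E0; case: (h1 k Is).
    - exact: cvg_cst.
    - have := cvg_norm (cvgB (cvg_cst (d s)) (h2 Is)).
      by rewrite subrr normr0; exact.
  by have := cvgM c0 c0; rewrite mulr0; exact.
- exact: gfin.
- apply: ae_filterS (ae_foralln E_le) => s h1 k Is.
  rewrite /= lee_fin ger0_norm ?sqr_ge0// (_ : 9 * g s ^+ 2 = (3 * g s) ^+ 2); last by ring.
  by apply: sq_le; [exact: E0|case: (h1 k Is)].
move=> _ _; rewrite integral0 => /fine_cvgP[[n0 _ fE] /cvgrPdist_le/(_ _ e0)[n1 _ cE]].
set k := maxn n0 n1.
have fn := fE k (leq_maxl _ _); have := cE k (leq_maxr _ _); rewrite /= sub0r normrN => H.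
rewrite /= in fn.
exists (fun s => \1_(Bk k) s *: s_ k s), (E_ k); split => //.
- apply: stepappr_simple => //; have [fs ms] := ss k; split.
    apply: (@sub_finite_set _ _ ((s_ k @` `[0, t]) `|` [set 0])).
      move=> _ [s Is <-] /=; rewrite indicE; case: (s \in Bk k); last by right; rewrite scale0r.
      by left; exists s => //; rewrite scale1r.
    by rewrite finite_setU; split.
  move=> v.
  rewrite (_ : _ `&` _ = (Bk k `&` (`[0, t]%classic `&` s_ k @^-1` [set v])) `|`
      ((`[0, t]%classic `\` Bk k) `&` [set _ | v = 0])).
    apply: measurableU; first by apply: measurableI; [exact: mBk|exact: ms].
    apply: measurableI; first by apply: measurableD; [exact: mI|exact: mBk].
    have [v0|v0] := pselect (v = 0).
      by rewrite (_ : [set _ | _] = setT)//; apply/seteqP; split.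
    by rewrite (_ : [set _ | _] = set0)//; apply/seteqP; split.
  apply/seteqP; split => s.
    move=> [Is /= us]; have [hB|hB] := pselect (Bk k s).
      by left; split => //; split => //=; rewrite -us indicE mem_set// scale1r.
    by right; split => //=; rewrite -us indicE memNset// scale0r.
  move=> [[hB [Is sv]]|[[Is hB] v0]]; split => //=.
    by rewrite indicE mem_set// scale1r.
  by rewrite indicE memNset// scale0r.
- exact: mE.
- by rewrite -(fineK fn) lee_fin (le_trans (ler_norm _) H).
- have [_ _ e_ae] := He k.
  apply: ae_filterS2 g_ae e_ae => s h1 h2 s0t.
  have Is : `[0, t]%classic s by rewrite /= in_itv.
  have [hB|hB] := pselect (Bk k s).
    by rewrite indicE mem_set// scale1r EB// h2.
  by rewrite indicE memNset// scale0r EnB// h1.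
Qed.

End TimeApprox.

(** * Passage to the limit *)

Section FinalEstimates.
Context {R : realType}.
Local Notation mu := (@lebesgue_measure R).

Lemma sqr_integrable (t e : R) (A : R -> R) : measurable_fun setT A ->
  (\int[mu]_(s in `[0%R, t]) (A s ^+ 2)%:E <= e%:E)%E ->
  mu.-integrable `[0, t] (EFin \o (fun s => A s ^+ 2)) /\ \int[mu]_(s in `[0, t]) (A s ^+ 2) <= e.
Proof.
move=> mA Ae; have Ai : mu.-integrable `[0, t] (EFin \o (fun s => A s ^+ 2)).
  apply/integrableP; split.
    by apply/measurable_EFinP; apply: measurable_funTS; exact: measurable_funX.
  under eq_integral do rewrite /= ger0_norm ?sqr_ge0//.
  by rewrite (le_lt_trans Ae)// ltry.
by split => //; rewrite -lee_fin -Rintegral_EFin.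
Qed.

(** From [A <= kap + A^2 / kap]. *)
Lemma integrable_of_sqr (t e kap : R) (A : R -> R) : 0 <= t -> 0 < kap -> measurable_fun setT A ->
  (forall s, 0 <= A s) ->
  (\int[mu]_(s in `[0%R, t]) (A s ^+ 2)%:E <= e%:E)%E ->
  mu.-integrable `[0, t] (EFin \o A) /\ \int[mu]_(s in `[0, t]) A s <= kap * t + e / kap.
Proof.
move=> t0 k0 mA A0 Ae; have [A2i A2e] := sqr_integrable mA Ae.
have mI : measurable (`[0, t]%classic : set (measurableTypeR R)) by [].
have ci : mu.-integrable `[0, t] (EFin \o cst kap).
  by apply: continuous_integrable => s; exact: cvg_cst.
have Bi : mu.-integrable `[0, t] (EFin \o (fun s => 1 * kap + kap^-1 * A s ^+ 2)).
  exact: (@integrable_lin _ _ (cst kap) (fun s => A s ^+ 2) 1 kap^-1).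
have AB s : A s <= 1 * kap + kap^-1 * A s ^+ 2.
  rewrite mul1r -(ler_pM2l k0) mulrDr mulrA divff ?gt_eqF// mul1r.
  by have := sqr_ge0 (A s - kap); have := A0 s; rewrite sqrrB expr2; nra.
have Ai : mu.-integrable `[0, t] (EFin \o A).
  apply: le_integrable Bi => //; first by apply/measurable_EFinP; exact: measurable_funTS.
  by move=> s _; rewrite /= lee_fin !ger0_norm// (le_trans (A0 s)).
split => //; apply: (@le_trans _ _ (\int[mu]_(s in `[0, t]) (1 * kap + kap^-1 * A s ^+ 2))).
  by apply: le_Rintegral => // s _; exact: AB.
rewrite (@RintegralDZ _ _ (cst kap) (fun s => A s ^+ 2) 1 kap^-1)// mul1r (Rintegral_cst_cc kap t0) subr0 lerD2l mulrC.
by rewrite ler_pM2r ?invr_gt0.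
Qed.

Lemma sum_pieces (h : R) (P : nat) (b : nat -> R) (p : R -> R) : 0 <= h ->
  (forall s, 0 <= p s) -> (forall i, 0 <= b i) -> mu.-integrable `[0, P%:R * h] (EFin \o p) ->
  (forall i, (i < P)%N -> {ae mu, forall s, i%:R * h <= s <= i.+1%:R * h -> b i <= p s}) ->
  h * \sum_(i < P) b i <= \int[mu]_(s in `[0, P%:R * h]) p s.
Proof.
move=> h0 p0 b0; elim: P => [|P IH] pi bp.
  by rewrite big_ord0 mulr0; exact: Rintegral_ge0.
have PS : P.+1%:R * h = P%:R * h + h by rewrite -natr1 mulrDl mul1r.
have P0 : 0 <= P%:R * h by rewrite mulr_ge0.
have PP : P%:R * h <= P.+1%:R * h by rewrite PS lerDl.
rewrite (Rintegral_cc_split P0 PP pi) big_ord_recr/= mulrDr lerD//.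
  apply: IH; first by apply: integrableS pi => //; apply: subset_itv; rewrite bnd_simp.
  by move=> i iP; apply: bp; rewrite ltnS ltnW.
have pi' : mu.-integrable `[P%:R * h, P.+1%:R * h] (EFin \o p).
  by apply: integrableS pi => //; apply: subset_itv; rewrite bnd_simp.
have -> : h * b P = \int[mu]_(s in `[P%:R * h, P.+1%:R * h]) (b P).
  by rewrite Rintegral_cst_cc// PS addrC addKr mulrC.
have ci : mu.-integrable `[P%:R * h, P.+1%:R * h] (EFin \o cst (b P)).
  by apply: continuous_integrable => s; exact: cvg_cst.
rewrite -lee_fin -!Rintegral_EFin//; apply: ae_ge0_le_integral => //.
- by move=> s _; rewrite lee_fin.
- by move=> s _; rewrite lee_fin.
- exact: measurable_int pi'.
apply: ae_filterS (bp P (ltnSn P)) => s h1.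
by rewrite /= in_itv/= => /h1; rewrite lee_fin.
Qed.

Lemma lipschitz_continuous (U W : normedModType R) (f : U -> W) (C : R) : 0 < C ->
  (forall x y, `|f x - f y| <= C * `|x - y|) -> continuous f.
Proof.
move=> C0 HC x; apply/cvgrPdist_le => e e0.
near=> y; rewrite (le_trans (HC _ _))// -ler_pdivlMl//.
near: y; apply: cvgr_dist_le; first exact: cvg_id.
by rewrite mulr_gt0 ?invr_gt0.
Unshelve. all: by end_near. Qed.

End FinalEstimates.

Section Core.
Context {R : realType} {n m q : nat}.
Variables (Lambda H : 'M[R]_n) (B : 'M[R]_(n, m)) (N : 'M[R]_(n, q))
  (K : 'M[R]_(m, n)) (ubar : 'cV[R]_m).
Hypothesis Lambda_diag : is_diag_mx Lambda.
Hypothesis Lambda_posdef : forall v : 'cV[R]_n, v != 0 -> 0 < (v^T *m Lambda *m v) 0 0.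
Hypothesis ubar_gt0 : forall i, 0 < ubar i 0.
Local Notation mu := (@lebesgue_measure R).
Local Notation A := (opA Lambda).
Local Notation DA := (domA H B K ubar).
Local Notation r := (fun i => (Lambda i i)^-1).
Local Notation G := (bc_map H B K ubar).
Variables (V : L2 R n -> R) (c1 c2 c3 chi : R).
Hypothesis V_differentiable : forall z, differentiable V z.
Hypotheses (c1_gt0 : 0 < c1) (c2_gt0 : 0 < c2) (c3_gt0 : 0 < c3) (chi_gt0 : 0 < chi).
Hypothesis V_bounds : forall z, DA z -> c1 * `|z| ^+ 2 <= V z <= c2 * `|z| ^+ 2.
Hypothesis V_dissipation : forall (d : L2 R q) z, DA z ->
  'd V z (A z + mulmxL2 N d) <= - c3 * V z + chi ^+ 2 * `|d| ^+ 2.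
Variables (d : R -> L2 R q) (X0 : L2 R n) (X : R -> L2 R n) (T : R).
Hypotheses (Xmild : mild_on A DA (mulmxL2 N \o d) X0 X T)
  (X_cont : {within `[0, T], continuous X}) (d_meas : strongly_measurable `[0, T] d)
  (X_0 : X 0 = X0).

Lemma C1c01_0 : C1c01 (cst 0 : R -> R).
Proof.
split; first by move=> z; exact: derivable_cst.
  by rewrite (_ : derive1 _ = cst 0); [move=> z; exact: cvg_cst|apply/funext => z; rewrite derive1_cst].
by exists 2^-1, 2^-1; split; rewrite ?invr_gt0// invf_lt1// ltr1n.
Qed.

(** The value at time 0 of a solution by characteristics. *)
Lemma nice_domA (x : 'I_n -> R -> R) : nice G x -> DA (st x).
Proof.
move=> xn; have [Y [Y' [<- _ YA _]]] := nice_evolution N Lambda_diag Lambda_posdef ubar_gt0 xn (fun=> C1c01_0).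
by have [] := YA 0; rewrite // lexx/= ltW// step_bound_gt0.
Qed.

Lemma forcing_measurable (v : L2 R n) : exists g : R -> R, [/\ measurable_fun setT g,
  forall s, 0 <= g s <= `|(mulmxL2 N \o d) s - v| &
  {ae mu, forall s, 0 <= s <= T -> `|(mulmxL2 N \o d) s - v| <= g s}].
Proof.
have mI : measurable (`[0, T]%classic : set (measurableTypeR R)) by [].
have [|//|g [mg g_le g_ae]] := bochner_measurable (phi := fun x (_ : L2 R q) => `|mulmxL2 N x - v|) mI d_meas (simple_on_cst 0 mI).
  have [C C0 HC] := mulmxL2_le N; move=> _.
  apply: (@lipschitz_continuous R _ R (fun x => `|mulmxL2 N x - v|) C C0) => x y.
  by rewrite (le_trans (ler_dist_dist _ _))// opprB addrA subrK mulmxL2B.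
exists g; split => //.
apply: ae_filterS g_ae => s h sT.
by rewrite h//= in_itv.
Qed.

(** The bound on the sum comes from
    [(a + b)^2 <= (1 + kap) * a^2 + (1 + kap^-1) * b^2], with [b] of order [kap] in
    L^2. *)
Lemma forcing_approx (t J kap : R) : 0 < t <= T ->
  (\int[mu]_(s in `[0%R, t]) (`|d s| ^+ 2)%:E <= J%:E)%E -> 0 < kap ->
  exists (P : nat) (dk : nat -> 'I_q -> R -> R) (th : R -> R),
  [/\ (0 < P)%N, t / P%:R <= step_bound Lambda, forall i j, C1c01 (dk i j),
     [/\ measurable_fun setT th, forall s, 0 <= th s,
      mu.-integrable `[0, t] (EFin \o th) & \int[mu]_(s in `[0, t]) th s <= kap * (t + 1)] &
     (forall i, (i < P)%N -> {ae mu, forall s, i%:R * (t / P%:R) <= s <= i.+1%:R * (t / P%:R) ->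
        `|d s - st (dk i)| <= th s}) /\
     t / P%:R * \sum_(i < P) `|st (dk i)| ^+ 2 <= (1 + kap) * J + kap ^+ 2 + kap].
Proof.
move=> /andP[t0 tT] dJ kap0.
have mI : measurable (`[0, t]%classic : set (measurableTypeR R)) by [].
have tT' : `[0, t]%classic `<=` `[0, T]%classic by apply: subset_itv; rewrite bnd_simp.
have dS : strongly_measurable `[0, t] d by exact: strongly_measurableS d_meas.
have e0 : 0 < kap ^+ 2 / 4 by rewrite divr_gt0// exprn_gt0.
have [P0 HP] := stepappr_L2 t0 dS (le_lt_trans dJ (ltry J)) e0.
have s0 := step_bound_gt0 Lambda_posdef.
pose P := (maxn P0 (Num.truncn (t / step_bound Lambda))).+1.
have [a [th [mth th0 the da]]] := HP P (leqW (leq_maxl _ _)) (ltn0Sn _).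
have PR : 0 < P%:R :> R by rewrite ltr0n.
have Pstep : t / P%:R <= step_bound Lambda.
  rewrite ler_pdivrMr// mulrC -ler_pdivrMr// (le_trans (ltW (truncnS_gt _)))//.
  by rewrite ler_nat ltnS leq_maxr.
(* The values of the step function are moved to smooth ones at distance [rho]; the
   squares of both errors then have integral at most [kap^2 / 4]. *)
pose rho := kap / (2 * (t + 1)); have rho0 : 0 < rho by rewrite divr_gt0// mulr_gt0// ltr_wpDl// ltW.
have /choice[dk dk_p] i : exists v : 'I_q -> R -> R, (forall j, C1c01 (v j)) /\ `|a i - st v| <= rho.
  by have [v v1 v2] := L2_dense (a i) rho0; exists v.
pose th' s := th s + rho.
have mth' : measurable_fun setT th' by exact: measurable_funD.
have th'0 s : 0 <= th' s by rewrite addr_ge0// ltW.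
have th'e : (\int[mu]_(s in `[0%R, t]) (th' s ^+ 2)%:E <= (kap ^+ 2)%:E)%E.
  have rhoe : (\int[mu]_(s in `[0%R, t]) (rho ^+ 2)%:E <= (kap ^+ 2 / 4)%:E)%E.
    rewrite int_sqr_cst// lee_fin /rho expr_div_n exprMn mulrAC.
    have t1 : 0 < t + 1 by rewrite ltr_wpDl// ltW.
    rewrite ler_pdivrMr ?mulr_gt0 ?exprn_gt0//.
    rewrite (_ : kap ^+ 2 / 4 * _ = kap ^+ 2 * (t + 1) ^+ 2); last by field.
    by rewrite ler_wpM2l ?sqr_ge0//; nra.
  have := integral_sqrD_le (measurable_itv `[0, t]) mth (measurable_cst rho) the rhoe.
  by rewrite (_ : 2 * (kap ^+ 2 / 4) + 2 * (kap ^+ 2 / 4) = kap ^+ 2)//; field.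
have [th'i th'I] := integrable_of_sqr (ltW t0) kap0 mth' th'0 th'e.
have [th2i th2I] := sqr_integrable mth' th'e.
have d_th' i : (i < P)%N -> {ae mu, forall s, i%:R * (t / P%:R) <= s <= i.+1%:R * (t / P%:R) ->
        `|d s - st (dk i)| <= th' s}.
  move=> iP; apply: ae_filterS (da i iP) => s h si.
  rewrite (le_trans (ler_distD (a i) _ _))// lerD ?h//.
  by have [] := dk_p i.
exists P, dk, th'; split => //.
- by move=> i j; have [] := dk_p i.
- split => //; rewrite (le_trans th'I)// mulrDr mulr1 lerD2l expr2 mulfK ?gt_eqF//.
split => //.
have cnorm (v : L2 R q) : continuous (fun x : L2 R q => `|x - v|).
  by apply: (@lipschitz_continuous R _ R _ 1) => // x y; rewrite mul1r (le_trans (ler_dist_dist _ _))// opprB addrA subrK.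
have aux (a0 b i k : R) : 0 <= k * a0 ^+ 2 - 2 * (a0 * b) + i * b ^+ 2 -> (b + a0) ^+ 2 <= (1 + k) * a0 ^+ 2 + (1 + i) * b ^+ 2.
  by rewrite sqrrD !mulrDl !mul1r => h; lra.
have pos (x v : L2 R q) : 0 <= `|x - v| by [].
have [g [mg g_le g_ae]] := bochner_measurable (phi := fun x v : L2 R q => `|x - v|) mI dS (simple_on_cst 0 mI) cnorm pos.
have gJ : (\int[mu]_(s in `[0%R, t]) (g s ^+ 2)%:E <= J%:E)%E.
  apply: (le_trans _ dJ); apply: ge0_le_integral_nonmeasurable => s _; rewrite lee_fin ?sqr_ge0//.
  have /andP[g0 gd] := g_le s; rewrite /= subr0 in gd.
  by rewrite lerXn2r// nnegrE.
have [g2i g2I] := sqr_integrable mg gJ.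
pose p s := (1 + kap) * g s ^+ 2 + (1 + kap^-1) * th' s ^+ 2.
have tP : P%:R * (t / P%:R) = t by rewrite mulrCA divff ?gt_eqF// mulr1.
have pI : mu.-integrable `[0, P%:R * (t / P%:R)] (EFin \o p).
  rewrite tP; exact: (@integrable_lin _ _ (fun s => g s ^+ 2) (fun s => th' s ^+ 2)).
have ki : 0 < kap^-1 by rewrite invr_gt0.
apply: (le_trans (@sum_pieces _ (t / P%:R) P (fun i => `|st (dk i)| ^+ 2) p _ _ _ pI _)).
- by rewrite divr_ge0// ltW.
- by move=> s; rewrite addr_ge0// mulr_ge0 ?sqr_ge0// addr_ge0// ltW.
- by move=> i; exact: sqr_ge0.
- move=> i iP; apply: ae_filterS2 (d_th' i iP) g_ae => s h1 h2 si.
  have := h1 si; have st' := grid_piece_itv t0 iP si.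
  have -> : `|d s - st (dk i)| = `|st (dk i) - d s| by exact: distrC.
  have := h2; rewrite /= in_itv st' => /(_ isT); rewrite subr0 => gE.
  have /= := ler_normD (st (dk i) - d s) (d s); rewrite subrK -gE => n1 n2.
  have {n1 n2} nn : `|st (dk i)| <= th' s + g s by rewrite (le_trans n1)// lerD2r.
  have g0 : 0 <= g s by case/andP: (g_le s).
  have : `|st (dk i)| ^+ 2 <= (th' s + g s) ^+ 2.
    by apply: sqr_le_sqr; rewrite normr_id.
  move=> /le_trans; apply; rewrite /p.
  have := mulr_ge0 (ltW ki) (sqr_ge0 (kap * g s - th' s)).
  rewrite (_ : kap^-1 * _ = kap * g s ^+ 2 - 2 * (g s * th' s) + kap^-1 * th' s ^+ 2); last first.
    by field; rewrite gt_eqF.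
  exact: aux.
rewrite tP /p (@RintegralDZ _ _ (fun s => g s ^+ 2) (fun s => th' s ^+ 2))// -addrA lerD//.
  by rewrite ler_wpM2l// addr_ge0// ltW.
apply: (le_trans (ler_wpM2l _ th2I)); first by rewrite addr_ge0// ltW.
by rewrite mulrDl mul1r lerD2l expr2 mulKf ?gt_eqF//.
Qed.

(** For [t > 0], a smooth approximation of [X0] is propagated along a step
    approximation of the disturbance; [chain] bounds its distance to the mild
    solution and the growth of V. *)
Lemma approximate_decay (t J del : R) : 0 <= t <= T ->
  (\int[mu]_(s in `[0%R, t]) (`|d s| ^+ 2)%:E <= J%:E)%E -> 0 < del ->
  exists x x', [/\ DA x, DA x', `|X0 - x| <= del, `|X t - x'| <= del &
    V x' <= expR (- c3 * t) * V x + chi ^+ 2 * (J + del)].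
Proof.
move=> /andP[t0 tT] dJ del0.
have J0 : 0 <= J by rewrite -lee_fin (le_trans _ dJ)//; apply: integral_ge0 => s _; rewrite lee_fin sqr_ge0.
have l0 := Lambda_gt0 Lambda_posdef.
have r0 i : 0 < (Lambda i i)^-1 by rewrite invr_gt0.
have [k k0 Gk] := bc_map_lip H B K ubar_gt0.
have [w w0 dissip] := @opA_dissipative R n Lambda G k DA Lambda_diag l0 k0 Gk (fun x Dx => Dx).
have [c c0 Nc] := @wnorm_le R n r k r0 k0.
have [c' c'0 Nc'] := @le_wnorm R n r k r0 k0.
have [CN CN0 HCN] := mulmxL2_le N.
pose E := expR (2 * w * t); have E0 : 0 < E by exact: expR_gt0.
pose M := c' * (E * (c + c * CN * (t + 1))).
have t1 : 0 < t + 1 by rewrite ltr_wpDl.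
have M0 : 0 < M by rewrite !mulr_gt0// addr_gt0// !mulr_gt0.
pose kap := Num.min (Num.min 1 (del / M)) (Num.min del (del / (J + 2))).
have J2 : 0 < J + 2 by rewrite ltr_wpDl.
have kap0 : 0 < kap by rewrite !lt_min ltr01 del0 !divr_gt0.
have kap1 : kap <= 1 by rewrite !ge_min lexx.
have kapM : kap <= del / M by rewrite !ge_min lexx !orbT.
have kapd : kap <= del by rewrite !ge_min lexx !orbT.
have kapJ : kap <= del / (J + 2) by rewrite !ge_min lexx !orbT.
have [v v_c v_le] := L2_dense X0 kap0.
have v_nice := C1c01_nice H B K ubar v_c.
(* At [t = 0] there is no grid, and the two states coincide. *)
have := t0; rewrite le_eqVlt => /predU1P[t0E|tp].
  exists (st v), (st v); split; rewrite -?t0E ?X_0 ?(le_trans v_le)//; try exact: nice_domA.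
  by rewrite mulr0 expR0 mul1r lerDl; apply: mulr_ge0; [exact: sqr_ge0|apply: addr_ge0 => //; exact: ltW].
have tpT : 0 < t <= T by rewrite tp.
have [P [dk [th [P0 Pstep dk_c [mth th0 thi thI] [d_th dkJ]]]]] := forcing_approx tpT dJ kap0.
have PR : 0 < P%:R :> R by rewrite ltr0n.
have tP : P%:R * (t / P%:R) = t by rewrite mulrCA divff ?gt_eqF// mulr1.
have h0 : 0 < t / P%:R <= step_bound Lambda by rewrite divr_gt0.
have PT : P%:R * (t / P%:R) <= T by rewrite tP.
have th'i : mu.-integrable `[0, P%:R * (t / P%:R)] (EFin \o (fun s => CN * th s)).
  by rewrite tP; apply: integrable_scale.
have th'0 s : 0 <= CN * th s by rewrite mulr_ge0// ltW.
have f_th i : (i < P)%N -> {ae mu, forall s, i%:R * (t / P%:R) <= s <= i.+1%:R * (t / P%:R) ->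
    `|(mulmxL2 N \o d) s - mulmxL2 N (st (dk i))| <= CN * th s}.
  move=> iP; apply: ae_filterS (d_th i iP) => s h si.
  by rewrite /= mulmxL2B (le_trans (HCN _))// ler_pM2l// h.
have [x' [x'_nice]] := chain Lambda_diag Lambda_posdef ubar_gt0 V_differentiable c3_gt0 V_dissipation
  k0 w0 c0 dissip Nc Xmild X_cont forcing_measurable h0 PT v_nice dk_c th'i th'0 f_th.
rewrite tP X_0 => Nx Vx.
exists (st v), (st x'); split; [exact: nice_domA|exact: nice_domA|exact: le_trans v_le kapd| |].
- rewrite (le_trans (Nc' _))// (le_trans (ler_wpM2l (ltW c'0) Nx))//.
  have I1 : \int[mu]_(s in `[0, t]) (CN * th s) <= CN * (kap * (t + 1)).
    rewrite RintegralZl// ler_pM2l//.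
  have I2 : wnorm r k (X0 - st v) <= c * kap by rewrite (le_trans (Nc _))// ler_pM2l.
  apply: (@le_trans _ _ (M * kap)); last by rewrite mulrC -ler_pdivlMr.
  rewrite (_ : M * kap = c' * (E * (c * kap + c * (CN * (kap * (t + 1)))))); last by rewrite /M; ring.
  by rewrite ler_pM2l// ler_pM2l// lerD// ler_pM2l.
- apply: (le_trans Vx); rewrite lerD2l ler_wpM2l ?sqr_ge0// (le_trans dkJ)//.
  have kapJ' : kap * (J + 2) <= del by rewrite -ler_pdivlMr.
  have kap2 : kap ^+ 2 <= kap by rewrite expr2 ler_piMr// ltW.
  by rewrite mulrDl mul1r; lra.
Qed.

Lemma mild_bound (t J : R) : 0 <= t <= T ->
  (\int[mu]_(s in `[0%R, t]) (`|d s| ^+ 2)%:E <= J%:E)%E ->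
  `|X t| <= expR (- (c3 / 2) * t) * (c2 / c1) `^ 2^-1 * `|X0| + chi / Num.sqrt c1 * Num.sqrt J.
Proof.
move=> tT dJ.
have J0 : 0 <= J by rewrite -lee_fin (le_trans _ dJ)//; apply: integral_ge0 => s _; rewrite lee_fin sqr_ge0.
set al := expR (- (c3 / 2) * t) * (c2 / c1) `^ 2^-1.
set be := chi / Num.sqrt c1.
have c210 : 0 <= c2 / c1 by rewrite divr_ge0// ltW.
have al0 : 0 <= al by rewrite mulr_ge0 ?expR_ge0 ?powR_ge0.
have be0 : 0 <= be by rewrite divr_ge0 ?sqrtr_ge0// ltW.
have al2 : al ^+ 2 = expR (- c3 * t) * (c2 / c1).
  rewrite exprMn -expRM_natl powR12_sqrt// sqr_sqrtr//; congr (expR _ * _).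
  by field.
have be2 : be ^+ 2 = chi ^+ 2 / c1 by rewrite expr_div_n sqr_sqrtr// ltW.
clearbody al be; apply/ler_addgt0Pr => e e0.
have ab0 : 0 < 1 + al + be by rewrite -addrA ltr_pwDl// addr_ge0.
(* The tolerance is [dl^2], because it enters under a square root. *)
pose dl := Num.min 1 (e / (1 + al + be)).
have dl0 : 0 < dl by rewrite lt_min ltr01 divr_gt0.
have dl1 : dl <= 1 by rewrite ge_min lexx.
have dle : dl * (1 + al + be) <= e by rewrite -ler_pdivlMr// ge_min lexx orbT.
have dl2 : dl ^+ 2 <= dl by rewrite expr2 ler_piMr// ltW.
have [x [x' [Dx Dx' X0x Xtx' Vx']]] := approximate_decay tT dJ (exprn_gt0 2 dl0).
have nx : `|x| <= `|X0| + dl.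
  by rewrite -lerBlDl (le_trans (lerB_dist _ _))// distrC (le_trans X0x).
have nXt : `|X t| <= `|x'| + dl.
  by rewrite -lerBlDl (le_trans (lerB_dist _ _))// (le_trans Xtx').
have nx' : `|x'| <= al * `|x| + be * Num.sqrt (J + dl ^+ 2).
  have Jd : 0 <= J + dl ^+ 2 by rewrite addr_ge0// sqr_ge0.
  rewrite -(@ler_pXn2r _ 2)// ?nnegrE// ?addr_ge0 ?mulr_ge0 ?sqrtr_ge0//.
  apply: (@le_trans _ _ ((al * `|x|) ^+ 2 + (be * Num.sqrt (J + dl ^+ 2)) ^+ 2)); last first.
    rewrite sqrrD lerD2r lerDl mulrn_wge0// !mulr_ge0 ?sqrtr_ge0//.
  rewrite !exprMn al2 be2 sqr_sqrtr//.
  have /andP[b1 _] := V_bounds Dx'; have /andP[_ b2] := V_bounds Dx.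
  rewrite -(ler_pM2l c1_gt0) (le_trans b1)// (le_trans Vx')//.
  have -> : c1 * (expR (- c3 * t) * (c2 / c1) * `|x| ^+ 2 + chi ^+ 2 / c1 * (J + dl ^+ 2)) =
      expR (- c3 * t) * (c2 * `|x| ^+ 2) + chi ^+ 2 * (J + dl ^+ 2).
    by field; rewrite gt_eqF.
  by rewrite lerD2r ler_wpM2l// expR_ge0.
have sJ : Num.sqrt (J + dl ^+ 2) <= Num.sqrt J + dl.
  have sJ0 := sqrtr_ge0 J.
  rewrite -(@ler_pXn2r _ 2)// ?nnegrE ?sqrtr_ge0//; last by rewrite addr_ge0// ltW.
  rewrite sqrrD !sqr_sqrtr ?addr_ge0 ?sqr_ge0// -addrA lerD2l lerDr.
  by apply/mulrn_wge0/mulr_ge0 => //; exact: ltW.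
have := ler_wpM2l al0 nx; have := ler_wpM2l be0 sJ.
by move: nXt nx' dle; rewrite !mulrDr mulr1 (mulrC dl al) (mulrC dl be); lra.
Qed.

End Core.

(** * The estimate for mild solution pairs *)

Unset Implicit Arguments.

Theorem proposition4 (R : realType) (n m q : nat)
  (Lambda H : 'M[R]_n) (B : 'M[R]_(n, m)) (N : 'M[R]_(n, q))
  (K : 'M[R]_(m, n)) (ubar : 'cV[R]_m)
  (Lambda_diag : is_diag_mx Lambda)
  (Lambda_posdef : forall v : 'cV[R]_n, v != 0 ->
    0 < (v^T *m Lambda *m v) 0 0)
  (ubar_gt0 : forall i, 0 < ubar i 0)
  (V : L2 R n -> R) (c1 c2 c3 chi : R)
  (V_ge0 : forall zeta, 0 <= V zeta)
  (V_differentiable : forall zeta, differentiable V zeta)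
  (c1_gt0 : 0 < c1) (c2_gt0 : 0 < c2) (c3_gt0 : 0 < c3) (chi_gt0 : 0 < chi)
  (V_bounds : forall zeta, domA H B K ubar zeta ->
    c1 * `|zeta| ^+ 2 <= V zeta <= c2 * `|zeta| ^+ 2)
  (V_dissipation : forall (d : L2 R q) zeta, domA H B K ubar zeta ->
    'd V zeta (opA Lambda zeta + mulmxL2 N d)
      <= - c3 * V zeta + chi ^+ 2 * `|d| ^+ 2)
  (I : set R) (X : R -> L2 R n) (d : R -> L2 R q) (X0 : L2 R n)
  (Xd_mild : mild_pair (opA Lambda) (domA H B K ubar) (mulmxL2 N) X0 I X d) :
  forall t, I t ->
    (`|X t|%:E <=
      (expR (- (c3 / 2) * t) * (c2 / c1) `^ 2^-1 * `|X0|)%:E +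
      (chi / Num.sqrt c1)%:E *
        sqrte (\int[@lebesgue_measure R]_(theta in `[0%R, t]%classic)
          (`|d theta| ^+ 2)%:E))%E.
Proof.
move=> t It; have [X_cont [d_meas _] X_0 X_mild] := Xd_mild.
have [T [T_gt0 tT IT X_T]] : exists T : R, [/\ 0 < T, 0 <= t <= T, `[0, T]%classic `<=` I &
    mild_on (opA Lambda) (domA H B K ubar) (mulmxL2 N \o d) X0 X T].
  case: X_mild => [[T [T0 IE XT]]|[IE XT]].
    by exists T; split => //; [move: It; rewrite IE /= in_itv|rewrite IE].
  have t0 : 0 <= t by move: It; rewrite IE /= in_itv/= andbT.
  exists (t + 1); split; [by rewrite ltr_wpDl|by rewrite t0 lerDl ler01| |].
    by rewrite IE => s /=; rewrite !in_itv/= => /andP[->].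
  by apply: XT; rewrite ltr_wpDl.
have Xc : {within `[0, T], continuous X} by exact: continuous_subspaceW X_cont.
have dm : strongly_measurable `[0, T] d by exact: strongly_measurableS d_meas.
have chi0 : 0 < chi / Num.sqrt c1 by rewrite divr_gt0// sqrtr_gt0.
set J := (\int[_]_(theta in _) _)%E.
have J0 : (0 <= J)%E by apply: integral_ge0 => s _; rewrite lee_fin sqr_ge0.
have [Joo|Jfin] := eqVneq J +oo%E.
  by rewrite Joo /= gt0_muley ?lte_fin// addey// leey.
have JE : J = (fine J)%:E by rewrite fineK// ge0_fin_numE// ltey.
rewrite JE /= -EFinM -EFinD lee_fin.
have dJ : (\int[@lebesgue_measure R]_(s in `[0%R, t]) (`|d s| ^+ 2)%:E <= (fine J)%:E)%E.
  by rewrite -JE.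
exact: (mild_bound Lambda_diag Lambda_posdef ubar_gt0 V_differentiable c1_gt0 c2_gt0 c3_gt0 chi_gt0
  V_bounds V_dissipation X_T Xc dm X_0 tT dJ).
Qed.
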